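(* For every integer $k \geq 4$ there exist constants $c = c(k) > 0$ and $C = C(k) > 0$ such that for all integers $r \geq 3$, $$ c\, r^2 \frac{\ln r}{\ln \ln r} \;\leq\; s_r(K_k) \;\leq\; C\, r^2 (\ln r)^{8(k-1)^2}. $$
   Context: All graphs are finite and simple. For graphs $G,H$ and an integer $r\ge 1$, write $G \rightarrow (H)_r$ if every colouring of the edges of $G$ with $r$ colours contains a monochromatic copy of $H$. A graph $G$ is $r$-Ramsey-minimal for $H$ if $G \rightarrow (H)_r$ but no proper subgraph $G' \subsetneq G$ satisfies $G' \rightarrow (H)_r$. Define $s_r(H) := \min \delta(G)$, the minimum taken over all graphs $G$ that are $r$-Ramsey-minimal for $H$, where $\delta(G)$ is the minimum degree. $K_k$ denotes the complete graph on $k$ vertices. *)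

(* Defs.v *)
From HB Require Import structures.
From Stdlib Require Export Reals.
From mathcomp Require Import all_boot.

Set Implicit Arguments.
Unset Strict Implicit.
Unset Printing Implicit Defensive.

Definition simple_graph (n : nat) (e : rel 'I_n) : Prop :=
  (forall u v, e u v = e v u) /\ (forall v, e v v = false).

Definition complete_rel (k : nat) : rel 'I_k := fun i j => i != j.
Arguments complete_rel : clear implicits.

(* A (sub)graph of a graph on T, given by a vertex set V and an edge relation E
   (edges assumed symmetric, inside V). G -> (H)_r : every r-colouring of the
   edges contains a monochromatic copy of H (H on 'I_m with edge relation h).
   A colouring is a function on ordered pairs that is symmetric on edges, i.e.
   a function on the (unordered) edges. A copy of H is an injective map of
   vertices into V sending H-edges to E-edges. *)
Definition arrows (T : finType) (V : {set T}) (E : rel T)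
  (m : nat) (h : rel 'I_m) (r : nat) : Prop :=
  forall col : T -> T -> 'I_r,
    (forall u v, E u v -> col u v = col v u) ->
    exists (c : 'I_r) (f : 'I_m -> T),
      injective f /\ (forall i, f i \in V) /\
      (forall i j, h i j -> E (f i) (f j) /\ col (f i) (f j) = c).

Definition ramsey_minimal (n : nat) (e : rel 'I_n)
  (m : nat) (h : rel 'I_m) (r : nat) : Prop :=
  simple_graph e /\ arrows [set: 'I_n] e h r /\
  forall (V : {set 'I_n}) (E' : rel 'I_n),
    (forall u v, E' u v = E' v u) ->
    (forall u v, E' u v -> [&& u \in V, v \in V & e u v]) ->
    (V != [set: 'I_n] \/ exists u v, E' u v != e u v) ->
    ~ arrows V E' h r.

Definition degree (n : nat) (e : rel 'I_n) (v : 'I_n) : nat :=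
  #|[set u | e v u]|.

(* Minimum degree (for n > 0 this is the true minimum since degrees are < n). *)
Definition min_degree (n : nat) (e : rel 'I_n) : nat :=
  \big[minn/n]_(v : 'I_n) degree e v.

Definition is_s_r (r : nat) (m : nat) (h : rel 'I_m) (s : nat) : Prop :=
  (exists (n : nat) (e : rel 'I_n), ramsey_minimal e h r /\ min_degree e = s) /\
  (forall (n : nat) (e : rel 'I_n), ramsey_minimal e h r -> s <= min_degree e).

(* Main.v *)
(** For the upper bound, suppose that some graph is not r-Ramsey for [K_k] but
    contains a set [P] of vertices on which every good colouring induces
    edge-disjoint [K_k]-free graphs such that each r-colouring of [P] has a
    [K_{k-1}] all of whose vertices and edges have the same colour.
    Joining one new vertex to [P] then makes the graph r-Ramsey, and every minimal
    r-Ramsey subgraph contains the new vertex, whose degree is at most [#|P|].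
    Such a graph is assembled from copies of one gadget: a non-Ramsey graph with
    an induced star that no good colouring makes monochromatic.  The gadget comes
    from a minimal Ramsey graph with an edge [uv] deleted, in which every good
    colouring uses all colours at [u].

    The pattern lives on the affine plane over a field with [q = 2 ^ h] elements.
    Each colour owns [d = O(h)] slopes; every line of such a slope is randomly
    partitioned into [s = k - 1] parts, pairs from distinct parts of a line become
    edges with a small probability, and a maximal edge-disjoint family of
    non-collinear [K_{s+1}] is deleted.  Every set of [q * polylog q] points still
    contains a [K_s], because it contains many edge-disjoint candidates.

    For the lower bound, a vertex of degree [m] in a minimal graph gives [r]
    edge-disjoint [K_k]-free graphs on its neighbourhood that admit no vertex
    colouring with the [i]-th class independent in the [i]-th graph.  Colouring
    greedily with the large independent sets given by Shearer's theorem for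
    [K_k]-free graphs shows that [m] is at least of order [r^2 ln r / ln ln r]. *)

Require Import Defs.
From Stdlib Require Import Reals Lra Classical.
From mathcomp Require Import all_boot perm ssralg finalg finfield zify.

Set Implicit Arguments.
Unset Strict Implicit.
Unset Printing Implicit Defensive.

(** * Good colourings and gluing *)

(** No graph can force the intended colours outright, since permuting the palette turns good
    colourings into good colourings. Gadgets force something weaker: at each pattern vertex, the
    intended colours are renamed by a bijection depending on that vertex. An edge of intended colour
    [j] makes the two renamings of [j] at its ends agree, which is all that a monochromatic clique
    needs. A gadget should sit on leaves that happen to share a colour, but these are known only
    after the colouring. So one copy is attached for every function from its vertices to the leaves,
    and the pigeonhole principle picks the useful copy. A full line would be a huge clique of the
    collinearity graph; splitting it into s = k - 1 parts caps its cliques at s. The edge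
    probability is of order h^(-2), just enough to make other cliques on s + 1 points rare. A
    candidate K_s then survives with probability of order h^(-2 C(s,2)), which forces q to be about
    r h^(2 C(s,2)). The degree q^2 thus carries the exponent 4 C(s,2) = 2(k-1)(k-2), within the
    claimed 8(k-1)^2. Probabilities appear as exact counts of finite functions, so union bounds are
    inequalities between natural numbers. *)

Section Colourings.
Variables (T : finType) (r : nat).
Implicit Types (E : rel T) (col : T -> T -> 'I_r) (c : 'I_r) (K : {set T}).

Definition simple_rel E := (forall u v, E u v = E v u) /\ (forall v, E v v = false).

Definition mono_clique E col c K :=
  forall x y, x \in K -> y \in K -> x != y -> E x y /\ col x y = c.

(** Symmetry is required on all pairs and not only on edges, and cliques are vertex sets instead of
    maps; both make restriction along an injection immediate. *)
Definition good_colouring (k : nat) E col :=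
  (forall x y, col x y = col y x) /\
  forall c K, mono_clique E col c K -> #|K| < k.

Definition colourable k E := exists col, good_colouring k E col.

Lemma subset_card_exists K k : k <= #|K| -> exists2 K' : {set T}, K' \subset K & #|K'| = k.
Proof.
elim: k => [|k IH] kK; first by exists set0; rewrite ?sub0set ?cards0.
have [K' sK' cK'] := IH (ltnW kK).
have /card_gt0P [x] : 0 < #|K :\: K'|.
  by rewrite cardsD (setIidPr sK') cK' subn_gt0.
rewrite inE => /andP[xK' xK]; exists (x |: K').
  by rewrite subUset sub1set xK.
by rewrite cardsU1 xK' cK'.
Qed.

Lemma clique_of_fun k E col c (f : 'I_k -> T) : injective f ->
  (forall i j, complete_rel k i j -> E (f i) (f j) /\ col (f i) (f j) = c) ->
  mono_clique E col c (f @: setT) /\ #|f @: setT| = k.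
Proof.
move=> finj fP; split; last by rewrite card_imset // cardsT card_ord.
move=> _ _ /imsetP[i _ ->] /imsetP[j _ ->] ij; apply: fP.
by apply: contraNN ij => /eqP->.
Qed.

Lemma fun_of_clique k E col c K : mono_clique E col c K -> k <= #|K| ->
  exists f : 'I_k -> T, [/\ injective f, forall i, f i \in K &
  forall i j, complete_rel k i j -> E (f i) (f j) /\ col (f i) (f j) = c].
Proof.
move=> KP kK; have [K' sK' cK'] := subset_card_exists kK.
have inK (i : 'I_k) : enum_val (cast_ord (esym cK') i) \in K.
  by apply: (subsetP sK'); exact: enum_valP.
exists (fun i => enum_val (cast_ord (esym cK') i)); split => //.
  by move=> i j /enum_val_inj /cast_ord_inj.
move=> i j ij; apply: KP => //.
by apply: contraNN ij => /eqP /enum_val_inj /cast_ord_inj ->.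
Qed.

(** Off the edges the colouring is reset to a default colour to make it symmetric. Since [1 < k],
    every vertex of a large clique lies on an edge and hence in [V]. *)
Lemma not_arrows_colourable k E (V : {set T}) : 0 < r ->
  (forall u v, E u v = E v u) ->
  (forall u v, E u v -> u \in V) -> 1 < k ->
  ~ arrows V E (complete_rel k) r -> colourable k E.
Proof.
move=> r0 Esym EV k1 nar; have [col ncol] := not_all_ex_not _ _ nar.
have [colsym nf] := imply_to_and _ _ ncol.
pose c0 : 'I_r := Ordinal r0.
exists (fun x y => if E x y then col x y else c0); split.
  by move=> x y; rewrite (Esym y x); case: ifP => // /colsym.
move=> c K KP; rewrite ltnNge; apply/negP => kK; apply: nf; exists c.
have [f [finj fK fP]] := fun_of_clique KP kK.
exists f; split => //; split.
  move=> i; have [j ij] : exists j : 'I_k, i != j.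
    have : 0 < #|[set~ i]| by rewrite cardsC1 card_ord -subn1 subn_gt0.
    by case/card_gt0P => j; rewrite !inE eq_sym; exists j.
  by apply: (EV _ (f j)); case: (fP i j ij).
by move=> i j ij; have [e] := fP i j ij; rewrite e.
Qed.

Lemma colourable_not_arrows k E (V : {set T}) :
  colourable k E -> ~ arrows V E (complete_rel k) r.
Proof.
move=> [col [colsym colP]] /(_ col) []; first by move=> u v _; exact: colsym.
move=> c [f [finj [_ fP]]].
have [KP cK] := clique_of_fun finj fP.
by have := colP _ _ KP; rewrite cK ltnn.
Qed.

Lemma colourableS k E E' : (forall x y, E' x y -> E x y) ->
  colourable k E -> colourable k E'.
Proof.
move=> sub [col [colsym colP]]; exists col; split => // c K KP.
by apply: (colP c) => x y xK yK xy; have [/sub] := KP x y xK yK xy.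
Qed.

End Colourings.

Lemma good_pullback (S T : finType) r k (E : rel T) (E' : rel S)
    (g : S -> T) (col : T -> T -> 'I_r) :
  injective g -> (forall a b, E' a b -> E (g a) (g b)) ->
  good_colouring k E col -> good_colouring k E' (fun a b => col (g a) (g b)).
Proof.
move=> ginj gE [colsym colP]; split=> [x y|c K KP]; first exact: colsym.
rewrite -(card_imset (mem K) ginj); apply: (colP c) => _ _ /imsetP[a aK ->] /imsetP[b bK ->] ab.
have [|e <-] := KP a b aK bK; first by apply: contraNN ab => /eqP->.
by split => //; apply: gE.
Qed.

(** Selects a copy among those indexed by functions [V -> 'I_N]: its leaves all receive one colour.
    Injecting the whole of [V] spares a separate index type for the set of leaves. *)
Lemma pigeonhole_inj (V : finType) r N (c : 'I_N -> 'I_r) : r * #|V| < N ->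
  exists c0, exists2 f : {ffun V -> 'I_N}, injective f & forall v, c (f v) = c0.
Proof.
move=> rN.
have [c0 cc0] : exists c0, #|V| <= #|[set i | c i == c0]|.
  apply: NNPP => no; move: rN; rewrite ltnNge => /negP; apply.
  rewrite -[N in N <= _]card_ord -sum1_card (partition_big c xpredT) //=.
  rewrite -[r in r * _]card_ord -sum_nat_const; apply: leq_sum => j _.
  rewrite sum1_card leqNgt; apply/negP => /ltnW le; apply: no; exists j.
  by apply: leq_trans le _; apply: subset_leq_card; apply/subsetP => i; rewrite !inE.
exists c0; have [K' sK' cK'] := subset_card_exists cc0.
have e : #|V| = #|K'| by [].
exists [ffun v => enum_val (cast_ord e (enum_rank v))].
  by move=> v w; rewrite !ffunE => /enum_val_inj /cast_ord_inj /enum_rank_inj.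
move=> v; rewrite ffunE; apply/eqP.
by have /(subsetP sK') := enum_valP (cast_ord e (enum_rank v)); rewrite inE.
Qed.

Section Glue.
Variables (V X I : finType) (A : rel V) (B : rel X) (phi : I -> V -> option X).

(* Copies of the gadget [A] indexed by [I] are attached to [B]; [phi i v = Some x]
   identifies the vertex [v] of the copy [i] with [x]. Such identified vertices
   [inr (i, v)] remain in the type as isolated vertices. *)
Definition glue_emb (i : I) (v : V) : X + I * V :=
  if phi i v is Some x then inl x else inr (i, v).

(** Edges of a copy between two identified vertices are not added here: by [phi_edge] they are
    already edges of [B]. *)
Definition glue_rel : rel (X + I * V) := fun p q =>
  match p, q with
  | inl x, inl y => B x y
  | inl x, inr (i, v) => (phi i v == None) && [exists s, (phi i s == Some x) && A s v]
  | inr (i, v), inl x => (phi i v == None) && [exists s, (phi i s == Some x) && A s v]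
  | inr (i, v), inr (j, w) => [&& i == j, phi i v == None, phi i w == None & A v w]
  end.

Hypothesis Asimple : simple_rel A.
Hypothesis Bsimple : simple_rel B.
Hypothesis phi_inj : forall i a b x, phi i a = Some x -> phi i b = Some x -> a = b.
Hypothesis phi_edge : forall i a b x y,
  phi i a = Some x -> phi i b = Some y -> A a b = B x y.

Lemma glue_rel_simple : simple_rel glue_rel.
Proof.
case: Asimple => Asym Airr; case: Bsimple => Bsym Birr.
split; last by move=> [x|[i v]] //=; rewrite ?Birr ?Airr ?andbF.
move=> [x|[i v]] [y|[j w]] //=.
rewrite eq_sym; case: eqP => //= ->.
by rewrite Asym andbCA.
Qed.

Lemma glue_emb_inj i : injective (glue_emb i).
Proof.
move=> a b; rewrite /glue_emb.
by case ea: (phi i a) => [x|]; case eb: (phi i b) => [y|] // [] // e; subst; apply: phi_inj ea eb.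
Qed.

Lemma glue_emb_edge i a b : A a b = glue_rel (glue_emb i a) (glue_emb i b).
Proof.
case: Asimple => Asym Airr; rewrite /glue_emb.
case ea: (phi i a) => [x|]; case eb: (phi i b) => [y|] /=.
- exact: phi_edge ea eb.
- rewrite eb /=; apply/idP/existsP => [ab|[s /andP[/eqP es sb]]]; first by exists a; rewrite ea eqxx.
  by rewrite (phi_inj ea es).
- rewrite ea /=; rewrite Asym; apply/idP/existsP => [ab|[s /andP[/eqP es sb]]].
    by exists b; rewrite eb eqxx.
  by rewrite (phi_inj eb es).
- by rewrite ea eb !eqxx.
Qed.

Lemma glue_adj_emb i v p : glue_rel (inr (i, v)) p ->
  phi i v = None /\ exists w, p = glue_emb i w.
Proof.
case: p => [x|[j w]] /=.
  by case/andP=> /eqP -> /existsP[s /andP[/eqP es _]]; split=> //; exists s; rewrite /glue_emb es.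
by case/and4P => /eqP <- /eqP -> /eqP ew _; split=> //; exists w; rewrite /glue_emb ew.
Qed.

Variables (r k : nat).
Hypothesis k_gt1 : 1 < k.

Lemma glue_restrict i col : good_colouring k glue_rel col ->
  good_colouring k A (fun a b => col (glue_emb i a) (glue_emb i b) : 'I_r).
Proof. by apply: good_pullback; [exact: glue_emb_inj | move=> a b; rewrite (glue_emb_edge i)]. Qed.

(** No clique straddles two pieces: an unidentified vertex of copy [i] has all its neighbours in
    that copy, so a clique containing it lies in the copy, and any other clique lies in [B]. *)
Lemma glue_good (colB : X -> X -> 'I_r) (colA : I -> V -> V -> 'I_r) :
  good_colouring k B colB ->
  (forall i, good_colouring k A (colA i)) ->
  (forall i a b x y, phi i a = Some x -> phi i b = Some y -> A a b ->
     colA i a b = colB x y) ->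
  colourable r k glue_rel.
Proof.
move=> [Bsym' Bgood] Agood agree.
have Asym' i a b : colA i a b = colA i b a by case: (Agood i).
pose cross x i v := if [pick s | phi i s == Some x] is Some s then colA i s v else colA i v v.
(* Off the edges only symmetry matters. Between two copies the diagonal value from the copy of
   smaller rank is used; it also provides an element of ['I_r], which might be empty. *)
pose col (p q : X + I * V) : 'I_r := match p, q with
  | inl x, inl y => colB x y
  | inl x, inr (i, v) => cross x i v
  | inr (i, v), inl x => cross x i v
  | inr (i, v), inr (j, w) => if i == j then colA i v w else
       if enum_rank i < enum_rank j then colA i v v else colA j w w end.
have crossE x i s v : phi i s = Some x -> cross x i v = colA i s v.
  move=> es; rewrite /cross; case: pickP => [s' /eqP es'|/(_ s)]; last by rewrite es eqxx.
  by rewrite (phi_inj es es').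
have colE i a b : A a b -> col (glue_emb i a) (glue_emb i b) = colA i a b.
  move=> ab; rewrite /glue_emb; case ea: (phi i a) => [x|]; case eb: (phi i b) => [y|] /=.
  - by rewrite (agree i a b x y).
  - by rewrite (crossE _ _ _ _ ea).
  - by rewrite (crossE _ _ _ _ eb) Asym'.
  - by rewrite eqxx.
exists col; split.
  move=> [x|[i v]] [y|[j w]] //=.
  rewrite eq_sym; case: eqP => [->|/eqP ij]; first exact: Asym'.
  case: ltngtP => // /val_inj /enum_rank_inj e; by rewrite e eqxx in ij.
move=> c K KP.
have [inB|] := boolP [forall p in K, if p is inl _ then true else false].
  have [->|[p0 p0K]] := set_0Vmem K; first by rewrite cards0 ltnW.
  have EK : K = inl @: (inl @^-1: K).
    apply/setP => p; apply/idP/imsetP => [pK|[x]]; last by rewrite inE => xK ->.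
    move/forall_inP: inB => /(_ p pK); case: p pK => // x xK _.
    by exists x; rewrite ?inE.
  rewrite EK card_imset; last by move=> x y [].
  apply: (Bgood c) => x y; rewrite !inE => xK yK xy.
  by apply: (KP (inl x) (inl y) xK yK).
rewrite negb_forall_in => /exists_inP[[//|[i v]] vK _].
have [small|big] := leqP #|K| 1; first exact: leq_ltn_trans small k_gt1.
have adj p : p \in K -> p != inr (i, v) -> glue_rel (inr (i, v)) p.
  by move=> pK pv; case: (KP (inr (i, v)) p vK pK); rewrite // eq_sym.
have vN : phi i v = None.
  have /card_gt0P[p] : 0 < #|K :\ inr (i, v)| by rewrite (cardsD1 (inr (i, v))) vK ltnS in big.
  by rewrite !inE => /andP[pv pK]; case: (glue_adj_emb (adj p pK pv)).
have inr_emb p : p \in K -> exists w, p = glue_emb i w.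
  have [->|pv pK] := eqVneq p (inr (i, v)); first by exists v; rewrite /glue_emb vN.
  by case: (glue_adj_emb (adj p pK pv)).
have EK : K = glue_emb i @: (glue_emb i @^-1: K).
  apply/setP => p; apply/idP/imsetP => [pK|[x]]; last by rewrite inE => xK ->.
  by have [w e] := inr_emb p pK; exists w; rewrite // inE -e.
rewrite EK card_imset; last exact: glue_emb_inj.
apply: ((Agood i).2 c) => a b; rewrite !inE => aK bK ab.
have [|e1 e2] := KP _ _ aK bK; first by rewrite (inj_eq (@glue_emb_inj i)).
by rewrite -glue_emb_edge in e1; rewrite colE in e2.
Qed.

End Glue.

(** * Star gadgets *)

Definition star_gadget r k (V : finType) (A : rel V) (u : V) (W : {set V}) :=
  [/\ simple_rel A, colourable r k A, forall w, w \in W -> A u w,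
      forall w w', w \in W -> w' \in W -> ~~ A w w' &
      forall col : V -> V -> 'I_r, good_colouring k A col ->
        ~ (forall w w', w \in W -> w' \in W -> col u w = col u w')].

Definition has_star_gadget r k m :=
  exists (V : finType) (A : rel V) (u : V) (W : {set V}), star_gadget r k A u W /\ #|W| = m.

Definition star_rel (L : finType) : rel (option L) := fun p q => (p == None) != (q == None).

Lemma star_rel_simple (L : finType) : simple_rel (@star_rel L).
Proof. by split=> [u v|v]; rewrite /star_rel ?eqxx // eq_sym. Qed.

Lemma star_rel_good (L : finType) r k (c0 : 'I_r) : 2 < k ->
  good_colouring k (@star_rel L) (fun _ _ => c0).
Proof.
move=> k2; split=> // c K KP; rewrite ltnNge; apply/negP => kK.
have /card_gt1P[x [y [xK yK xy]]] : 1 < #|K :\ None|.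
  move: (leq_trans k2 kK); rewrite (cardsD1 None K).
  by case: (None \in K) => // /ltnW.
move: xK yK; rewrite !inE => /andP[xN xK] /andP[yN yK].
by have [] := KP x y xK yK xy; rewrite /star_rel (negbTE xN) (negbTE yN).
Qed.

(* Induction on the number of label classes: either some good colouring is
   constant on the star of the last class, and then gluing copies of [A] along
   a large star makes that class redundant, or this star is the gadget. *)
Lemma labelled_star_gadget r k a : 2 < k ->
  forall (V : finType) (A : rel V) (u : V) (lab : V -> nat),
  simple_rel A -> colourable r k A ->
  (forall v, lab v < a -> A u v) ->
  (forall v w, lab v < a -> lab v = lab w -> ~~ A v w) ->
  (forall col : V -> V -> 'I_r, good_colouring k A col ->
     ~ (forall v w, lab v < a -> lab v = lab w -> col u v = col u w)) ->
  exists m, has_star_gadget r k m.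
Proof.
move=> k2; elim: a => [|a IH] V A u lab As Ac Au Ai Ab.
  by case: Ac => col colP; case: (Ab col colP).
pose W := [set v | lab v == a].
have [[col0 [col0P col0W]]|no] := classic (exists col : V -> V -> 'I_r,
  good_colouring k A col /\ forall w w', w \in W -> w' \in W -> col u w = col u w'); last first.
  exists #|W|, V, A, u, W; split=> //; split=> //.
  - by move=> w; rewrite inE => /eqP e; apply: Au; rewrite e.
  - by move=> w w'; rewrite !inE => /eqP e /eqP e'; apply: Ai; rewrite e.
  - by move=> col colP cW; apply: no; exists col.
have [Asym Airr] := As.
have uW : u \notin W.
  by apply/negP; rewrite inE => /eqP e; have := Au u; rewrite e Airr ltnSn => /(_ isT).
(* Among this many leaves of the large star, some colour occurs on at least [#|V|] of them; the copy
   indexed by an injection into these leaves has a class [W] of one colour. *)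
set N := (r * #|V|).+1.
pose phi (i : {ffun V -> 'I_N}) (v : V) : option (option 'I_N) :=
  if v == u then Some None else
  if (v \in W) && injectiveb i then Some (Some (i v)) else None.
have phi_inj i x y z : phi i x = Some z -> phi i y = Some z -> x = y.
  rewrite /phi; case: (x =P u) => [->|_]; case: (y =P u) => [->|_] //.
  - by case: ifP => // _ [<-].
  - by case: ifP => // _ [<-].
  - case: ifP => // /andP[_ /injectiveP ii] [<-]; case: ifP => // _ [] e.
    exact/ii.
have phi_edge i x y z t : phi i x = Some z -> phi i y = Some t ->
    A x y = star_rel z t.
  rewrite /phi; case: (x =P u) => [->|_]; case: (y =P u) => [->|_] //.
  - by move=> [<-] [<-]; rewrite Airr.
  - move=> [<-]; case: ifP => // /andP[yW _] [<-] /=; apply: Au.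
    by move: yW; rewrite inE => /eqP->.
  - case: ifP => // /andP[yW _] [<-] [<-] /=; rewrite Asym; apply: Au.
    by move: yW; rewrite inE => /eqP->.
  - case: ifP => // /andP[xW _] [<-]; case: ifP => // /andP[yW _] [<-] /=.
    apply/negbTE; move: xW yW; rewrite !inE => /eqP xa /eqP ya.
    by apply: Ai; rewrite ?xa ?ya.
pose Q := glue_rel A (@star_rel _) phi.
pose u' : option 'I_N + {ffun V -> 'I_N} * V := inl None.
(* The value [a] means unlabelled from now on. The remaining classes are merged across all copies,
   so constancy on them passes to every copy, in particular to the one whose class [W] is constant,
   contradicting [Ab]. *)
pose lab' (p : option 'I_N + {ffun V -> 'I_N} * V) : nat :=
  if p is inr (i, v) then (if phi i v == None then lab v else a) else a.
have embu i : glue_emb phi i u = u' by rewrite /glue_emb /phi eqxx.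
apply: (IH _ Q u' lab').
- exact: glue_rel_simple As (star_rel_simple _).
- pose c0 := col0 u (odflt u [pick w in W]).
  have c0P w : w \in W -> col0 u w = c0.
    move=> wW; apply: col0W => //; rewrite /odflt; case: pickP => [//|/(_ w)].
    by rewrite wW.
  apply: (@glue_good _ _ _ A (@star_rel 'I_N) phi As phi_inj phi_edge r k (ltnW k2)
    (fun _ _ => c0) (fun _ => col0)).
  + exact: star_rel_good.
  + by [].
  + have Cs : forall x y, col0 x y = col0 y x by case: col0P.
    move=> i x y z t; rewrite /phi; case: (x =P u) => [->|_]; case: (y =P u) => [->|_] //.
    * by rewrite Airr.
    * by move=> _; case: ifP => // /andP[yW _] _ _; apply: c0P.
    * by case: ifP => // /andP[yW _] _ _ _; rewrite Cs; apply: c0P.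
    * case: ifP => // /andP[xW _] _; case: ifP => // /andP[yW _] _.
      move: xW yW; rewrite !inE => /eqP xa /eqP ya.
      by rewrite (negbTE (Ai x y _ _)) ?xa ?ya.
- move=> [x|[i v]] /=; rewrite ?ltnn //.
  case: eqP => [e la|]; rewrite ?ltnn //=; apply/existsP; exists u.
  by rewrite {1}/phi eqxx eqxx; apply: Au; apply: leq_trans la _.
- move=> [x|[i v]] [y|[j w]] /=; rewrite ?ltnn //; case: (phi i v =P None) => e; rewrite ?ltnn //.
  + by move=> la lv; rewrite lv ltnn in la.
  + case: (phi j w =P None) => e' la lv; first by rewrite (negbTE (Ai v w _ lv)) ?andbF // ltnS ltnW.
    by rewrite lv ltnn in la.
- move=> col colP cl.
  pose cx (x : 'I_N) : 'I_r := col u' (inl (Some x)).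
  have [c1 [iota iinj ic]] := pigeonhole_inj cx (ltnSn (r * #|V|)).
  have colP' := glue_restrict As phi_inj phi_edge iota colP.
  apply: (Ab _ colP') => v w la lvw; rewrite embu.
  have /injectiveP iinjb := iinj.
  have [lva|lva] := eqVneq (lab v) a.
    have E z : lab z = a -> glue_emb phi iota z = inl (Some (iota z)).
      move=> za; have zW : z \in W by rewrite inE za.
      rewrite /glue_emb /phi zW iinjb ifN //.
      by apply: contraNN uW => /eqP<-.
    by rewrite !E -?lvw // -/(cx _) -/(cx (iota w)) !ic.
  have lva' : lab v < a by rewrite ltn_neqAle lva -ltnS.
  have E z : lab z = lab v -> glue_emb phi iota z = inr (iota, z) /\ phi iota z = None.
    move=> zv; have zu : z != u.
      by apply/eqP => zu; have := Au v la; have := Ai v u la; rewrite -zv zu => /(_ erefl);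
         move/negP; rewrite Asym.
    have zW : z \notin W by rewrite inE zv.
    by rewrite /glue_emb /phi (negbTE zu) (negbTE zW).
  have [-> ev] := E v erefl; have [-> ew] := E w (esym lvw).
  by apply: cl; rewrite /= ?ev ?ew ?eqxx.
Qed.

(* Gluing many copies at [u] spreads the neighbourhood of [u] over independent classes. *)
Lemma star_gadget_exists r k (V : finType) (A : rel V) (u : V) : 2 < k ->
  simple_rel A -> colourable r k A ->
  (forall col : V -> V -> 'I_r, good_colouring k A col ->
     ~ (forall v w, A u v -> A u w -> col u v = col u w)) ->
  exists m, has_star_gadget r k m.
Proof.
move=> k2 As Ac Ab; have [Asym Airr] := As.
set a := (r * #|V|).+1.
pose phi (i : {ffun V -> 'I_a}) (v : V) : option unit := if v == u then Some tt else None.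
pose B : rel unit := fun _ _ => false.
have phi_inj i x y z : phi i x = Some z -> phi i y = Some z -> x = y.
  by rewrite /phi; case: (x =P u) => [->|_]; case: (y =P u) => [->|_].
have phi_edge i x y z t : phi i x = Some z -> phi i y = Some t -> A x y = B z t.
  by rewrite /phi; case: (x =P u) => [->|_]; case: (y =P u) => [->|_].
have Bs : simple_rel B by [].
pose u' : unit + {ffun V -> 'I_a} * V := inl tt.
(* A neighbour [v] of [u] in the copy [i] joins the class [i v]. Injectivity of [i] makes the
   classes independent; if all classes were constant, a copy indexed by an injection into classes of
   one common colour would be constant at [u]. *)
pose lab (p : unit + {ffun V -> 'I_a} * V) : nat :=
  if p is inr (i, v) then (if injectiveb i && A u v then i v : nat else a) else a.
have embu i : glue_emb phi i u = u' by rewrite /glue_emb /phi eqxx.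
have embN i v : A u v -> glue_emb phi i v = inr (i, v).
  by move=> uv; rewrite /glue_emb /phi ifN //; apply/eqP => e; rewrite e Airr in uv.
apply: (@labelled_star_gadget r k a k2 _ (glue_rel A B phi) u' lab).
- exact: glue_rel_simple.
- case: Ac => col0 col0P.
  pose c0 := col0 u u.
  apply: (@glue_good _ _ _ A B phi As phi_inj phi_edge r k (ltnW k2)
    (fun _ _ => c0) (fun _ => col0)) => //.
  + split=> // c K _; apply: leq_ltn_trans (max_card _) _.
    by rewrite card_unit ltnW.
  + move=> i x y z t; rewrite /phi; case: (x =P u) => [->|_]; case: (y =P u) => [->|_] //.
- move=> [x|[i v]] /=; rewrite ?ltnn //.
  case: ifP => [/andP[_ uv] _|]; rewrite ?ltnn //.
  have vu : v != u by apply/eqP => e; rewrite e Airr in uv.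
  rewrite /phi (negbTE vu) eqxx /=; apply/existsP; exists u.
  by rewrite eqxx.
- move=> [x|[i v]] [y|[j w]] /=; rewrite ?ltnn //.
    by case: ifP; rewrite ?ltnn // => _ _ e; have := ltn_ord (i v); rewrite e ltnn.
  case: ifP => [/andP[/injectiveP ii _] _|]; rewrite ?ltnn //.
  case: ifP => [/andP[_ _]|_ e]; last by have := ltn_ord (i v); rewrite e ltnn.
  by case: (i =P j) => //= <- /val_inj /ii ->; rewrite Airr !andbF.
- move=> col colP cl.
  have [[v0 uv0]|none] := classic (exists v, A u v); last first.
    case: Ac => col0 col0P; apply: (Ab _ col0P) => v w uv.
    by case: none; exists v.
  pose cx (x : 'I_a) : 'I_r := col u' (odflt u' [pick p | lab p == x]).
  have [c1 [iota iinj ic]] := pigeonhole_inj cx (ltnSn (r * #|V|)).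
  have colP' := glue_restrict As phi_inj phi_edge iota colP.
  have /injectiveP iinjb := iinj.
  suff E v : A u v -> col u' (glue_emb phi iota v) = c1.
    by apply: (Ab _ colP') => v w uv uw; rewrite embu !E.
  move=> uv; rewrite -(ic v) /cx embN //.
  have lv : lab (inr (iota, v)) = iota v by rewrite /= iinjb uv.
  apply: cl; rewrite lv // /odflt; case: pickP => [p /eqP //|/(_ (inr (iota, v)))].
  by rewrite lv eqxx.
Qed.

Lemma ex_minimal (P : nat -> Prop) : (exists n, P n) ->
  exists n, P n /\ forall m, m < n -> ~ P m.
Proof.
case=> n; elim/ltn_ind: n => n IH Pn.
have [[m [mn Pm]]|no] := classic (exists m, m < n /\ P m); first exact: IH Pm.
by exists n; split=> // m mn Pm; apply: no; exists m.
Qed.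

Lemma good_relabel (T : finType) r k (E : rel T) (col : T -> T -> 'I_r) (pi : 'I_r -> 'I_r) :
  injective pi -> good_colouring k E col -> good_colouring k E (fun x y => pi (col x y)).
Proof.
move=> pinj [colsym colP]; split=> [x y|c K KP]; first by rewrite colsym.
have [K1|/card_gt1P[x [y [xK yK xy]]]] := leqP #|K| 1.
  have [->|[x xK]] := set_0Vmem K.
    have /colP : mono_clique E col c set0 by move=> x y; rewrite inE.
    by rewrite cards0.
  have /colP : mono_clique E col (col x x) K; last by [].
  move=> y z yK zK yz; have := subset_leq_card (_ : [set y; z] \subset K).
  by rewrite cards2 yz => H; have := leq_trans (H _) K1; rewrite subUset !sub1set yK zK => /(_ isT).
have [_ e] := KP x y xK yK xy.
apply: (colP (col x y)) => a b aK bK ab; have [e1 e2] := KP a b aK bK ab.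
by split=> //; apply: pinj; rewrite e e2.
Qed.

Lemma exists_relabel r (i0 j0 i j : 'I_r) : i0 != j0 -> i != j ->
  exists pi : 'I_r -> 'I_r, [/\ injective pi, pi i0 = i & pi j0 = j].
Proof.
move=> ij0 ij; pose x := tperm i0 i j0.
exists (fun c => tperm x j (tperm i0 i c)); split.
- by move=> a b /perm_inj /perm_inj.
- rewrite tpermL tpermD //; last by rewrite eq_sym.
  by rewrite -(tpermL i0 i) /x inj_eq 1?eq_sym //; exact: perm_inj.
- by rewrite -/x tpermL.
Qed.

(** A negative signal sender: once the edges from [u] to [W] share a colour, the edge to [w0] must
    avoid it, and every ordered pair of distinct colours is attainable. *)
Definition pair_gadget r k (V : finType) (A : rel V) (u : V) (W : {set V}) (w0 : V) :=
  [/\ simple_rel A, w0 \notin W,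
      forall w, w \in w0 |: W -> A u w,
      forall w w', w \in w0 |: W -> w' \in w0 |: W -> ~~ A w w' &
      (forall col : V -> V -> 'I_r, good_colouring k A col ->
        ~ (forall w w', w \in w0 |: W -> w' \in w0 |: W -> col u w = col u w')) /\
      (forall i j : 'I_r, i != j -> exists col : V -> V -> 'I_r,
        [/\ good_colouring k A col, forall w, w \in W -> col u w = i & col u w0 = j])].

(** In a star gadget with the fewest leaves, dropping [w0] leaves a star that some good colouring
    makes constant. There [w0] gets a second colour, and permuting the palette yields all pairs. *)
Lemma pair_gadget_exists r k : (exists m, has_star_gadget r k m) ->
  exists (V : finType) (A : rel V) u W w0, pair_gadget r k A u W w0.
Proof.
move=> /ex_minimal [m [[V [A [u [W [[As Ac Au Ai Ab] cW]]]]] mmin]].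
have [W0|[w0 w0W]] := set_0Vmem W.
  case: Ac => col colP; case: (Ab col colP) => w w'; by rewrite W0 inE.
have EW : w0 |: (W :\ w0) = W by rewrite setD1K.
have [[col [colP colc]]|no] := classic (exists col : V -> V -> 'I_r, good_colouring k A col /\
  forall w w', w \in W :\ w0 -> w' \in W :\ w0 -> col u w = col u w'); last first.
  case: (mmin #|W :\ w0|); first by rewrite -cW (cardsD1 w0 W) w0W.
  exists V, A, u, (W :\ w0); split=> //; split=> //.
  - by move=> w; rewrite inE => /andP[_]; exact: Au.
  - by move=> w w'; rewrite !inE => /andP[_ ?] /andP[_ ?]; exact: Ai.
  - by move=> col colP colc; apply: no; exists col.
exists V, A, u, (W :\ w0), w0; split; rewrite ?EW //; first by rewrite !inE eqxx.
split=> // i j ij.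
have [[w1 w1W ne]|no] := classic (exists2 w1, w1 \in W :\ w0 & col u w1 != col u w0); last first.
  case: (Ab col colP) => w w' wW w'W.
  suff E z : z \in W -> col u z = col u w0 by rewrite !E.
  move=> zW; have [->//|zw0] := eqVneq z w0.
  apply/eqP; apply: contra_notT no => ne; exists z => //; by rewrite !inE zw0.
have [pi [pinj pi1 pi0]] := exists_relabel ne ij.
exists (fun x y => pi (col x y)); split=> //; first exact: good_relabel.
by move=> w wW; rewrite (colc w w1).
Qed.

(** * Forcing a colour pattern and joining an apex to it *)

Section Assemble.
Variables (r k : nat) (P : finType) (pc : P -> P -> option 'I_r).
Hypothesis k_gt2 : 2 < k.
Hypothesis pc_sym : forall x y, pc x y = pc y x.
Hypothesis pc_irr : forall x, pc x x = None.
Hypothesis pc_free : forall j (K : {set P}),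
  (forall x y, x \in K -> y \in K -> x != y -> pc x y = Some j) -> #|K| < k.
Hypothesis pc_strong : forall kappa : P -> 'I_r, exists j (K : {set P}),
  [/\ k <= #|K|.+1, forall x, x \in K -> kappa x = j &
      forall x y, x \in K -> y \in K -> x != y -> pc x y = Some j].

Variables (V : finType) (A : rel V) (u : V) (W : {set V}) (w0 : V).
Hypothesis gadget : pair_gadget r k A u W w0.

Variable c0 : 'I_r.

Variable N : nat.
Hypothesis N_big : r * #|V| < N.
Local Notation X := (P + P * ('I_r * 'I_N))%type.
Local Notation I := (P * 'I_r * {ffun V -> 'I_N} * X)%type.

(** Each pattern vertex receives, for every colour [i], a class of [N] pendant leaves. The most
    frequent colour on that class later plays the role of [i] at this vertex. *)
Definition assemble_base : rel X := fun p q =>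
  match p, q with
  | inl x, inl y => pc x y != None
  | inl x, inr (y, _) => x == y
  | inr (y, _), inl x => x == y
  | inr _, inr _ => false
  end.

Definition assemble_base_col (p q : X) : 'I_r :=
  match p, q with
  | inl x, inl y => odflt c0 (pc x y)
  | inl _, inr (_, (i, _)) => i
  | inr (_, (i, _)), inl _ => i
  | inr _, inr _ => c0
  end.

Definition target_col (x : P) (w : X) : option 'I_r :=
  match w with
  | inl y => pc x y
  | inr (x', (j, _)) => if x == x' then Some j else None
  end.

Lemma target_colP x w j : target_col x w = Some j ->
  [/\ assemble_base (inl x) w, assemble_base_col (inl x) w = j & w != inl x].
Proof.
case: w => [y|[x' [j' l]]] /=.
  move=> e; rewrite e; split=> //; by apply/eqP => -[xy]; rewrite xy pc_irr in e.
by case: eqP => // _ [].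
Qed.

(** A gadget compares the leaf class [c] at [x] with an edge at [x] of another intended colour [j].
    Taking [w] among the leaves separates the classes from one another; taking [w] in the pattern
    ties its edges to the classes. *)
Definition assemble_valid (i : I) : bool :=
  let: (x, c, iota, w) := i in
  injectiveb iota && (if target_col x w is Some j then c != j else false).

Definition assemble_phi (i : I) (v : V) : option X :=
  let: (x, c, iota, w) := i in
  if assemble_valid i then
    if v == u then Some (inl x) else if v == w0 then Some w else
    if v \in W then Some (inr (x, (c, iota v))) else None
  else None.

Lemma assemble_base_simple : simple_rel assemble_base.
Proof.
split; first by move=> [x|[x [i l]]] [y|[y [j l']]] //=; rewrite pc_sym.
by move=> [x|[x [i l]]] //=; rewrite pc_irr eqxx.
Qed.

Lemma assemble_base_good : good_colouring k assemble_base assemble_base_col.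
Proof.
split.
  by move=> [x|[x [i l]]] [y|[y [j l']]] //=; rewrite pc_sym.
move=> c K KP; rewrite ltnNge; apply/negP => kK.
have inK p : p \in K -> if p is inl _ then true else false.
  case: p => // -[x t] pK.
  have /card_gt1P[y [z [yK zK yz]]] : 1 < #|K :\ inr (x, t)|.
    by move: (leq_trans k_gt2 kK); rewrite (cardsD1 (inr (x, t))) pK.
  have E q : q \in K :\ inr (x, t) -> q = inl x.
    rewrite !inE => /andP[qp qK]; have [] := KP q _ qK pK qp.
    by case: q {qp qK} => [q|[q t']] //= /eqP->.
  by move: yz; rewrite (E _ yK) (E _ zK) eqxx.
have EK : K = inl @: (inl @^-1: K).
  apply/setP => p; apply/idP/imsetP => [pK|[x]]; last by rewrite inE => xK ->.
  by have := inK p pK; case: p pK => // x xK _; exists x; rewrite ?inE.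
move: kK; rewrite leqNgt => /negP; apply.
rewrite EK card_imset; last by move=> x y [].
apply: (pc_free (j := c)) => x y; rewrite !inE => xK yK xy.
have [] := KP (inl x) (inl y) xK yK xy.
by rewrite /=; case: (pc x y) => //= j _ ->.
Qed.

Lemma gadget_u : (u == w0) = false /\ (u \in W) = false.
Proof.
have [[_ Airr] _ Au _ _] := gadget.
split; apply/negP => uW; [have := Au w0 | have := Au u].
  by rewrite (eqP uW) !inE eqxx Airr => /(_ isT).
by rewrite !inE uW orbT Airr => /(_ isT).
Qed.

Lemma assemble_phi_inj i a b p :
  assemble_phi i a = Some p -> assemble_phi i b = Some p -> a = b.
Proof.
have [eu uW] := gadget_u; have [_ w0W _ _ _] := gadget.
case: i => [[[x c] iota] w]; rewrite /assemble_phi; case: ifP => // /andP[/injectiveP ii].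
case e : target_col => [j|//] cj; have [_ _ wx] := target_colP e.
have wi l : w != inr (x, (c, l)).
  apply: contraNneq cj => ew; rewrite ew /= eqxx in e; by case: e => ->.
case: (a =P u) => [->|_]; case: (b =P u) => [->|_] //.
- case: (b =P w0) => _ [<-]; first by case=> ew; rewrite ew eqxx in wx.
  by case: ifP.
- case: (a =P w0) => _; first by case=> <- [] ew; rewrite -ew eqxx in wx.
  by case: ifP => // _ [<-].
- case: (a =P w0) => [->|_]; case: (b =P w0) => [->|_] //.
  + by case=> <-; case: ifP => // _ [] ew; have := wi (iota b); rewrite ew eqxx.
  + case: ifP => // _ [<-] [] ew; have := wi (iota a); by rewrite ew eqxx.
  + case: ifP => // _ [<-]; case: ifP => // _ []; by move/ii.
Qed.

Lemma assemble_phi_edge i a b p q :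
  assemble_phi i a = Some p -> assemble_phi i b = Some q -> A a b = assemble_base p q.
Proof.
have [eu uW] := gadget_u; have [[Asym Airr] w0W Au Ai _] := gadget.
have [Bsym Birr] := assemble_base_simple.
have Auw : A u w0 by apply: Au; rewrite !inE eqxx.
have AuW z : z \in W -> A u z by move=> zW; apply: Au; rewrite !inE zW orbT.
case: i => [[[x c] iota] w]; rewrite /assemble_phi; case: ifP => // /andP[/injectiveP ii].
case e : target_col => [j|//] cj; have [exw _ wx] := target_colP e.
have wi l : assemble_base w (inr (x, (c, l))) = false.
  case: w e exw wx => [y|[y t]] //= e1 e2 yx; apply: contraNF yx => /eqP -> //.
have Aw a' b' : a' \in w0 |: W -> b' \in w0 |: W -> A a' b' = false.
  by move=> aW bW; apply/negbTE/Ai.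
case: (a =P u) => [->|_]; case: (b =P u) => [->|_] //.
- by move=> [<-] [<-]; rewrite Airr Birr.
- case: (b =P w0) => [->|_] [<-]; first by case=> <-; rewrite Auw exw.
  by case: ifP => // bW [<-] /=; rewrite eqxx AuW.
- case: (a =P w0) => [->|_]; first by case=> <- [<-]; rewrite Asym Auw Bsym exw.
  by case: ifP => // aW [<-] [<-]; rewrite Asym AuW //= eqxx.
- case: (a =P w0) => [->|_]; case: (b =P w0) => [->|_].
  + by case=> <- [<-]; rewrite Airr Birr.
  + case=> <-; case: ifP => // bW [<-]; rewrite wi; apply: Aw; by rewrite !inE ?eqxx ?bW ?orbT.
  + case: ifP => // aW [<-] [<-]; rewrite Bsym wi; apply: Aw; by rewrite !inE ?eqxx ?aW ?orbT.
  + case: ifP => // aW [<-]; case: ifP => // bW [<-] /=; apply: Aw; by rewrite !inE ?aW ?bW ?orbT.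
Qed.

Local Notation F := (glue_rel A assemble_base assemble_phi).

Lemma assemble_colourable (r_gt1 : 1 < r) : colourable r k F.
Proof.
have [eu uW] := gadget_u; have [As w0W Au Ai [_ gcol]] := gadget.
have Aw a' b' : a' \in w0 |: W -> b' \in w0 |: W -> A a' b' = false.
  by move=> aW bW; apply/negbTE/Ai.
pose colAspec (i : I) (f : {ffun V * V -> 'I_r}) :=
    good_colouring k A (fun a b => f (a, b)) /\
    forall a b x y, assemble_phi i a = Some x -> assemble_phi i b = Some y -> A a b ->
     f (a, b) = assemble_base_col x y.
have [colA colAP] : exists colA : I -> {ffun V * V -> 'I_r}, forall i, colAspec i (colA i).
  apply: (@fin_all_exists _ _ colAspec) => -[[[x c] iota] w].
  (* A copy with an invalid index is identified with nothing, so any good colouring of the gadget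
     serves there; [1 < r] supplies the two colours that produce one. *)
  have [/andP[ii]|] := boolP (assemble_valid (x, c, iota, w)); last first.
    move=> nv.
    have [j0 j01] : exists j0 : 'I_r, c != j0.
      have : 0 < #|[set~ c]| by rewrite cardsC1 card_ord -subn1 subn_gt0.
      by case/card_gt0P => j; rewrite !inE eq_sym; exists j.
    have [col [[colsym colP] _ _]] := gcol _ _ j01.
    exists [ffun p => col p.1 p.2]; split.
      split=> [a b|c' K KP]; first by rewrite !ffunE /= colsym.
      by apply: (colP c') => a b aK bK ab; have := KP a b aK bK ab; rewrite ffunE.
    by move=> a b p q; rewrite /assemble_phi (negbTE nv).
  case e : target_col => [j|//] cj; have [exw ec wx] := target_colP e.
  have [col [[colsym colP] cW cw0]] := gcol _ _ cj.
  exists [ffun p => col p.1 p.2]; split.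
    split=> [a b|c' K KP]; first by rewrite !ffunE /= colsym.
    by apply: (colP c') => a b aK bK ab; have := KP a b aK bK ab; rewrite ffunE.
  have Bc : assemble_base_col w (inl x) = j.
    by rewrite -ec; case: (w) => [y|[y [j' l]]] //=; rewrite pc_sym.
  move=> a b p q; rewrite /assemble_phi /assemble_valid ii e cj /= ffunE /=.
  case: (a =P u) => [->|_]; case: (b =P u) => [->|_] //.
  - by rewrite As.2.
  - case: (b =P w0) => [->|_] [<-]; first by case=> <- _; rewrite cw0.
    by case: ifP => // bW [<-] _ /=; apply: cW.
  - case: (a =P w0) => [->|_]; first by case=> <- [<-] _; rewrite colsym cw0.
    by case: ifP => // aW [<-] [<-] _; rewrite colsym cW.
  - case: (a =P w0) => [->|_]; case: (b =P w0) => [->|_].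
    + by rewrite As.2.
    + by move=> _; case: ifP => // bW _; rewrite Aw ?inE ?eqxx ?bW ?orbT.
    + by case: ifP => // aW _ _; rewrite Aw ?inE ?eqxx ?aW ?orbT.
    + by case: ifP => // aW _; case: ifP => // bW _; rewrite Aw ?inE ?aW ?bW ?orbT.
apply: (@glue_good _ _ _ A assemble_base assemble_phi As assemble_phi_inj assemble_phi_edge
  r k (ltnW k_gt2) _ _ assemble_base_good (fun i => (colAP i).1)).
by move=> i; exact: (colAP i).2.
Qed.

Definition apex_rel : rel (option (X + I * V)) := fun p q =>
  let base p := if p is inl (inl _) then true else false in
  match p with
  | Some p => if q is Some q then F p q else base p
  | None => if q is Some q then base q else false
  end.

Lemma apex_rel_simple : simple_rel apex_rel.
Proof.
have [As _ _ _ _] := gadget.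
have [Fsym Firr] := glue_rel_simple assemble_phi As assemble_base_simple.
split; last by move=> [p|]; [exact: Firr|].
by move=> [p|] [q|]; [exact: Fsym| | |].
Qed.

Lemma apex_degree : #|[set p | apex_rel None p]| <= #|P|.
Proof.
have inj : injective (fun x : P => Some (inl (inl x)) : option (X + I * V)) by move=> x y [].
rewrite -[#|P|]cardsT -(card_imset (mem setT) inj); apply: subset_leq_card; apply/subsetP => p.
rewrite inE; case: p => [[[x|]|]|] //= _.
by apply/imsetP; exists x; rewrite ?inE.
Qed.

(* For every vertex [x] the popular colours of the pendant classes at [x] form a
   bijection [c x] of the palette, and all pattern edges of colour [j] at [x] get
   the colour [c x j]. *)
Lemma apex_not_colourable : ~ colourable r k apex_rel.
Proof.
have [eu uW] := gadget_u; have [As w0W Au Ai [gno _]] := gadget.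
case=> col colP.
have colF : good_colouring k F (fun p q => col (Some p) (Some q)).
  by apply: good_pullback colP => // p q [].
pose lc (x : P) (i : 'I_r) (l : 'I_N) : 'I_r :=
  col (Some (inl (inl x))) (Some (inl (inr (x, (i, l))))).
have [c cP] : exists c : P * 'I_r -> 'I_r, forall xi,
    exists2 f : {ffun V -> 'I_N}, injective f & forall v, lc xi.1 xi.2 (f v) = c xi.
  apply: (@fin_all_exists _ (fun _ => 'I_r) (fun xi i0 =>
    exists2 f : {ffun V -> 'I_N}, injective f & forall v, lc xi.1 xi.2 (f v) = i0)) => xi.
  exact: (pigeonhole_inj (lc xi.1 xi.2) N_big).
(* Otherwise the copy whose class sits on popular leaves of the class [i] and whose last leaf is [w]
   would be constant at its centre. *)
have key x i w j : target_col x w = Some j -> i != j ->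
    col (Some (inl (inl x))) (Some (inl w)) <> c (x, i).
  move=> e ij ec; have [f finj fc] := cP (x, i).
  have val : assemble_valid (x, i, f, w).
    by rewrite /assemble_valid e ij andbT; apply/injectiveP.
  apply: (gno _ (glue_restrict As assemble_phi_inj assemble_phi_edge (x, i, f, w) colF)).
  have E : glue_emb assemble_phi (x, i, f, w) u = inl (inl x).
    by rewrite /glue_emb /assemble_phi val eqxx.
  have E0 : glue_emb assemble_phi (x, i, f, w) w0 = inl w.
    by rewrite /glue_emb /assemble_phi val [w0 == u]eq_sym eu eqxx.
  have EW z : z \in W -> glue_emb assemble_phi (x, i, f, w) z = inl (inr (x, (i, f z))).
    move=> zW; rewrite /glue_emb /assemble_phi val zW !ifN //.
      by apply: contraNneq w0W => <-.
    by apply: contraFneq uW => <-.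
  suff H z : z \in w0 |: W ->
     col (Some (glue_emb assemble_phi (x, i, f, w) u))
         (Some (glue_emb assemble_phi (x, i, f, w) z)) = c (x, i).
    by move=> z z' zW z'W; rewrite !H.
  rewrite E !inE => /orP[/eqP->|zW]; first by rewrite E0.
  by rewrite EW // -(fc z).
have cinj x : injective (fun i => c (x, i)).
  move=> i j eij; apply/eqP/negP => /negP ij; have [f finj fc] := cP (x, j).
  have [l _] : exists l : V, True by exists u.
  apply: (key x i (inr (x, (j, f l))) j _ ij); first by rewrite /= eqxx.
  by rewrite -/(lc x j (f l)) [LHS]fc eij.
have cbij x i0 : exists i, c (x, i) = i0.
  have := injF_onto (cinj x) => /(_ i0) /codomP[i ->]; by exists i.
have ecol x y j : pc x y = Some j -> col (Some (inl (inl x))) (Some (inl (inl y))) = c (x, j).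
  move=> e; have [i ei] := cbij x (col (Some (inl (inl x))) (Some (inl (inl y)))).
  rewrite -ei; have [->//|ij] := eqVneq i j.
  by case: (key x i (inl y) j e ij).
(* The colour of the edge from the apex to [x] is translated back into an intended colour through
   the bijection at [x], so that [pc_strong] applies. *)
have [kappa kP] : exists kappa : P -> 'I_r, forall x, c (x, kappa x) = col None (Some (inl (inl x))).
  by apply: (@fin_all_exists _ (fun _ => 'I_r)
    (fun x i => c (x, i) = col None (Some (inl (inl x))))) => x; apply: cbij.
have [j [K [kK Kk Kpc]]] := pc_strong kappa.
have [x0 x0K] : exists x, x \in K.
  apply/set0Pn; apply/eqP => K0; move: kK; rewrite K0 cards0 => k1.
  by have := leq_trans k_gt2 k1.
have [colsym colP'] := colP.
(* The edge from [x] to [x0] has intended colour [j], so its actual colour can be read at either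
   end. Hence [K] and the apex together form a monochromatic clique. *)
have cx x : x \in K -> c (x, j) = c (x0, j).
  move=> xK; have [->//|xx0] := eqVneq x x0.
  rewrite -(ecol x x0 j); last exact: Kpc.
  rewrite colsym; apply: ecol; apply: Kpc => //; by rewrite eq_sym.
pose K' := None |: [set Some (inl (inl x)) | x in K] : {set option (X + I * V)}.
have cK' : #|K'| = #|K|.+1.
  rewrite cardsU1 card_imset; last by move=> x y [].
  by case: imsetP => // -[].
suff : #|K'| < k by rewrite cK' ltnNge kK.
have nK x : x \in K -> col None (Some (inl (inl x))) = c (x0, j).
  by move=> xK; rewrite -kP Kk // cx.
apply: (colP' (c (x0, j))) => p q.
rewrite !inE => /orP[/eqP->|/imsetP[x xK ->]] /orP[/eqP->|/imsetP[y yK ->]] //.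
- by move=> _; rewrite nK.
- by move=> _; rewrite colsym nK.
- move=> xy; have {}xy : x != y by apply: contraNneq xy => ->.
  by rewrite /= (ecol x y j) ?Kpc // cx.
Qed.

End Assemble.

(** * From colour patterns to minimal Ramsey graphs *)

Lemma not_good_clique (T : finType) r k (E : rel T) (col : T -> T -> 'I_r) :
  (forall x y, col x y = col y x) -> ~ good_colouring k E col ->
  exists c K, mono_clique E col c K /\ k <= #|K|.
Proof.
move=> colsym ng; apply: NNPP => no; apply: ng; split=> // c K KP.
by rewrite ltnNge; apply/negP => kK; apply: no; exists c, K.
Qed.

Lemma colourable_embed (S T : finType) r k (g : S -> T) (E : rel T) : 0 < r -> 1 < k ->
  injective g -> (forall x y, E x y = E y x) -> (forall x y, E x y -> exists a, x = g a) ->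
  colourable r k (fun a b => E (g a) (g b)) -> colourable r k E.
Proof.
move=> r0 k1 ginj Esym Eg [col [colsym colP]].
pose h x := [pick a | g a == x].
have hg a : h (g a) = Some a.
  by rewrite /h; case: pickP => [b /eqP /ginj->//|/(_ a)]; rewrite eqxx.
exists (fun x y => if h x is Some a then if h y is Some b then col a b else Ordinal r0 else Ordinal r0).
split=> [x y|c K KP]; first by case: (h x) => [a|]; case: (h y).
rewrite ltnNge; apply/negP => kK.
have Kg x : x \in K -> exists a, x = g a.
  move=> xK; have /card_gt0P[y] : 0 < #|K :\ x|.
    by move: (leq_trans k1 kK); rewrite (cardsD1 x K) xK ltnS.
  rewrite !inE eq_sym => /andP[xy yK]; have [xyE _] := KP x y xK yK xy.
  exact: Eg xyE.
have EK : K = g @: (g @^-1: K).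
  apply/setP => x; apply/idP/imsetP => [xK|[a]]; last by rewrite inE => aK ->.
  by have [a e] := Kg x xK; exists a; rewrite // inE -e.
move: kK; rewrite EK (card_imset _ ginj) leqNgt => /negP; apply; apply: (colP c) => a b.
rewrite !inE => aK bK ab; have [|e1] := KP _ _ aK bK; first by rewrite (inj_eq ginj).
by rewrite !hg.
Qed.

(** Induction on the sum of the targets: a vertex sends some colour [c] to at least [N c] others,
    where [N c] handles the targets with that of [c] lowered by one. At sum 0 the threshold is 1
    because a vertex is needed to name a colour. *)
Lemma ramsey_multicolour r m (kk : 'I_r -> nat) : \sum_c kk c = m ->
  exists N, forall (T : finType) (col : T -> T -> 'I_r) (S : {set T}),
  (forall x y, col x y = col y x) -> N <= #|S| ->
  exists c (K : {set T}), [/\ K \subset S, mono_clique (fun x y => x != y) col c K & kk c <= #|K|].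
Proof.
elim: m kk => [|m IH] kk km.
  exists 1 => T col S colsym /card_gt0P[x _].
  exists (col x x), set0; rewrite sub0set; split=> //; first by move=> y z; rewrite inE.
  by move/eqP: km; rewrite sum_nat_eq0 => /forallP/(_ (col x x)); rewrite /= cards0 => /eqP->.
have [[c kc0]|kpos] := classic (exists c, kk c = 0).
  exists 0 => T col S _ _; exists c, set0; rewrite sub0set kc0; split=> //.
  by move=> y z; rewrite inE.
pose kd c c' := if c' == c then (kk c).-1 else kk c'.
have [N NP] : exists N : 'I_r -> nat, forall c, forall (T : finType) (col : T -> T -> 'I_r) (S : {set T}),
  (forall x y, col x y = col y x) -> N c <= #|S| ->
  exists c' (K : {set T}), [/\ K \subset S, mono_clique (fun x y => x != y) col c' K & kd c c' <= #|K|].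
  apply: (@fin_all_exists _ (fun _ => nat) (fun c n => forall (T : finType) (col : T -> T -> 'I_r) (S : {set T}),
  (forall x y, col x y = col y x) -> n <= #|S| ->
  exists c' (K : {set T}), [/\ K \subset S, mono_clique (fun x y => x != y) col c' K & kd c c' <= #|K|])) => c.
  apply: IH; move: km; rewrite (bigD1 c) // (bigD1 c (P := xpredT)) //= /kd eqxx.
  have -> : kk c = (kk c).-1.+1 by rewrite prednK // lt0n; apply/eqP => e; apply: kpos; exists c.
  rewrite addSn => -[<-]; congr (_ + _); apply: eq_bigr => i /negbTE -> //.
exists (\sum_c N c).+1 => T col S colsym NS.
have /card_gt0P[x xS] : 0 < #|S| by apply: leq_trans NS.
pose Sc c := [set y in S :\ x | col x y == c].
have [c cP] : exists c, N c <= #|Sc c|.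
  apply: NNPP => no; move: NS; rewrite (cardsD1 x S) xS ltnS leqNgt => /negP; apply.
  have Slt c : #|Sc c| < N c by rewrite ltnNge; apply/negP => le; apply: no; exists c.
  rewrite -sum1_card (partition_big (col x) xpredT) //=.
  have le c : true -> \sum_(i in S :\ x | col x i == c) 1 <= N c.
    move=> _; rewrite sum1dep_card ltnW //; apply: leq_ltn_trans (Slt c).
    by apply: subset_leq_card; apply/subsetP => y; rewrite !inE.
  rewrite (bigD1 (col x x)) //= [X in _ < X](bigD1 (col x x)) //= -addSn leq_add //.
    rewrite sum1dep_card; apply: leq_ltn_trans (Slt _).
    by apply: subset_leq_card; apply/subsetP => y; rewrite !inE.
  by apply: leq_sum => c _; apply: le.
have [c' [K [KS Km Kc]]] := NP c T col (Sc c) colsym cP.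
have KS' : K \subset S.
  by apply: subset_trans KS _; apply/subsetP => y; rewrite !inE => /andP[/andP[]].
have [ec|nc] := eqVneq c' c; last first.
  by exists c', K; split=> //; move: Kc; rewrite /kd (negbTE nc).
have xK : x \notin K.
  by apply/negP => /(subsetP KS); rewrite !inE eqxx.
have xyc y : y \in K -> col x y = c by move/(subsetP KS); rewrite !inE => /andP[_ /eqP].
exists c', (x |: K); split.
- by rewrite subUset sub1set xS.
- move=> y z; rewrite !inE => /orP[/eqP->|yK] /orP[/eqP->|zK] yz //; first by rewrite eqxx in yz.
  + by rewrite xyc.
  + by rewrite colsym xyc.
  + exact: Km.
- rewrite cardsU1 xK; move: Kc; rewrite /kd ec eqxx => Kc.
  by rewrite add1n; apply: leq_trans (leqSpred _) _.
Qed.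

Lemma exists_not_colourable r k : exists N, ~ colourable r k (fun x y : 'I_N => x != y).
Proof.
have [N NP] := @ramsey_multicolour r _ (fun _ => k) erefl.
exists N => -[col [colsym colP]].
have [|c [K [_ KP kK]]] := NP _ col setT colsym; first by rewrite cardsT card_ord.
by have := colP c K KP; rewrite ltnNge kK.
Qed.

Definition edge_set (T : finType) (E : rel T) : {set T * T} := [set p | E p.1 p.2].

(** Minimising the number of edges on a fixed vertex set makes every edge critical. *)
Lemma edge_critical r k : 0 < r -> 1 < k ->
  exists (V : finType) (A : rel V) (u v : V),
  [/\ u != v, simple_rel A, colourable r k A &
   ~ colourable r k (fun x y => A x y || ([set x; y] == [set u; v]))].
Proof.
move=> r0 k1; have [N NP] := exists_not_colourable r k.
have [m [[E [[Es En] cE]] Emin]] : exists m, (exists E : rel 'I_N,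
    (simple_rel E /\ ~ colourable r k E) /\ #|edge_set E| = m) /\
    forall m', m' < m -> ~ exists E : rel 'I_N,
    (simple_rel E /\ ~ colourable r k E) /\ #|edge_set E| = m'.
  apply: ex_minimal; exists #|edge_set (fun x y : 'I_N => x != y)|, (fun x y => x != y).
  by split=> //; split=> //; split=> [x y|x]; rewrite ?eqxx // eq_sym.
have [E0|[[u v] uv]] := set_0Vmem (edge_set E).
  case: En; exists (fun _ _ => Ordinal r0); split=> // c K KP.
  rewrite ltnNge; apply/negP => kK.
  have /card_gt1P[x [y [xK yK xy]]] := leq_trans k1 kK.
  have [xyE _] := KP x y xK yK xy.
  have : (x, y) \in edge_set E by rewrite inE.
  by rewrite E0 inE.
move: uv; rewrite inE /= => uv; have [Esym Eirr] := Es.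
have u_v : u != v by apply/eqP => e; rewrite e Eirr in uv.
exists 'I_N, (fun x y => E x y && ([set x; y] != [set u; v])), u, v; split=> //.
- by split=> [x y|x]; rewrite ?Eirr // Esym setUC.
- apply: NNPP => nc; apply: (Emin #|edge_set (fun x y => E x y && ([set x; y] != [set u; v]))|).
    rewrite -cE; apply: proper_card; apply/properP; split.
      by apply/subsetP => p; rewrite !inE => /andP[].
    by exists (u, v); rewrite !inE /= ?eqxx ?andbF.
  exists (fun x y => E x y && ([set x; y] != [set u; v])); do 2?split=> //.
  by split=> [x y|x]; rewrite ?Eirr // Esym setUC.
- move=> cc; apply: En; apply: colourableS cc => x y xy.
  by rewrite xy /=; case: eqP.
Qed.

Lemma has_star_gadget_exists r k : 1 < r -> 2 < k -> exists m, has_star_gadget r k m.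
Proof.
move=> r1 k2; have [V [A [u [v [uv As Ac An]]]]] := edge_critical (ltnW r1) (ltnW k2).
apply: (star_gadget_exists k2 As Ac (u := u)) => col [colsym colP] cc.
have [c cP] : exists c : 'I_r, forall w, A u w -> col u w != c.
  have other (i : 'I_r) : exists j : 'I_r, i != j.
    have : 0 < #|[set~ i]| by rewrite cardsC1 card_ord -subn1 subn_gt0.
    by case/card_gt0P => j; rewrite !inE eq_sym; exists j.
  have [[w uw]|no] := classic (exists w, A u w).
    have [j j1] := other (col u w); exists j => w' uw'.
    by rewrite (cc w' w).
  by exists (col u u) => w uw; case: no; exists w.
apply: An; pose col' x y := if [set x; y] == [set u; v] then c else col x y.
have colsym' x y : col' x y = col' y x by rewrite /col' setUC colsym.
exists col'; apply: NNPP => /(not_good_clique colsym') [c' [K [KP kK]]].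
have K_A w z : w \in K -> z \in K -> w != z -> [set w; z] != [set u; v] -> A w z /\ col w z = c'.
  move=> wK zK wz ne; have [] := KP w z wK zK wz.
  by rewrite /col' (negbTE ne) orbF.
have [uvK|nuv] := boolP ((u \in K) && (v \in K)); last first.
  have := colP c' K; rewrite ltnNge kK => /(_ _)/negP; apply.
    move=> x y xK yK xy; apply: K_A => //; apply: contraNneq nuv => e.
    by rewrite -!sub1set -subUset -[_ :|: _]e subUset !sub1set xK.
  by [].
have /andP[uK vK] := uvK.
have ec : c' = c by have [_] := KP u v uK vK uv; rewrite /col' eqxx.
have /card_gt0P[w] : 0 < #|K :\ u :\ v|.
  move: (leq_trans k2 kK); rewrite (cardsD1 u K) uK (cardsD1 v (K :\ u)) !inE eq_sym uv vK.
  by rewrite !addnA ltnS.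
rewrite !inE => /and3P[wv wu wK].
have [||uw cw] := K_A u w uK wK.
- by rewrite eq_sym.
- apply/eqP => /setP/(_ w); rewrite !inE eqxx orbT (negbTE wv) (negbTE wu) //.
- by have := cP w uw; rewrite cw ec eqxx.
Qed.

Lemma bigminn_leq (n : nat) (I : eqType) (s : seq I) (F : I -> nat) j :
  j \in s -> \big[minn/n]_(i <- s) F i <= F j.
Proof.
elim: s => // i s IH; rewrite inE big_cons => /orP[/eqP->|/IH le]; first exact: geq_minl.
exact: leq_trans (geq_minr _ _) le.
Qed.

(** Minimality in [ramsey_minimal] concerns both vertices and edges, so the sum of their numbers is
    minimised over non-colourable subgraphs. Any such subgraph contains [v], whose degree can only
    have dropped. *)
Lemma minimal_subgraph (Z : finType) (E : rel Z) (v : Z) r k : 0 < r -> 1 < k ->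
  simple_rel E -> ~ colourable r k E ->
  colourable r k (fun x y => [&& E x y, x != v & y != v]) ->
  exists n (e : rel 'I_n), ramsey_minimal e (complete_rel k) r /\
    min_degree e <= #|[set w | E v w]|.
Proof.
move=> r0 k1 [Esym Eirr] En Ev.
pose ok (p : {set Z} * rel Z) :=
  [/\ forall x y, p.2 x y = p.2 y x, forall x y, p.2 x y -> [&& x \in p.1, y \in p.1 & E x y]
    & ~ colourable r k p.2].
have [m [[[V' E'] [[E'sym E'V E'n] cE]] Emin]] : exists m, (exists p,
    ok p /\ #|p.1| + #|edge_set p.2| = m) /\
    forall m', m' < m -> ~ exists p, ok p /\ #|p.1| + #|edge_set p.2| = m'.
  apply: ex_minimal; exists (#|[set: Z]| + #|edge_set E|), ([set: Z], E).
  by split=> //; split=> //= x y ->; rewrite !inE.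
rewrite /= in E'sym E'V E'n cE.
have vV : v \in V'.
  apply/negP => /negP nv; apply: E'n; apply: colourableS Ev => x y /E'V /and3P[xV yV ->] /=.
  by apply/andP; split; apply: contraNneq nv => <-.
have E'E x y : E' x y -> E x y by case/E'V/and3P.
pose e : rel 'I_#|V'| := fun i j => E' (enum_val i) (enum_val j).
have enumK x : x \in V' -> exists i : 'I_#|V'|, x = enum_val i.
  by move=> xV; exists (enum_rank_in vV x); rewrite enum_rankK_in.
have esimple : simple_graph e.
  by split=> [i j|i]; rewrite /e // ; apply/negP => /E'E; rewrite Eirr.
have en : ~ colourable r k e.
  apply: contra_not E'n; apply: (colourable_embed (g := enum_val)) => //; first exact: enum_val_inj.
  by move=> x y /E'V/and3P[/enumK].
exists #|V'|, e; split.
  split=> //; split.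
    apply: NNPP => na; apply: en.
    by apply: (not_arrows_colourable r0 esimple.1 _ k1 na) => i j _; rewrite inE.
  move=> V0 E0 E0sym E0V ne ar0.
  have E0n : ~ colourable r k E0 by move=> /(colourable_not_arrows (V := V0)).
  pose E1 : rel Z := fun x y => [exists i, exists j, [&& enum_val i == x, enum_val j == y & E0 i j]].
  pose V1 : {set Z} := enum_val @: V0.
  have E1E0 i j : E1 (enum_val i) (enum_val j) = E0 i j.
    apply/existsP/idP => [[i' /existsP[j' /and3P[/eqP ei /eqP ej]]]|ij].
      by rewrite (enum_val_inj ei) (enum_val_inj ej).
    by exists i; apply/existsP; exists j; rewrite !eqxx.
  have E1P x y : E1 x y -> exists i j, [/\ x = enum_val i, y = enum_val j & E0 i j].
    by move=> /existsP[i /existsP[j /and3P[/eqP <- /eqP <- ij]]]; exists i, j.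
  have E1E' x y : E1 x y -> E' x y.
    by move=> /E1P[i [j [-> -> /E0V/and3P[]]]].
  have V1V : V1 \subset V' by apply/subsetP => _ /imsetP[i _ ->]; exact: enum_valP.
  apply: (Emin (#|V1| + #|edge_set E1|)); last first.
    exists (V1, E1); split=> //; split=> /=.
    - by move=> x y; apply/idP/idP => /E1P[i [j [-> -> ij]]]; rewrite E1E0 E0sym.
    - move=> x y xy; rewrite (E'E x y (E1E' _ _ xy)) andbT.
      by have [i [j [-> -> /E0V/and3P[iV jV _]]]] := E1P _ _ xy; rewrite !imset_f.
    - case=> col colP; apply: E0n; exists (fun i j => col (enum_val i) (enum_val j)).
      by apply: good_pullback colP => [|i j]; [exact: enum_val_inj | rewrite E1E0].
  have sE : edge_set E1 \subset edge_set E' by apply/subsetP => p; rewrite !inE => /E1E'.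
  rewrite -cE; case: ne => [VT|[i [j ij]]].
    rewrite -addSn leq_add ?subset_leq_card //.
    rewrite card_imset; last exact: enum_val_inj.
    have : V0 \proper setT by rewrite properEneq VT subsetT.
    by move/proper_card; rewrite cardsT card_ord.
  rewrite -addnS leq_add ?subset_leq_card // proper_card //; apply/properP; split=> //.
  have : e i j && ~~ E0 i j.
    case eE: (E0 i j) ij => [] /= ij; last by move: ij; case: (e i j).
    by have /and3P[_ _ eij] := E0V _ _ eE; rewrite eij in ij.
  by case/andP=> eij nE0; exists (enum_val i, enum_val j); rewrite inE //= E1E0.
have [i vi] := enumK v vV.
apply: (@leq_trans (degree e i)); first by apply: bigminn_leq; rewrite mem_index_enum.
rewrite /degree -(card_imset (mem [set u | e i u]) (@enum_val_inj _ (mem V'))).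
apply: subset_leq_card; apply/subsetP => _ /imsetP[j ij ->].
by move: ij; rewrite !inE /e -vi => /E'E.
Qed.

(* [pc x y] is the colour of the edge [xy] of the pattern, or [None]. *)
Theorem pattern_min_degree r k (P : finType) (pc : P -> P -> option 'I_r) : 1 < r -> 2 < k ->
  (forall x y, pc x y = pc y x) -> (forall x, pc x x = None) ->
  (forall j (K : {set P}), (forall x y, x \in K -> y \in K -> x != y -> pc x y = Some j) -> #|K| < k) ->
  (forall kappa : P -> 'I_r, exists j (K : {set P}),
    [/\ k <= #|K|.+1, forall x, x \in K -> kappa x = j &
        forall x y, x \in K -> y \in K -> x != y -> pc x y = Some j]) ->
  exists n (e : rel 'I_n), ramsey_minimal e (complete_rel k) r /\ min_degree e <= #|P|.
Proof.
move=> r1 k2 pcs pci pcf pcst.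
have [V [A [u [W [w0 g]]]]] := pair_gadget_exists (has_star_gadget_exists r1 k2).
pose c0 : 'I_r := Ordinal (ltnW r1).
pose N := (r * #|V|).+1; have NV : r * #|V| < N := ltnSn _.
have cF := assemble_colourable k2 pcs pci pcf g c0 N r1.
have nG := apex_not_colourable k2 pcs pci pcst g c0 NV.
have [|n [e [em ed]]] := minimal_subgraph (v := None) (ltnW r1) (ltnW k2)
  (apex_rel_simple pcs pci g N) nG; last first.
  by exists n, e; split=> //; apply: leq_trans ed _; exact: apex_degree.
apply: (colourable_embed (g := Some)) => //.
- exact: ltnW.
- exact: ltnW.
- by move=> p q [].
- by move=> p q; rewrite (apex_rel_simple pcs pci g N).1; congr (_ && _); exact: andbC.
- by move=> [p|] q /and3P[] //; exists p.
- by apply: colourableS cF => p q /and3P[].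
Qed.

(** * The deletion method *)

Lemma bernoulli_expn m j : m ^ j * (m + j) <= m * m.+1 ^ j.
Proof.
elim: j => [|j IH]; first by rewrite !expn0 addn0 mul1n muln1.
rewrite !expnS; apply: leq_trans (_ : m.+1 * (m ^ j * (m + j)) <= _); last first.
  by rewrite [leqRHS]mulnCA leq_mul2l IH orbT.
by move: (m ^ j) => X; nia.
Qed.

(** Integer form of (1 - 1/n)^n <= 1/2, from Bernoulli's inequality; both exponential tail bounds
    rest on it. *)
Lemma pow_half n : 0 < n -> n.-1 ^ n * 2 <= n ^ n.
Proof.
case: n => // m _; rewrite /= -/(expn _ _).
case: (posnP m) => [->|m0]; first by rewrite exp0n.
rewrite -(leq_pmul2l m0); apply: leq_trans (bernoulli_expn m m.+1).
rewrite mulnCA leq_mul2l; apply/orP; right; lia.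
Qed.

(** From x^x <= (2x)(2x-1)...(x+1) = C(2x,x) x! and C(2x,x) <= 4^x. It replaces the usual bound
    (en/x)^x. *)
Lemma bin_expn_le n x : 'C(n, x) * x ^ x <= (4 * n) ^ x.
Proof.
have H : x ^ x <= 4 ^ x * x`!.
  apply: (@leq_trans ((x + x) ^_ x)).
    suff H j : j <= x -> x ^ j <= (x + x) ^_ j by exact: H.
    elim: j => // j IH jx; rewrite expnS ffactnSr mulnC leq_mul ?IH 1?ltnW //; lia.
  rewrite -bin_ffact leq_mul2r; apply/orP; right.
  have -> : 4 ^ x = 2 ^ (x + x) by rewrite addnn -mul2n expnM.
  have := Pascal 1 1 (x + x); rewrite addn1 => ->.
  rewrite (bigD1 (inord x : 'I_(x + x).+1)) //= inordK; last by rewrite ltnS leq_addr.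
  by rewrite !exp1n !muln1 leq_addr.
apply: (@leq_trans ('C(n, x) * (4 ^ x * x`!))); first by rewrite leq_mul2l H orbT.
rewrite mulnCA bin_ffact expnMn leq_mul2l; apply/orP; right.
by elim: x {H} => // x IH; rewrite ffactnSr expnSr leq_mul // leq_subr.
Qed.

Section RandomFunctions.
Variables (E : finType) (t : nat).
Implicit Types (w : {ffun E -> 'I_t.+1}) (D : {set E}).

(** The value [ord0] marks a selected element, so a uniform [w] selects each element independently
    with probability 1/(t+1). *)
Definition all_zero w D := [forall e in D, w e == ord0].

Lemma all_zeroU w D D' : all_zero w (D :|: D') = all_zero w D && all_zero w D'.
Proof.
apply/forall_inP/andP => [H|[/forall_inP H /forall_inP H'] e].
  by split; apply/forall_inP => e eD; apply: H; rewrite inE eD ?orbT.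
by rewrite inE => /orP[/H|/H'].
Qed.

Lemma card_all_zero D : #|[set w | all_zero w D]| * t.+1 ^ #|D| = t.+1 ^ #|E|.
Proof.
have -> : #|[set w | all_zero w D]| = \prod_e (if e \in D then 1 else t.+1).
  rewrite cardsE -(@eq_card _ (family (fun e => if e \in D then pred1 ord0 else predT))); last first.
    move=> w; rewrite [in RHS]unfold_in; apply/familyP/forall_inP => H e.
      by move=> eD; have := H e; rewrite eD.
    by case: ifP => // /H.
  rewrite card_family foldrE big_map big_enum /=; apply: eq_bigr => e _.
  by case: ifP => _; rewrite ?card1 // card_ord.
have -> : t.+1 ^ #|D| = \prod_e (if e \in D then t.+1 else 1).
  by rewrite -prod_nat_const big_mkcond.
rewrite -big_split /= -prod_nat_const.
by apply: eq_bigr => e _; case: ifP; rewrite ?mul1n ?muln1.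
Qed.

(* Up to normalisation, the expectation of [2 ^ (number of absent blocks)]: the
   blocks are disjoint, so their presences are independent. *)
Lemma sum_absent_blocks c0 (bs : seq {set E}) D :
  pairwise (fun A B : {set E} => [disjoint A & B]) bs -> all (fun A : {set E} => #|A| == c0) bs ->
  all (fun A : {set E} => [disjoint A & D]) bs ->
  (\sum_(w | all_zero w D) 2 ^ count (fun A : {set E} => ~~ all_zero w A) bs) *
    (t.+1 ^ c0) ^ size bs * t.+1 ^ #|D|
  = t.+1 ^ #|E| * (2 * t.+1 ^ c0).-1 ^ size bs.
Proof.
elim: bs D => [|B bs IH] D /=.
  move=> _ _ _; rewrite !muln1; under eq_bigr do rewrite expn0.
  by rewrite sum1dep_card card_all_zero.
move=> /andP[dB db] /andP[/eqP cB cb] /andP[dBD dbD].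
set T := t.+1 ^ c0; have T0 : 0 < T by rewrite expn_gt0.
have dbDB : all (fun A : {set E} => [disjoint A & D :|: B]) bs.
  apply/allP => A Ab; rewrite -setI_eq0 setIUr setU_eq0 !setI_eq0 (allP dbD _ Ab) /=.
  by rewrite disjoint_sym (allP dB).
have cDB : #|D :|: B| = #|D| + c0.
  by rewrite cardsU cB (_ : D :&: B = set0) ?cards0 ?subn0 //; apply/eqP; rewrite setI_eq0 disjoint_sym.
have IH1 := IH D db cb dbD; have IH2 := IH (D :|: B) db cb dbDB.
set G1 := \sum_(w | all_zero w D) 2 ^ count _ bs in IH1.
set G2 := \sum_(w | all_zero w (D :|: B)) 2 ^ count _ bs in IH2.
set G := \sum_(w | _) _.
(* Splitting on whether [B] is present: an absent [B] doubles the weight and a present one keeps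
   it. *)
have EG : G + G2 = 2 * G1.
  rewrite /G /G2 /G1 big_distrr /= (bigID (fun w => all_zero w B) (all_zero^~ D)) /=.
  rewrite [RHS](bigID (fun w => all_zero w B) (all_zero^~ D)) /=.
  under [X in _ + X]eq_bigl do rewrite all_zeroU.
  rewrite addnAC -big_split /=; congr (_ + _); apply: eq_bigr => w /andP[_ wB].
    by rewrite wB /= add0n mul2n addnn.
  by rewrite wB expnD.
rewrite cDB expnD -/T in IH2; rewrite -/T in IH1.
rewrite !expnS -/T.
move: (T ^ size bs) (t.+1 ^ #|D|) (t.+1 ^ #|E|) ((2 * T).-1 ^ size bs) IH1 IH2 => p d e q IH1 IH2.
have H1 : (G + G2) * (T * p * d) = 2 * T * (e * q).
  by rewrite EG -IH1 -!mulnA; congr (2 * _); rewrite mulnCA.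
have H2 : G2 * (T * p * d) = e * q by rewrite -IH2 [d * T]mulnC !mulnA [G2 * T * p]mulnAC.
have H3 : (2 * T).-1 * (e * q) + e * q = 2 * T * (e * q).
  by rewrite -mulSnr prednK // muln_gt0.
apply: (@addIn (e * q)).
have -> : e * ((2 * T).-1 * q) = (2 * T).-1 * (e * q) by rewrite mulnCA.
rewrite H3 -H1 mulnDl H2.
by rewrite -!mulnA.
Qed.

(** Markov's inequality for 2^(absent blocks). With T = (t+1)^c0 each block contributes the factor
    2(1 - 1/(2T)) on average, and over 2TM blocks the second factors multiply to at most 2^(-M). *)
Lemma absent_blocks_tail c0 (bs : seq {set E}) M y :
  pairwise (fun A B : {set E} => [disjoint A & B]) bs -> all (fun A : {set E} => #|A| == c0) bs ->
  size bs = 2 * t.+1 ^ c0 * M ->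
  #|[set w | count (all_zero w) bs < y]| * 2 ^ M <= t.+1 ^ #|E| * 2 ^ y.
Proof.
move=> db cb sb.
have := @sum_absent_blocks c0 bs set0 db cb.
rewrite cards0 muln1 => /(_ _); have -> : all (fun A : {set E} => [disjoint A & set0]) bs.
  by apply/allP => A _; rewrite -setI_eq0 setI0.
move/(_ isT).
set T := t.+1 ^ c0 in sb *; have T0 : 0 < T by rewrite expn_gt0.
set sm := \sum_(w | _) _ => Hs.
have H1 : #|[set w | count (all_zero w) bs < y]| * 2 ^ size bs <= 2 ^ y * sm.
  rewrite -sum1_card big_distrl /sm big_distrr /= [leqRHS](bigID (fun w => count (all_zero w) bs < y)) /=.
  apply: leq_trans (leq_addr _ _).
  rewrite (eq_bigl (fun w => all_zero w set0 && (count (all_zero w) bs < y))); last first.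
    move=> w; rewrite !inE; case: (count _ _ < y); rewrite ?andbF ?andbT //; symmetry; apply/forall_inP => e; by rewrite inE.
  apply: leq_sum => w /andP[_ /ltnW wy]; rewrite mul1n -expnD leq_exp2l //.
  by rewrite -(count_predC (all_zero w)) leq_add2r.
have H2 : (2 * T).-1 ^ size bs * 2 ^ M <= 2 ^ size bs * T ^ size bs.
  rewrite -expnMn sb; have : 0 < 2 * T by rewrite muln_gt0.
  move: (2 * T) => n n0.
  rewrite !(expnM _ n M) -expnMn; case: (posnP M) => [->|M0]; first by rewrite !expn0.
  by rewrite leq_exp2r // pow_half.
have X0 : 0 < 2 ^ size bs * T ^ size bs by rewrite muln_gt0 !expn_gt0.
rewrite -(leq_pmul2r X0).
apply: (@leq_trans (2 ^ y * (sm * T ^ size bs) * 2 ^ M)).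
  have -> : forall a b c d, a * b * (c * d) = (a * c) * d * b by move=> *; nia.
  rewrite [2 ^ y * _]mulnA; apply: leq_mul => //; exact: leq_mul.
rewrite Hs; apply: (@leq_trans (2 ^ y * t.+1 ^ #|E| * (2 ^ size bs * T ^ size bs))).
  by rewrite mulnA -[leqLHS]mulnA leq_mul2l H2 orbT.
by rewrite [2 ^ y * _]mulnC.
Qed.

End RandomFunctions.

Lemma leq_card_bigcup (I T : finType) (A : pred I) (F : I -> {set T}) :
  #|\bigcup_(i | A i) F i| <= \sum_(i | A i) #|F i|.
Proof.
elim/big_rec2: _ => [|i n X _ le]; first by rewrite cards0.
by apply: leq_trans (leq_card_setU _ _).1 _; rewrite leq_add2l.
Qed.

Lemma pairwise_enum (T : finType) (A : {set T}) (r : rel T) :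
  (forall x y, x \in A -> y \in A -> x != y -> r x y) -> pairwise r (enum A).
Proof.
move=> rA; apply: (@sub_in_pairwise _ (mem A) (fun x y => x != y)).
- by move=> x y; exact: rA.
- by apply/allP => x; rewrite mem_enum.
- by have := enum_uniq A; rewrite uniq_pairwise.
Qed.

Section Deletion.
Variable P : finType.
Implicit Types (K C e : {set P}) (A : {set {set P}}).

Definition pairs K : {set {set P}} := [set e : {set P} | (e \subset K) && (#|e| == 2)].

Lemma card_pairs K : #|pairs K| = 'C(#|K|, 2).
Proof. exact: cards_draws. Qed.

Lemma pairs_disjoint K K' : #|K :&: K'| <= 1 -> [disjoint pairs K & pairs K'].
Proof.
move=> le; rewrite -setI_eq0; apply/eqP/setP => e; rewrite !inE; apply/negP.
case/andP => /andP[eK /eqP e2] /andP[eK' _].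
have : #|e| <= #|K :&: K'| by apply: subset_leq_card; rewrite subsetI eK.
by rewrite e2 => /leq_trans/(_ le).
Qed.

Definition edge_disjoint A :=
  [forall C in A, forall C' in A, (C != C') ==> [disjoint pairs C & pairs C']].

Lemma card_edge_disjoint A c : edge_disjoint A -> (forall C, C \in A -> #|pairs C| = c) ->
  #|\bigcup_(C in A) pairs C| = #|A| * c.
Proof.
move=> Ad Ac; pose F C := if C \in A then pairs C else set0.
have disj C C' : C != C' -> [disjoint F C & F C'].
  rewrite /F => CC'; case: ifP => CA; last by rewrite -setI_eq0 set0I.
  case: ifP => CA'; last by rewrite -setI_eq0 setI0.
  by move/forall_inP: Ad => /(_ C CA)/forall_inP/(_ C' CA')/implyP/(_ CC').
rewrite big_mkcond -sum1_card partition_disjoint_bigcup //.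
rewrite -sum_nat_const [RHS]big_mkcond; apply: eq_bigr => C _; rewrite sum1_card /F.
by case: ifP => [/Ac|]; rewrite ?cards0.
Qed.

(* Random graph with edge probability [1 / t.+1], from which the edges of a maximal
   edge-disjoint family of forbidden cliques are deleted. *)
Lemma deletion_method (I : finType) (t s D x : nat) (CC : {set {set P}})
    (Bl : I -> {set {set P}}) : 0 < s -> 0 < x ->
  (forall C, C \in CC -> #|C| = s.+1) ->
  (forall e, #|e| = 2 -> #|[set C in CC | e \subset C]| <= D) ->
  (forall i K, K \in Bl i -> #|K| = s) ->
  (forall i K K', K \in Bl i -> K' \in Bl i -> K != K' -> #|K :&: K'| <= 1) ->
  (forall i, #|Bl i| = 2 * t.+1 ^ 'C(s, 2) * ('C(s.+1, 2).+1 * x)) ->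
  16 * 'C(s.+1, 2).+1 * 'C(s, 2) * D <= t.+1 ^ s ->
  2 * #|I| < 2 ^ x ->
  exists H : rel P, [/\ forall u v, H u v = H v u, forall v, H v v = false,
    forall C, C \in CC -> exists u v, [/\ u \in C, v \in C, u != v & ~~ H u v] &
    forall i, exists2 K, K \in Bl i & forall u v, u \in K -> v \in K -> u != v -> H u v].
Proof.
set c1 := 'C(s.+1, 2); set c0 := 'C(s, 2) => s0 x0 CCs CCD Bls Bld Blc numD numI.
set T := t.+1 ^ c0 in Blc.
have ec1 : t.+1 ^ c1 = T * t.+1 ^ s by rewrite /c1 binS bin1 expnD.
pose Om := {ffun {set P} -> 'I_t.+1}.
have cOm : #|Om| = t.+1 ^ #|{set P}| by rewrite card_ffun card_ord.
(* Only forbidden cliques sharing a pair with a block of [Bl i] can damage such a block when edges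
   are deleted. *)
pose Ci i := [set C in CC | [exists K in Bl i, ~~ [disjoint pairs C & pairs K]]].
have cCi i : 8 * #|Ci i| <= x * t.+1 ^ c1.
  have sub : Ci i \subset \bigcup_(K in Bl i) \bigcup_(e in pairs K) [set C in CC | e \subset C].
    apply/subsetP => C; rewrite inE => /andP[CC' /exists_inP[K KB]].
    rewrite -setI_eq0 => /set0Pn[e]; rewrite inE => /andP[eC eK].
    apply/bigcupP; exists K => //; apply/bigcupP; exists e => //.
    by move: eC; rewrite !inE CC' => /andP[].
  have : #|Ci i| <= #|Bl i| * (c0 * D).
    apply: leq_trans (subset_leq_card sub) _; apply: leq_trans (leq_card_bigcup _ _) _.
    rewrite -sum_nat_const; apply: leq_sum => K KB; apply: leq_trans (leq_card_bigcup _ _) _.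
    rewrite /c0 -(Bls i K KB) -card_pairs -sum_nat_const; apply: leq_sum => e.
    by rewrite inE => /andP[_ /eqP]; exact: CCD.
  rewrite Blc ec1 => le.
  apply: (@leq_trans (x * T * (16 * c1.+1 * c0 * D))); last first.
    by rewrite -[leqLHS]mulnA !leq_mul2l numD !orbT.
  move: le; move: (#|Ci i|) (c1.+1) => n m le.
  apply: leq_trans (leq_mul (leqnn 8) le) _.
  have -> : 8 * (2 * T * (m * x) * (c0 * D)) = x * T * (16 * m * c0 * D) by nia.
  exact: leqnn.
(* Too few blocks are present, or, in [bad2], too many edge-disjoint forbidden cliques near them.
   Each event has probability at most 2^(-x), so [2 * #|I| < 2 ^ x] suffices for the union bound. *)
pose bad1 i := [set w : Om | count (all_zero w) [seq pairs K | K <- enum (Bl i)] < c1 * x].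
pose bad2 i := [set w : Om | [exists A : {set {set P}},
  [&& A \subset Ci i, #|A| == x, edge_disjoint A & all_zero w (\bigcup_(C in A) pairs C)]]].
have b1 i : #|bad1 i| * 2 ^ x <= #|Om|.
  have := @absent_blocks_tail _ t c0 [seq pairs K | K <- enum (Bl i)] (c1.+1 * x) (c1 * x).
  rewrite size_map -cardE Blc => /(_ _ _ erefl); rewrite -cOm => H.
  rewrite -(@leq_pmul2r (2 ^ (c1 * x))) ?expn_gt0 // -mulnA -expnD -mulSn; apply: H.
    rewrite pairwise_map; apply: pairwise_enum => K K' KB K'B ne.
    by apply: pairs_disjoint; apply: (Bld i).
  apply/allP => _ /mapP[K KB ->]; rewrite card_pairs (Bls i) //; by rewrite -mem_enum.
have b2 i : #|bad2 i| * 2 ^ x <= #|Om|.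
  pose FA := [set A : {set {set P}} | (A \subset Ci i) && (#|A| == x)].
  have cFA : #|FA| = 'C(#|Ci i|, x) by exact: cards_draws.
  have sub : bad2 i \subset \bigcup_(A in [set A in FA | edge_disjoint A])
      [set w : Om | all_zero w (\bigcup_(C in A) pairs C)].
    apply/subsetP => w; rewrite inE => /existsP[A /and4P[AC Ax Ad Aw]].
    by apply/bigcupP; exists A; rewrite !inE ?AC ?Ax.
  have H1 : #|bad2 i| * t.+1 ^ (c1 * x) <= 'C(#|Ci i|, x) * #|Om|.
    apply: leq_trans (leq_mul (subset_leq_card sub) (leqnn _)) _.
    apply: leq_trans (leq_mul (leq_card_bigcup _ _) (leqnn _)) _.
    rewrite big_distrl /= -cFA -sum_nat_const.
    apply: (@leq_trans (\sum_(A in [set A in FA | edge_disjoint A]) #|Om|)); last first.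
      rewrite !sum_nat_const leq_mul2r; apply/orP; right; apply: subset_leq_card.
      by apply/subsetP => A; rewrite inE => /andP[].
    apply: leq_sum => A; rewrite !inE => /andP[/andP[AC /eqP Ax] Ad].
    rewrite cOm -(card_all_zero t (\bigcup_(C in A) pairs C)).
    rewrite (card_edge_disjoint (c := c1) Ad) ?Ax 1?[x * _]mulnC //.
    move=> C /(subsetP AC); rewrite inE card_pairs => /andP[CC' _].
    by rewrite CCs.
  (* An edge-disjoint family of x cliques is present with probability (t+1)^(-c1 x); the factor 8 in
     [cCi] covers the 4 of [bin_expn_le] and the 2 of 2^x. *)
  have H2 : 'C(#|Ci i|, x) * 2 ^ x <= t.+1 ^ (c1 * x).
    have xx0 : 0 < x ^ x by rewrite expn_gt0 x0.
    rewrite -(leq_pmul2r xx0) mulnAC.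
    apply: (@leq_trans ((4 * #|Ci i|) ^ x * 2 ^ x)); first by rewrite leq_mul2r bin_expn_le orbT.
    rewrite -expnMn expnM -expnMn leq_exp2r // [t.+1 ^ c1 * x]mulnC.
    apply: leq_trans (cCi i); move: (#|Ci i|) => n; lia.
  have T0 : 0 < t.+1 ^ (c1 * x) by rewrite expn_gt0.
  rewrite -(leq_pmul2r T0) mulnAC; apply: leq_trans (leq_mul H1 (leqnn _)) _.
  by rewrite mulnAC mulnC leq_mul2l H2 orbT.
have [w wgood] : exists w : Om, forall i, w \notin bad1 i :|: bad2 i.
  apply: NNPP => no.
  have sub : [set: Om] \subset \bigcup_i (bad1 i :|: bad2 i).
    apply/subsetP => w _; apply/bigcupP; apply: NNPP => nb; apply: no; exists w => i.
    by apply/negP => wi; apply: nb; exists i.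
  have := leq_trans (subset_leq_card sub) (leq_card_bigcup _ _); rewrite cardsT => le.
  have : #|Om| * 2 ^ x <= 2 * #|I| * #|Om|.
    apply: leq_trans (leq_mul le (leqnn _)) _; rewrite big_distrl /=.
    rewrite [2 * _]mulnC -mulnA -sum_nat_const; apply: leq_sum => i _.
    apply: leq_trans (leq_mul (leq_card_setU _ _).1 (leqnn _)) _.
    by rewrite mulnDl mul2n -addnn leq_add.
  rewrite mulnC leq_pmul2r; first by rewrite leqNgt numI.
  by rewrite cOm expn_gt0.
pose okF (F : {set {set P}}) := [&& F \subset CC, edge_disjoint F & all_zero w (\bigcup_(C in F) pairs C)].
(* Maximality kills every forbidden clique: one that survived the deletion could be added to [F]. *)
have [F Fmax] : {F | maxset okF F}.
  apply: ex_maxset; exists set0; rewrite /okF sub0set big_set0.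
  by apply/and3P; split=> //; apply/forall_inP => ?; rewrite inE.
have /and3P[FC Fd Fw] : okF F by case/maxsetP: Fmax.
pose del := \bigcup_(C in F) pairs C.
exists (fun u v => [&& u != v, w [set u; v] == ord0 & [set u; v] \notin del]); split.
- by move=> u v; rewrite setUC eq_sym.
- by move=> v; rewrite eqxx.
- move=> C CC'; apply: NNPP => no.
  have Hall e : e \in pairs C -> w e = ord0 /\ e \notin del.
    rewrite inE => /andP[eC /cards2P[u [v [uv ee]]]]; subst e.
    move: eC; rewrite subUset !sub1set => /andP[uC vC].
    apply: NNPP => h; apply: no; exists u, v; split=> //.
    by rewrite uv /=; apply/negP => /andP[/eqP w0 nd]; apply: h.
  have okC : okF (C |: F).
    apply/and3P; split; first by rewrite subUset sub1set CC'.
      have CF C' : C' \in F -> [disjoint pairs C & pairs C'].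
        move=> C'F; rewrite -setI_eq0; apply/set0Pn => -[e]; rewrite inE => /andP[/Hall[_ eD] eC'].
        by case/negP: eD; apply/bigcupP; exists C'.
      apply/forall_inP => C1; rewrite !inE => /orP[/eqP->|C1F]; apply/forall_inP => C2;
        rewrite !inE => /orP[/eqP->|C2F]; apply/implyP => ne; first by rewrite eqxx in ne.
      - exact: CF.
      - by rewrite disjoint_sym; exact: CF.
      - by move/forall_inP: Fd => /(_ _ C1F)/forall_inP/(_ _ C2F)/implyP/(_ ne).
    apply/forall_inP => e /bigcupP[C1]; rewrite in_setU1 => /orP[/eqP->|C1F] eC.
      by have [-> _] := Hall e eC.
    by move/forall_inP: Fw; apply; apply/bigcupP; exists C1.
  have CF : C \in F.
    have [_ /(_ _ okC (subsetUr _ _)) <-] := maxsetP Fmax; by rewrite setU11.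
  have /card_gt0P[e eC] : 0 < #|pairs C| by rewrite card_pairs CCs // bin_gt0.
  have [_ /negP] := Hall e eC; apply; by apply/bigcupP; exists C.
- move=> i; apply: NNPP => no; have := wgood i; rewrite !inE negb_or => /andP[nb1 nb2].
  (* Fewer than [x] cliques of [F] touch these blocks, so fewer than [c1 * x] deleted pairs matter.
     Each spoils at most one block, as blocks share no pairs, whereas at least [c1 * x] blocks are
     present. *)
  pose Pi := [set K in Bl i | all_zero w (pairs K)].
  pose F' := F :&: Ci i.
  have F'd : edge_disjoint F'.
    apply/forall_inP => C1; rewrite inE => /andP[C1F _]; apply/forall_inP => C2.
    by rewrite inE => /andP[C2F _]; move/forall_inP: Fd => /(_ _ C1F)/forall_inP/(_ _ C2F).
  have cF' : #|F'| < x.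
    rewrite ltnNge; apply/negP => /subset_card_exists[A AF' Ax].
    case/negP: nb2; apply/existsP; exists A; rewrite Ax eqxx /=; apply/and3P; split.
    - by apply: subset_trans AF' _; rewrite subsetIr.
    - apply/forall_inP => C1 /(subsetP AF') C1F; apply/forall_inP => C2 /(subsetP AF') C2F.
      by move/forall_inP: F'd => /(_ _ C1F)/forall_inP/(_ _ C2F).
    - apply/forall_inP => e /bigcupP[C /(subsetP AF')]; rewrite inE => /andP[CF _] eC.
      by move/forall_inP: Fw; apply; apply/bigcupP; exists C.
  pose E' := \bigcup_(C in F') pairs C.
  have cE' : #|E'| = #|F'| * c1.
    apply: card_edge_disjoint => // C; rewrite inE => /andP[/(subsetP FC) CC' _].
    by rewrite card_pairs CCs.
  have PiE K : K \in Pi -> exists e, e \in pairs K :&: E'.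
    rewrite inE => /andP[KB Kw]; apply: NNPP => ne; apply: no; exists K => // u v uK vK uv.
    have eK : [set u; v] \in pairs K by rewrite inE cards2 uv subUset !sub1set uK vK.
    rewrite uv (forall_inP Kw) //=; apply/negP => /bigcupP[C CF eC]; apply: ne.
    exists [set u; v]; rewrite inE eK; apply/bigcupP; exists C => //.
    rewrite !inE CF (subsetP FC) //=; apply/exists_inP; exists K => //.
    by rewrite -setI_eq0; apply/set0Pn; exists [set u; v]; rewrite inE eC.
  pose f K := odflt set0 [pick e in pairs K :&: E'].
  have fP K : K \in Pi -> f K \in pairs K :&: E'.
    move=> /PiE[e eK]; rewrite /f; case: pickP => [e' //|/(_ e)]; by rewrite eK.
  have : #|Pi| <= #|E'|.
    rewrite -(@card_in_imset _ _ f); last first.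
      move=> K K' KP K'P fe; apply/eqP; apply/negP => /negP ne.
      have := fP K KP; have := fP K' K'P; rewrite -fe !inE -!/(pairs _).
      have : [disjoint pairs K & pairs K'].
        by apply: pairs_disjoint; apply: (Bld i) => //; [case/setIdP: KP|case/setIdP: K'P].
      rewrite -setI_eq0 => /eqP/setP/(_ (f K)); rewrite !inE.
      by move=> h /andP[h1 _] /andP[h2 _]; rewrite h1 h2 in h.
    by apply: subset_leq_card; apply/subsetP => _ /imsetP[K /fP + ->]; rewrite inE => /andP[].
  rewrite cE'; have -> : #|Pi| = count (all_zero w) [seq pairs K | K <- enum (Bl i)].
    rewrite count_map -size_filter cardE; apply/perm_size/uniq_perm.
    - exact: enum_uniq.
    - exact/filter_uniq/enum_uniq.
    - by move=> K; rewrite mem_enum mem_filter mem_enum inE andbC.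
  move=> le; move: nb1; rewrite -leqNgt => /leq_trans/(_ le).
  by rewrite mulnC leq_pmul2r ?bin_gt0 // leqNgt cF'.
Qed.

End Deletion.

(** * Random partitions *)

Section RandomPartition.
Variables (E : finType) (s : nat).
Hypothesis s_gt0 : 0 < s.

(** [F] names a scarce part for [m] of the chunks. Markov's inequality is applied to 2^(points
    outside the named part): a point contributes 2(1 - 1/(2s)) on average, and the second factor
    gains 2^(-a') over the 2 s a' points of a chunk. *)
Lemma card_unbalanced (L : finType) (m a' c : nat) (Q : L -> {set E}) (F : L -> option 'I_s) :
  (forall b, #|Q b| = 2 * s * a') -> (forall b b', b != b' -> [disjoint Q b & Q b']) ->
  #|[set b | F b != None]| = m -> c <= a' ->
  #|[set chi : {ffun E -> 'I_s} | [forall b, if F b is Some j then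
      #|[set x in Q b | chi x == j]| < c else true]]| * 2 ^ (a' * m) <= 2 ^ (c * m) * s ^ #|E|.
Proof.
move=> Qa Qd Fm ca; set a := 2 * s * a' in Qa.
set X := [set chi | _].
have ca2 : c <= a by rewrite /a; nia.
pose G b := if F b != None then Q b else set0.
have Gd b b' : b != b' -> [disjoint G b & G b'].
  rewrite /G => bb'; case: ifP => Fb; last by rewrite -setI_eq0 set0I.
  case: ifP => Fb'; last by rewrite -setI_eq0 setI0.
  exact: Qd.
pose w (o : option 'I_s) (v : 'I_s) := if o is Some j then (if v == j then 1 else 2) else 1.
pose tau x := if [pick b | x \in G b] is Some b then F b else None.
have tauG b x : x \in G b -> tau x = F b.
  rewrite /tau => xb; case: pickP => [b' xb'|/(_ b)]; last by rewrite xb.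
  congr F; apply/eqP; apply/negP => /negP /Gd; rewrite -setI_eq0 => /eqP/setP/(_ x).
  by rewrite !inE xb xb'.
have tauN x : x \notin \bigcup_b G b -> tau x = None.
  rewrite /tau => nx; case: pickP => // b xb; case/negP: nx; by apply/bigcupP; exists b.
set Tg := \bigcup_b G b.
have cTg : #|Tg| = a * m.
  rewrite -sum1_card partition_disjoint_bigcup //= -Fm mulnC -sum_nat_const [RHS]big_mkcond /=.
  apply: eq_bigr => b _; rewrite sum1_card /G inE; case: ifP => _; by rewrite ?Qa ?cards0.
have sumw x : \sum_v w (tau x) v = if x \in Tg then (2 * s).-1 else s.
  case: ifP => [/bigcupP[b _ xb]|/negbT/tauN->]; last by rewrite sum1_card card_ord.
  rewrite (tauG b x xb); move: xb; rewrite /G; case: (F b) => [j|]; rewrite ?inE //= => _.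
  rewrite (bigD1 j) //= eqxx (eq_bigr (fun _ => 2)); last by move=> i /negbTE->.
  rewrite sum_nat_const (eq_card (B := [set~ j])); last by move=> i; rewrite !inE.
  by rewrite cardsC1 card_ord; lia.
have total : (\sum_(chi : {ffun E -> 'I_s}) \prod_x w (tau x) (chi x)) * s ^ (a * m)
    = (2 * s).-1 ^ (a * m) * s ^ #|E|.
  rewrite -(bigA_distr_bigA (fun x => w (tau x))) /=.
  under eq_bigr do rewrite sumw.
  have -> : s ^ (a * m) = \prod_x (if x \in Tg then s else 1).
    by rewrite -cTg -prod_nat_const big_mkcond.
  have -> : (2 * s).-1 ^ (a * m) = \prod_x (if x \in Tg then (2 * s).-1 else 1).
    by rewrite -cTg -prod_nat_const big_mkcond.
  rewrite -big_split /= -prod_nat_const -big_split /=.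
  by apply: eq_bigr => x _; case: ifP; rewrite ?muln1 ?mul1n.
have low (chi : {ffun E -> 'I_s}) : chi \in X -> 2 ^ ((a - c) * m) <= \prod_x w (tau x) (chi x).
  rewrite inE => /forallP chiX.
  rewrite (bigID (mem Tg)) /= [X in _ <= _ * X]big1 ?muln1; last by move=> x /tauN->.
  have -> : 2 ^ ((a - c) * m) = \prod_b (if F b != None then 2 ^ (a - c) else 1).
    by rewrite expnM -Fm -prod_nat_const big_mkcond; apply: eq_bigr => b _; rewrite inE.
  rewrite partition_disjoint_bigcup //=; apply: leq_prod => b _; case: ifP => Fb //; last by rewrite prodn_gt0 // => x; rewrite /w; case: (tau x) => // j; case: ifP.
  have := chiX b; case eF: (F b) Fb => [j|] // _ lt.
  have GQ : G b = Q b by rewrite /G eF.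
  rewrite GQ (eq_bigr (fun x => if chi x == j then 1 else 2)); last first.
    by move=> x xb; rewrite (tauG b) ?GQ // eF.
  rewrite (bigID (fun x => chi x == j)) /= [X in _ <= X * _]big1 ?mul1n; last by move=> x /andP[_ ->].
  rewrite (eq_bigr (fun _ => 2)); last by move=> x /andP[_ /negbTE->].
  rewrite prod_nat_const leq_exp2l // leq_subLR.
  rewrite -(Qa b) -(cardID (mem [set x | chi x == j]) (mem (Q b))) leq_add //.
    rewrite ltnW //; move: lt; congr (_ < _); apply: eq_card => x; by rewrite !inE.
  by apply: subset_leq_card; apply/subsetP => x; rewrite !inE andbC.
have H1 : #|X| * 2 ^ ((a - c) * m) * s ^ (a * m) <= (2 * s).-1 ^ (a * m) * s ^ #|E|.
  rewrite -total leq_mul2r; apply/orP; right.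
  rewrite [leqRHS](bigID (mem X)) /= -sum_nat_const; apply: leq_trans (leq_addr _ _).
  exact: leq_sum.
have H2 : (2 * s).-1 ^ (a * m) * 2 ^ (a' * m) <= 2 ^ (a * m) * s ^ (a * m).
  rewrite -expnMn -/a (expnM _ a m) (expnM _ a' m) -expnMn [leqRHS]expnM.
  case: (posnP m) => [->|m0]; first by rewrite !expn0.
  rewrite leq_exp2r // /a; have : 0 < 2 * s by rewrite muln_gt0.
  move: (2 * s) => n n0; rewrite !(expnM _ n a') -expnMn.
  by case: (posnP a') => [->|a0]; rewrite ?expn0 // leq_exp2r // pow_half.
have X0 : 0 < 2 ^ ((a - c) * m) * s ^ (a * m) by rewrite muln_gt0 !expn_gt0 s_gt0.
rewrite -(leq_pmul2r X0).
apply: (@leq_trans ((2 * s).-1 ^ (a * m) * s ^ #|E| * 2 ^ (a' * m))).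
  apply: leq_trans (leq_mul H1 (leqnn (2 ^ (a' * m)))).
  by rewrite -!mulnA; apply/eq_leq; congr (_ * _); rewrite mulnC -!mulnA.
rewrite mulnAC; apply: leq_trans (leq_mul H2 (leqnn _)) _.
have -> : 2 ^ (a * m) = 2 ^ (c * m) * 2 ^ ((a - c) * m) by rewrite -expnD -mulnDl subnKC.
by apply/eq_leq; rewrite -!mulnA; congr (_ * _); rewrite mulnA mulnC.
Qed.

(** If fewer than [m] of the [2 * m] chunks are balanced, then [m] others each have a scarce part.
    The union bound runs over these witnesses, functions into [option 'I_s], of which there are at
    most (s+1)^(2m). *)
Lemma exists_balanced_partition (I L : finType) (m a' c : nat) (Q : I -> L -> {set E}) :
  #|L| = 2 * m ->
  (forall i b, #|Q i b| = 2 * s * a') ->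
  (forall i b b', b != b' -> [disjoint Q i b & Q i b']) -> c <= a' ->
  #|I| * s.+1 ^ (2 * m) < 2 ^ ((a' - c) * m) ->
  exists chi : {ffun E -> 'I_s}, forall i,
    m <= #|[set b | [forall j, c <= #|[set x in Q i b | chi x == j]|]]|.
Proof.
move=> Lm Qa Qd ca num; apply: NNPP => no.
pose X i (F : {ffun L -> option 'I_s}) :=
  [set chi : {ffun E -> 'I_s} | [forall b, if F b is Some j then
      #|[set x in Q i b | chi x == j]| < c else true]].
pose Fam := [set F : {ffun L -> option 'I_s} | #|[set b | F b != None]| == m].
have sub : [set: {ffun E -> 'I_s}] \subset \bigcup_i \bigcup_(F in Fam) X i F.
  apply/subsetP => chi _.
  have [i gi] : exists i, #|[set b | [forall j, c <= #|[set x in Q i b | chi x == j]|]]| < m.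
    apply: NNPP => ni; apply: no; exists chi => i; rewrite leqNgt; apply/negP => lt.
    by apply: ni; exists i.
  pose Bd := [set b | [exists j, #|[set x in Q i b | chi x == j]| < c]].
  have cBd : m <= #|Bd|.
    have := cardsC [set b | [forall j, c <= #|[set x in Q i b | chi x == j]|]].
    have -> : ~: [set b | [forall j, c <= #|[set x in Q i b | chi x == j]|]] = Bd.
      apply/setP => b; rewrite !inE negb_forall; apply: eq_existsb => j; by rewrite ltnNge.
    by rewrite Lm; move: gi; lia.
  have [B' sB' cB'] := subset_card_exists cBd.
  pose F : {ffun L -> option 'I_s} := [ffun b => if b \in B' then
     [pick j | #|[set x in Q i b | chi x == j]| < c] else None].
  apply/bigcupP; exists i => //; apply/bigcupP; exists F; rewrite inE.
    apply/eqP; rewrite -[RHS]cB'; apply: eq_card => b; rewrite inE ffunE.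
    case: ifP => // /(subsetP sB'); rewrite inE => /existsP[j jb].
    by case: pickP => // /(_ j); rewrite jb.
  apply/forallP => b; rewrite ffunE; case: ifP => // _; by case: pickP.
have cX i F : F \in Fam -> #|X i F| * 2 ^ (a' * m) <= 2 ^ (c * m) * s ^ #|E|.
  by rewrite inE => /eqP Fm; exact: card_unbalanced (Qa i) (Qd i) Fm ca.
have := leq_trans (subset_leq_card sub) (leq_card_bigcup _ _).
rewrite cardsT card_ffun card_ord => le.
have : s ^ #|E| * 2 ^ (a' * m) <= #|I| * s.+1 ^ (2 * m) * (2 ^ (c * m) * s ^ #|E|).
  apply: leq_trans (leq_mul le (leqnn _)) _; rewrite big_distrl /= -mulnA -sum_nat_const.
  apply: leq_sum => i _; apply: leq_trans (leq_mul (leq_card_bigcup _ _) (leqnn _)) _.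
  rewrite big_distrl /=; apply: leq_trans (_ : \sum_(F in Fam) 2 ^ (c * m) * s ^ #|E| <= _).
    by apply: leq_sum => F FF; apply: cX.
  rewrite sum_nat_const leq_mul2r; apply/orP; right; apply: leq_trans (max_card _) _.
  by rewrite card_ffun card_option card_ord Lm.
apply/negP; rewrite -ltnNge.
have -> : 2 ^ (a' * m) = 2 ^ ((a' - c) * m) * 2 ^ (c * m) by rewrite -expnD -mulnDl subnK.
rewrite [ltnRHS]mulnCA [s ^ #|E| * _]mulnC ltn_pmul2r // muln_gt0 !expn_gt0 s_gt0 //.
Qed.

End RandomPartition.

(** * Graphs on nets of lines *)

Lemma bin_leq_expn n k : 'C(n, k) <= n ^ k.
Proof.
apply: (@leq_trans ('C(n, k) * k`!)); first by rewrite leq_pmulr // fact_gt0.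
by rewrite bin_ffact; elim: k => // k IH; rewrite ffactnSr expnSr leq_mul // leq_subr.
Qed.

Lemma exists_injection (T : finType) (A : {set T}) n : n <= #|A| ->
  exists f : {ffun 'I_n -> T}, injective f /\ forall i, f i \in A.
Proof.
move=> nA; exists [ffun i => enum_val (widen_ord nA i)]; split=> [i j|i]; last first.
  by rewrite ffunE; exact: enum_valP.
by rewrite !ffunE => /enum_val_inj /(congr1 val) /= /val_inj.
Qed.

Lemma design_lt s B (j : 'I_s) (x y : 'I_B) : x + j * y < s * B.
Proof. by have := ltn_ord j; have := ltn_ord x; have := ltn_ord y; nia. Qed.

(** A pair (x, y) stands for the line j -> x + jy, and two distinct lines agree in at most one
    place; hence the transversals built from them share at most one point. *)
Lemma design_inj (j j' x x' y y' : nat) : j != j' ->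
  x + j * y = x' + j * y' -> x + j' * y = x' + j' * y' -> x = x' /\ y = y'.
Proof.
move=> jj e e'; suff ey : y = y' by subst y'; split=> //; lia.
by case: (ltngtP y y') => // lt; case: (ltngtP j j') jj => // ltj _; nia.
Qed.

(** Greedy choice: before each of the [q] rounds more than half of the 2aq points remain, so one of
    the at most [q] fibres of [f] still has [a] of them. *)
Lemma chunks_exist (P J : finType) (f : P -> J) (S : {set P}) (a q : nat) :
  0 < a -> #|J| <= q -> 2 * a * q <= #|S| ->
  exists Q : 'I_q -> {set P}, [/\ forall l, Q l \subset S, forall l, #|Q l| = a,
    forall l u v, u \in Q l -> v \in Q l -> f u = f v &
    forall l l', l != l' -> [disjoint Q l & Q l']].
Proof.
move=> a0 Jq Sq.
suff H j : j <= q -> exists Q : nat -> {set P}, [/\ forall l, l < j -> Q l \subset S,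
    forall l, l < j -> #|Q l| = a,
    forall l u v, l < j -> u \in Q l -> v \in Q l -> f u = f v &
    forall l l', l < j -> l' < j -> l != l' -> [disjoint Q l & Q l']].
  have [Q [Q1 Q2 Q3 Q4]] := H q (leqnn q).
  exists (fun l => Q l); split=> [l|l|l u v|l l' ll'].
  - exact: Q1.
  - exact: Q2.
  - exact: Q3.
  - exact: Q4.
elim: j => [|j IH] jq; first by exists (fun _ => set0).
have [Q [Q1 Q2 Q3 Q4]] := IH (ltnW jq).
pose R := S :\: \bigcup_(l < j) Q l.
have cU : #|\bigcup_(l < j) Q l| <= a * j.
  apply: leq_trans (leq_card_bigcup _ _) _.
  rewrite (eq_bigr (fun _ => a)); first by rewrite sum_nat_const card_ord mulnC.
  by move=> l _; apply: Q2.
have cR : a * q < #|R|.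
  have : #|S| <= #|R| + #|\bigcup_(l < j) Q l|.
    rewrite cardsD; have := subset_leq_card (subsetIr S (\bigcup_(l < j) Q l)); lia.
  have : a * j < a * q by rewrite ltn_pmul2l.
  move: Sq cU; rewrite -mulnA; move: (a * q) (a * j) => ? ?; lia.
have [c cc] : exists c, a <= #|[set x in R | f x == c]|.
  apply: NNPP => no; move: cR; rewrite ltnNge => /negP; apply.
  rewrite -sum1_card (partition_big f xpredT) //=.
  apply: (@leq_trans (\sum_(c : J) a)); last by rewrite sum_nat_const mulnC leq_mul2l Jq orbT.
  apply: leq_sum => c _; rewrite sum1dep_card leqNgt; apply/negP => /ltnW lt; apply: no.
  by exists c; rewrite cardsE in lt *.
have [T sT cT] := subset_card_exists cc.
have TR x : x \in T -> x \in R /\ f x = c.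
  by move=> /(subsetP sT); rewrite !inE => /andP[-> /eqP].
have Tdisj l : l < j -> [disjoint Q l & T].
  move=> lj; rewrite -setI_eq0; apply/set0Pn => -[x]; rewrite inE => /andP[xQ /TR[+ _]].
  rewrite inE => /andP[/negP H _]; apply: H; by apply/bigcupP; exists (Ordinal lj).
exists (fun l => if l == j then T else Q l); split.
- move=> l; rewrite ltnS; case: eqP => [_ _|/eqP lj le]; last by apply: Q1; rewrite ltn_neqAle lj.
  by apply/subsetP => x /TR[]; rewrite inE => /andP[].
- move=> l; rewrite ltnS; case: eqP => [//|/eqP lj le]; by apply: Q2; rewrite ltn_neqAle lj.
- move=> l u v; rewrite ltnS; case: eqP => [_ _ /TR[_ ->] /TR[_ ->]//|/eqP lj le].
  by apply: Q3; rewrite ltn_neqAle lj.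
- move=> l l'; rewrite !ltnS => le le' ne.
  have [lj|lj] := eqVneq l j; have [l'j|l'j] := eqVneq l' j.
  + by rewrite lj l'j eqxx in ne.
  + by rewrite disjoint_sym; apply: Tdisj; rewrite ltn_neqAle l'j.
  + by apply: Tdisj; rewrite ltn_neqAle lj.
  + by apply: Q4; rewrite ?ltn_neqAle ?lj ?l'j.
Qed.

Section Net.
Variables (P J : finType) (d : nat) (ic : 'I_d -> P -> J).
Hypothesis net : forall m m' u v, u != v -> ic m u = ic m v -> ic m' u = ic m' v -> m = m'.

Definition collinear u v := [exists m, ic m u == ic m v].

Definition bad_cliques (s : nat) := [set C : {set P} | [&& #|C| == s.+1,
  [forall u in C, forall v in C, collinear u v] &
  [forall m, exists u in C, exists v in C, ic m u != ic m v]]].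

(** Crossings of a line through [u] with a line through [v] of another slope; each pair of slopes
    gives at most one. *)
Definition meets u v := [set x | [exists m, exists m', [&& m != m', ic m x == ic m u & ic m' x == ic m' v]]].

Lemma card_meets u v : #|meets u v| <= d ^ 2.
Proof.
pose F (mm : 'I_d * 'I_d) := [set x | [&& mm.1 != mm.2, ic mm.1 x == ic mm.1 u & ic mm.2 x == ic mm.2 v]].
have sub : meets u v \subset \bigcup_mm F mm.
  apply/subsetP => x; rewrite inE => /existsP[m /existsP[m' H]].
  by apply/bigcupP; exists (m, m') => //; rewrite inE.
apply: leq_trans (subset_leq_card sub) _; apply: leq_trans (leq_card_bigcup _ _) _.
apply: (@leq_trans (\sum_(mm : 'I_d * 'I_d) 1)); last by rewrite sum1_card card_prod card_ord mulnn.
apply: leq_sum => -[m m'] _; rewrite leqNgt; apply/negP => /card_gt1P[x [y []]].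
rewrite !inE /= => /and3P[mm' /eqP e1 /eqP e2] /and3P[_ /eqP e3 /eqP e4] xy.
by move: mm'; rewrite (net xy (m := m) (m' := m')) ?e1 ?e3 ?e2 ?e4 ?eqxx.
Qed.

(** Such a clique has a point [x] off the line [uv], hence in [meets u v]. Any further point is also
    off that line, or is the crossing of that line with a line through [x]. So there are at most d^2
    choices of [x], and the rest lies in 2 d^2 points. *)
Lemma bad_cliques_at_pair s (e : {set P}) : #|e| = 2 -> 0 < s ->
  #|[set C in bad_cliques s | e \subset C]| <= (2 * d ^ 2) ^ s.
Proof.
move=> /eqP/cards2P[u [v [uv ->]]] s0.
pose Y x := meets u v :|: meets u x.
have cY x : #|Y x| <= 2 * d ^ 2.
  by apply: leq_trans (leq_card_setU _ _).1 _; rewrite mul2n -addnn leq_add // card_meets.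
pose W := \bigcup_(x in meets u v) [set D : {set P} | (D \subset Y x) && (#|D| == s.-1)].
have cW : #|W| <= (2 * d ^ 2) ^ s.
  apply: leq_trans (leq_card_bigcup _ _) _.
  apply: (@leq_trans (\sum_(x in meets u v) (2 * d ^ 2) ^ s.-1)).
    apply: leq_sum => x _; rewrite cards_draws; apply: leq_trans (bin_leq_expn _ _) _.
    by case: (s.-1) => // n; rewrite leq_exp2r.
  have -> : (2 * d ^ 2) ^ s = (2 * d ^ 2) * (2 * d ^ 2) ^ s.-1 by rewrite -expnS prednK.
  rewrite sum_nat_const leq_mul2r; apply/orP; right.
  by apply: leq_trans (card_meets _ _) _; rewrite leq_pmull.
apply: leq_trans cW.
rewrite -(@card_in_imset _ _ (fun C => C :\: [set u; v])); last first.
  move=> C C'; rewrite !inE => /andP[_ sC] /andP[_ sC'] eC.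
  by rewrite -(setID C [set u; v]) -(setID C' [set u; v]) eC (setIidPr sC) (setIidPr sC').
apply: subset_leq_card; apply/subsetP => _ /imsetP[C + ->]; rewrite inE => /andP[].
rewrite inE => /and3P[/eqP cC /forall_inP Ccol /forallP Cnot] sC.
have [uC vC] : u \in C /\ v \in C by apply/andP; rewrite -!sub1set -subUset.
have col x y : x \in C -> y \in C -> exists m, ic m x = ic m y.
  by move=> /Ccol/forall_inP H /H/existsP[m /eqP]; exists m.
have [m0 e0] := col u v uC vC.
have off z : z \in C -> ic m0 z != ic m0 u -> z \in meets u v.
  move=> zC nz; have [m eu] := col z u zC uC; have [m' ev] := col z v zC vC.
  rewrite inE; apply/existsP; exists m; apply/existsP; exists m'.
  rewrite eu ev !eqxx !andbT; apply/eqP => mm'; subst m'; move: nz.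
  by rewrite (@net m0 m u v) ?eu ?eqxx // -eu -ev.
have [x xC nx] : exists2 x, x \in C & ic m0 x != ic m0 u.
  have /exists_inP[a aC /exists_inP[b bC ab]] := Cnot m0.
  have [ea|na] := eqVneq (ic m0 a) (ic m0 u); last by exists a.
  by exists b => //; rewrite -ea eq_sym.
apply/bigcupP; exists x; first exact: off.
rewrite inE; apply/andP; split; last first.
  by rewrite cardsD cC (setIidPr sC) cards2 uv; case: (s) s0 => // n _; rewrite subn2.
apply/subsetP => z; rewrite !inE => /andP[_ zC].
have [ez|nz] := eqVneq (ic m0 z) (ic m0 u); last by have := off z zC nz; rewrite inE => ->.
apply/orP; right; have [m2 e2] := col z x zC xC.
apply/existsP; exists m0; apply/existsP; exists m2; rewrite ez e2 !eqxx !andbT.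
by apply: contraNneq nx => mm; rewrite -mm in e2; rewrite -ez e2.
Qed.

(* A chunk all of whose parts have at least [s * B] points contains [B ^ 2] pairwise
   edge-disjoint transversals: with the points of each part numbered, those taking the
   point number [x + j * y] from the part [j], for [x, y < B]. *)
Lemma blocks_exist (s B q m N : nat) (chi : {ffun 'I_d * P -> 'I_s}) (S : {set P})
    (Q : 'I_d * 'I_q -> {set P}) (p0 : P) : 1 < s ->
  (forall b, Q b \subset S) ->
  (forall b u v, u \in Q b -> v \in Q b -> ic b.1 u = ic b.1 v) ->
  (forall mm l l', l != l' -> [disjoint Q (mm, l) & Q (mm, l')]) ->
  m <= #|[set b | [forall j, s * B <= #|[set x in Q b | chi (b.1, x) == j]|]]| ->
  N <= m * (B * B) ->
  exists Bl : {set {set P}}, [/\ #|Bl| = N,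
    forall K, K \in Bl -> [/\ #|K| = s, K \subset S & exists mm, forall u v, u \in K -> v \in K ->
      ic mm u = ic mm v /\ (u != v -> chi (mm, u) != chi (mm, v))] &
    forall K K', K \in Bl -> K' \in Bl -> K != K' -> #|K :&: K'| <= 1].
Proof.
move=> s1 QS Qic Qd; set Gd := [set b | _] => mG Nm.
pose spec (bj : ('I_d * 'I_q) * 'I_s) (f : {ffun 'I_(s * B) -> P}) := bj.1 \in Gd ->
  injective f /\ forall i, f i \in Q bj.1 /\ chi (bj.1.1, f i) = bj.2.
have [pf pfP] : exists pf : ('I_d * 'I_q) * 'I_s -> {ffun 'I_(s * B) -> P}, forall bj, spec bj (pf bj).
  apply: (@fin_all_exists _ _ spec) => -[b j]; rewrite /spec /=.
  have [bG|nb] := boolP (b \in Gd); last by exists [ffun _ => p0].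
  have := bG; rewrite inE => /forallP/(_ j)/exists_injection[f [finj fA]].
  exists f => _; split=> // i; have := fA i; rewrite inE => /andP[-> /eqP] //.
pose idx (j : 'I_s) (x y : 'I_B) : 'I_(s * B) := Ordinal (design_lt j x y).
pose blk (t : ('I_d * 'I_q) * ('I_B * 'I_B)) : {set P} :=
  [set pf (t.1, j) (idx j t.2.1 t.2.2) | j : 'I_s].
have blkP t u : t.1 \in Gd -> u \in blk t -> exists j,
    [/\ u = pf (t.1, j) (idx j t.2.1 t.2.2), u \in Q t.1 & chi (t.1.1, u) = j].
  move=> tG /imsetP[j _ ->]; exists j; split=> //.
    by case: (pfP (t.1, j) tG) => _ /(_ (idx j t.2.1 t.2.2)) [].
  by case: (pfP (t.1, j) tG) => _ /(_ (idx j t.2.1 t.2.2)) [].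
have blk_card t : t.1 \in Gd -> #|blk t| = s.
  move=> tG; rewrite card_imset ?card_ord // => j j' e.
  have [_ /(_ (idx j t.2.1 t.2.2))[_ /= <-]] := pfP (t.1, j) tG.
  have [_ /(_ (idx j' t.2.1 t.2.2))[_ /= <-]] := pfP (t.1, j') tG.
  by rewrite e.
have blk_chi t u v : t.1 \in Gd -> u \in blk t -> v \in blk t ->
   ic t.1.1 u = ic t.1.1 v /\ (u != v -> chi (t.1.1, u) != chi (t.1.1, v)).
  move=> tG /(blkP _ _ tG)[j [eu uQ cu]] /(blkP _ _ tG)[j' [ev vQ cv]]; split; first exact: Qic.
  by move=> uv; rewrite cu cv; apply: contraNneq uv => jj; rewrite eu ev jj.
(* Two common points fix the slope by [net], then the chunk by disjointness, and finally the
   transversal by [design_inj]. *)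
have blk_sep t t' : t.1 \in Gd -> t'.1 \in Gd -> 1 < #|blk t :&: blk t'| -> t = t'.
  case: t t' => [[mm l] [x y]] [[mm' l'] [x' y']] /= tG tG' /card_gt1P[u [v []]].
  rewrite !inE => /andP[ut ut'] /andP[vt vt'] uv.
  have [j [/= eu uQ cu]] := blkP ((mm, l), (x, y)) _ tG ut; have [j' [/= eu' uQ' cu']] := blkP ((mm', l'), (x', y')) _ tG' ut'.
  have [i [/= ev vQ cv]] := blkP ((mm, l), (x, y)) _ tG vt; have [i' [/= ev' vQ' cv']] := blkP ((mm', l'), (x', y')) _ tG' vt'.
  have emm : mm = mm' by apply: (net uv); [exact: (Qic (mm, l)) | exact: (Qic (mm', l'))].
  subst mm'.
  have el : l = l'.
    apply/eqP; apply/negP => /negP /(Qd mm); rewrite -setI_eq0 => /eqP/setP/(_ u).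
    by rewrite !inE uQ uQ'.
  subst l'; rewrite /= in cu cu' cv cv'.
  have ejj : j' = j by rewrite -cu -cu'. 
  have eii : i' = i by rewrite -cv -cv'.
  rewrite ejj in eu'; rewrite eii in ev'.
  have ji : nat_of_ord j != i.
    by apply: contraNneq uv => /val_inj ji; rewrite eu ev ji.
  have [inj1 _] := pfP (mm, l, j) tG; have [inj2 _] := pfP (mm, l, i) tG.
  have /(congr1 val) /= e1 : idx j x y = idx j x' y' by apply: inj1; rewrite -eu -eu'.
  have /(congr1 val) /= e2 : idx i x y = idx i x' y' by apply: inj2; rewrite -ev -ev'.
  have [ex ey] := design_inj ji e1 e2.
  by rewrite (val_inj ex) (val_inj ey).
pose Full := blk @: [set t | t.1 \in Gd].
have cFull : N <= #|Full|.
  rewrite card_in_imset; last first.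
    move=> t t'; rewrite in_set => tG; rewrite in_set => tG' e; apply: blk_sep => //.
    by rewrite -e setIid blk_card.
  apply: leq_trans Nm _; apply: (@leq_trans (#|Gd| * (B * B))); first by rewrite leq_mul2r mG orbT.
  have -> : #|Gd| * (B * B) = #|setX Gd [set: 'I_B * 'I_B]|.
    by rewrite cardsX cardsT card_prod !card_ord.
  by apply: subset_leq_card; apply/subsetP => -[b xy]; rewrite in_setX => /andP[bG _]; rewrite in_set.
have [Bl sBl cBl] := subset_card_exists cFull.
exists Bl; split=> //.
- move=> K /(subsetP sBl)/imsetP[t]; rewrite inE => tG ->; split; first exact: blk_card.
    by apply/subsetP => u /(blkP _ _ tG)[j [_ uQ _]]; apply: (subsetP (QS _)) uQ.
  by exists t.1.1 => u v; exact: blk_chi.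
- move=> K K' /(subsetP sBl)/imsetP[t tG ->] /(subsetP sBl)/imsetP[t' tG' ->] ne.
  rewrite in_set in tG; rewrite in_set in tG'; rewrite leqNgt; apply/negP => /(blk_sep _ _ tG tG') e.
  by rewrite e eqxx in ne.
Qed.

(** One partition is fixed that serves all sets of [sigma] points, and only then are edges drawn. In
    order, the four inequalities provide enough blocks, make non-collinear cliques rare, and pay for
    the two union bounds over at most [(q ^ 2) ^ sigma] sets. *)
Theorem net_graph (s B q d' t x : nat) :
  1 < s -> 0 < B -> d = 2 * d' -> 0 < x -> #|J| <= q -> #|P| = q ^ 2 -> 0 < q ->
  let a' := 2 * (s * B) in let sigma := 2 * (2 * s * a') * q in
  let c0 := 'C(s, 2) in let c1 := 'C(s.+1, 2) in
  2 * t.+1 ^ c0 * (c1.+1 * x) <= d' * q * (B * B) ->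
  16 * c1.+1 * c0 * (2 * d ^ 2) ^ s <= t.+1 ^ s ->
  (q ^ 2) ^ sigma * s.+1 ^ (2 * (d' * q)) < 2 ^ ((s * B) * (d' * q)) ->
  2 * (q ^ 2) ^ sigma < 2 ^ x ->
  exists H : rel P, [/\ (forall u v, H u v = H v u) /\ (forall v, H v v = false),
    forall u v, H u v -> collinear u v,
    forall K : {set P}, (forall u v, u \in K -> v \in K -> u != v -> H u v) -> #|K| <= s &
    forall S : {set P}, sigma <= #|S| -> exists K : {set P}, [/\ K \subset S, #|K| = s &
      forall u v, u \in K -> v \in K -> u != v -> H u v]].
Proof.
move=> s1 B0 dd x0 Jq Pq q0 a' sigma c0 c1 num1 num2 num3 num4.
have s0 : 0 < s by apply: ltnW.
have a'0 : 0 < a' by rewrite /a' !muln_gt0 s0.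
have a0 : 0 < 2 * s * a' by rewrite !muln_gt0 s0.
pose I : finType := {S : {set P} | #|S| == sigma}.
have cI : #|I| <= (q ^ 2) ^ sigma.
  rewrite card_sig -Pq; apply: leq_trans (bin_leq_expn _ _).
  by rewrite -card_draws cardsE; apply/eq_leq/eq_card => S.
have [p0] : exists p : P, true.
  have : 0 < #|P| by rewrite Pq expn_gt0 q0.
  by case/card_gt0P => p; exists p.
move=> _.
pose Qspec (Sm : I * 'I_d) (Q : 'I_q -> {set P}) := [/\ forall l, Q l \subset val Sm.1,
  forall l, #|Q l| = 2 * s * a', forall l u v, u \in Q l -> v \in Q l -> ic Sm.2 u = ic Sm.2 v &
    forall l l', l != l' -> [disjoint Q l & Q l']].
have [Q QP] : exists Q : I * 'I_d -> 'I_q -> {set P}, forall Sm, Qspec Sm (Q Sm).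
  apply: (@fin_all_exists _ _ Qspec) => -[S m].
  have cS : 2 * (2 * s * a') * q <= #|val S| by rewrite (eqP (valP S)).
  exact: (chunks_exist (ic m) a0 Jq cS).
pose QQ (S : I) (b : 'I_d * 'I_q) := Q (S, b.1) b.2.
(* A point lies on one line of each slope and is assigned a part separately for each. Tagging points
   by the slope expresses this and makes chunks of different slopes disjoint. *)
pose QE (S : I) (b : 'I_d * 'I_q) : {set 'I_d * P} := [set (b.1, p) | p in QQ S b].
have pinj (m : 'I_d) : injective (fun p : P => (m, p)) by move=> p p' [].
have cb : #|{: 'I_d * 'I_q}| = 2 * (d' * q) by rewrite card_prod !card_ord dd mulnA.
have Qa S b : #|QE S b| = 2 * s * a'.
  by rewrite (card_imset _ (pinj b.1)); case: (QP (S, b.1)) => _ ->.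
have Qd S b b' : b != b' -> [disjoint QE S b & QE S b'].
  case: b b' => m l [m' l'] bb'; rewrite -setI_eq0; apply/set0Pn => -[[m0 p]].
  rewrite inE => /andP[/imsetP[p1 p1Q [e1 e2]] /imsetP[p2 p2Q [e3 e4]]].
  rewrite /= in p1Q p2Q e1 e3; subst m0 p1 m' p2.
  have ll' : l != l' by apply: contraNneq bb' => ->.
  have [_ _ _ /(_ l l' ll')] := QP (S, m).
  by rewrite -setI_eq0 => /eqP/setP/(_ p); rewrite !inE p1Q p2Q.
have ca : s * B <= a' by rewrite /a'; lia.
have num3' : #|I| * s.+1 ^ (2 * (d' * q)) < 2 ^ ((a' - s * B) * (d' * q)).
  have -> : a' - s * B = s * B by rewrite /a'; lia.
  by apply: leq_ltn_trans num3; rewrite leq_mul2r cI orbT.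
have [chi chiP] := exists_balanced_partition s0 cb Qa Qd ca num3'.
pose N := 2 * t.+1 ^ c0 * (c1.+1 * x).
pose Bspec (S : I) (Bl : {set {set P}}) := [/\ #|Bl| = N,
    forall K, K \in Bl -> [/\ #|K| = s, K \subset val S & exists mm, forall u v, u \in K -> v \in K ->
      ic mm u = ic mm v /\ (u != v -> chi (mm, u) != chi (mm, v))] &
    forall K K', K \in Bl -> K' \in Bl -> K != K' -> #|K :&: K'| <= 1].
have [Bl BlP] : exists Bl : I -> {set {set P}}, forall S, Bspec S (Bl S).
  apply: (@fin_all_exists _ _ Bspec) => S.
  apply: (@blocks_exist s B q (d' * q) N chi (val S) (QQ S) p0) => //.
  - by move=> b; case: (QP (S, b.1)) => H _ _ _; exact: H.
  - by move=> b u v ub vb; case: (QP (S, b.1)) => _ _ /(_ b.2 u v ub vb).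
  - by move=> m l l' ll'; case: (QP (S, m)) => _ _ _; apply.
  - apply: leq_trans (chiP S) _; apply: subset_leq_card; apply/subsetP => b; rewrite !inE.
    move=> /forallP H; apply/forallP => j; apply: leq_trans (H j) _.
    rewrite -(card_imset (mem [set x0 in QQ S b | chi (b.1, x0) == j]) (pinj b.1)).
    apply: subset_leq_card; apply/subsetP => y; rewrite inE => /andP[/imsetP[p pQ ->] yj].
    by apply/imsetP; exists p; rewrite // inE pQ.
have num4' : 2 * #|I| < 2 ^ x by apply: leq_ltn_trans num4; rewrite leq_mul2l cI orbT.
have bad1 C : C \in bad_cliques s -> #|C| = s.+1 by rewrite inE => /and3P[/eqP].
have [H0 [H0sym H0irr H0bad H0S]] := deletion_method s0 x0 bad1
  (fun e e2 => bad_cliques_at_pair e2 s0)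
  (fun S K (KB : K \in Bl S) => let: And3 _ p _ := BlP S in let: And3 p1 _ _ := p K KB in p1)
  (fun S => let: And3 _ _ p := BlP S in p)
  (fun S => let: And3 p _ _ := BlP S in p) num2 num4'.
(* The partition is imposed only now. A clique inside one line injects into the [s] parts, and one
   of size s + 1 not on a line has lost an edge in [H0]. *)
pose H u v := H0 u v && [exists m, (ic m u == ic m v) && (chi (m, u) != chi (m, v))].
exists H; split.
- split=> [u v|v]; last by rewrite /H H0irr.
  by rewrite /H H0sym; congr (_ && _); apply: eq_existsb => m; rewrite eq_sym [chi _ == _]eq_sym.
- by move=> u v /andP[_ /existsP[m /andP[e _]]]; apply/existsP; exists m.
- move=> K KH; rewrite leqNgt; apply/negP => /subset_card_exists[C CK cC].
  have CH u v : u \in C -> v \in C -> u != v -> H u v.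
    by move=> /(subsetP CK) uK /(subsetP CK) vK; exact: KH.
  have [line|/existsP noline] := boolP [exists m, forall u in C, forall v in C, ic m u == ic m v].
    case/existsP: line => m /forall_inP line.
    have inj : {in C &, injective (fun u => chi (m, u))}.
      move=> u v uC vC /eqP; apply: contraTeq => uv.
      have /andP[_ /existsP[m' /andP[/eqP e1 e2]]] := CH u v uC vC uv.
      by have /forall_inP/(_ v vC)/eqP e3 := line u uC; rewrite (net uv e3 e1).
    by have := max_card (mem ((fun u => chi (m, u)) @: C)); rewrite card_in_imset // cC card_ord ltnn.
  have Cbad : C \in bad_cliques s.
    rewrite inE cC eqxx /=; apply/andP; split.
      apply/forall_inP => u uC; apply/forall_inP => v vC; apply/existsP.
      have [->|uv] := eqVneq u v.
        have /card_gt1P[a [b [aC bC ab]]] : 1 < #|C| by rewrite cC ltnS.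
        by have /andP[_ /existsP[m _]] := CH a b aC bC ab; exists m.
      by have /andP[_ /existsP[m /andP[e _]]] := CH u v uC vC uv; exists m.
    apply/forallP => m; apply: contra_notT noline; rewrite negb_exists_in => /forall_inP nl.
    exists m; apply/forall_inP => u uC; have := nl u uC; rewrite negb_exists_in => /forall_inP nl'.
    by apply/forall_inP => v vC; have := nl' v vC; rewrite negbK.
  have [u [v [uC vC uv]]] := H0bad C Cbad.
  by have /andP[->] := CH u v uC vC uv.
- move=> S /subset_card_exists[S' SS' cS'].
  have cS'b : #|S'| == sigma by apply/eqP.
  pose SI : I := exist _ S' cS'b.
  have [K KB KH] := H0S SI; have [_ /(_ K KB)[cK KS [m Km]] _] := BlP SI.
  exists K; split=> //; first exact: subset_trans KS SS'.
  move=> u v uK vK uv; rewrite /H (KH u v) //=; apply/existsP; exists m.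
  by have [-> /(_ uv) ->] := Km u v uK vK; rewrite eqxx.
Qed.

End Net.

(** * The affine plane and the choice of parameters for the upper bound *)

Section FieldNet.
Import GRing.Theory.
Local Open Scope ring_scope.

Definition intercept (F : fieldType) (m : F) (p : F * F) : F := p.2 - m * p.1.

Lemma intercept_net (F : fieldType) (m m' : F) (u v : F * F) : u != v ->
  intercept m u = intercept m v -> intercept m' u = intercept m' v -> m = m'.
Proof.
case: u v => [a b] [a' b']; rewrite /intercept /= => uv e e'.
have E (n : F) : b - n * a = b' - n * a' -> n * (a - a') = b - b'.
  move=> en; have -> : b = b' - n * a' + n * a by rewrite -en subrK.
  by rewrite addrAC [b' - _]addrC addrK mulrBr addrC.
have [aa|naa] := eqVneq a a'.
  subst a'; have := E m e; rewrite subrr mulr0 => /esym/eqP; rewrite subr_eq0 => /eqP bb.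
  by rewrite bb eqxx in uv.
by apply: (@mulIf _ (a - a')); [rewrite subr_eq0 | rewrite !E].
Qed.

End FieldNet.

(** Disjoint sets of slopes make the graphs of different colours edge-disjoint, as two points
    determine a slope. By [r * sigma <= q ^ 2], any vertex colouring has a class large enough for
    the graph of its own colour. *)
Theorem field_pattern (r h s B d' t x : nat) :
  let q := 2 ^ h in let d := 2 * d' in
  let sigma := 2 * (2 * s * (2 * (s * B))) * q in
  let c0 := 'C(s, 2) in let c1 := 'C(s.+1, 2) in
  0 < r -> 0 < h -> 1 < s -> 0 < B -> 0 < x ->
  r * d <= q -> r * sigma <= q ^ 2 ->
  2 * t.+1 ^ c0 * (c1.+1 * x) <= d' * q * (B * B) ->
  16 * c1.+1 * c0 * (2 * d ^ 2) ^ s <= t.+1 ^ s ->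
  (q ^ 2) ^ sigma * s.+1 ^ (2 * (d' * q)) < 2 ^ ((s * B) * (d' * q)) ->
  2 * (q ^ 2) ^ sigma < 2 ^ x ->
  exists (P : finType) (pc : P -> P -> option 'I_r), [/\ #|P| = q ^ 2,
    (forall x y, pc x y = pc y x) /\ (forall x, pc x x = None),
    forall j (K : {set P}), (forall x y, x \in K -> y \in K -> x != y -> pc x y = Some j) -> #|K| <= s &
    forall kappa : P -> 'I_r, exists j (K : {set P}),
      [/\ #|K| = s, forall x, x \in K -> kappa x = j &
          forall x y, x \in K -> y \in K -> x != y -> pc x y = Some j]].
Proof.
move=> q d sigma c0 c1 r0 h0 s1 B0 x0 rd rsig num1 num2 num3 num4.
have [F _ cF] := @pPrimePowerField 2 h isT h0.
have [slope [slope_inj _]] : exists f : {ffun 'I_#|{: 'I_r * 'I_d}| -> F},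
    injective f /\ forall i, f i \in [set: F].
  by apply: exists_injection; rewrite cardsT cF card_prod !card_ord.
pose sl (im : 'I_r * 'I_d) : F := slope (enum_rank im).
have sl_inj : injective sl by move=> a b /slope_inj /enum_rank_inj.
pose ic i (m : 'I_d) : F * F -> F := intercept (sl (i, m)).
have cP : #|{: F * F}| = q ^ 2 by rewrite card_prod cF mulnn.
have q0 : 0 < q by rewrite expn_gt0.
have icnet i (m m' : 'I_d) (u v : F * F) : u != v -> ic i m u = ic i m v -> ic i m' u = ic i m' v -> m = m'.
  by move=> uv e e'; have /sl_inj[] := intercept_net uv e e'.
pose Hspec (i : 'I_r) (H : rel (F * F)) := [/\ (forall u v, H u v = H v u) /\ (forall v, H v v = false),
    forall u v, H u v -> collinear (ic i) u v,
    forall K : {set F * F}, (forall u v, u \in K -> v \in K -> u != v -> H u v) -> #|K| <= s &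
    forall S : {set F * F}, sigma <= #|S| -> exists K : {set F * F}, [/\ K \subset S, #|K| = s &
      forall u v, u \in K -> v \in K -> u != v -> H u v]].
have [H HP] : exists H : 'I_r -> rel (F * F), forall i, Hspec i (H i).
  apply: (@fin_all_exists _ _ Hspec) => i.
  have Fq : #|F| <= q by rewrite cF.
  exact: (@net_graph _ F d (ic i) (icnet i) s B q d' t x s1 B0 erefl x0 Fq cP q0 num1 num2 num3 num4).
have Hne i u v : H i u v -> u != v.
  by move=> uv; apply/eqP => e; subst v; case: (HP i) => -[_ /(_ u)]; rewrite uv.
have Huniq i j u v : H i u v -> H j u v -> i = j.
  move=> ui uj; have uv := Hne i u v ui.
  have [_ /(_ u v ui)/existsP[m /eqP e] _ _] := HP i.
  have [_ /(_ u v uj)/existsP[m' /eqP e'] _ _] := HP j.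
  by have /sl_inj[] := intercept_net uv e e'.
pose pc u v := [pick i | H i u v].
have pcP u v i : pc u v = Some i <-> H i u v.
  rewrite /pc; split; first by case: pickP => // j uj [<-].
  by move=> ui; case: pickP => [j uj|/(_ i)]; [congr Some; exact: Huniq uj ui | rewrite ui].
exists (F * F)%type, pc; split=> //.
- split=> [u v|u]; first by apply: eq_pick => i; case: (HP i) => -[->].
  by rewrite /pc; case: pickP => // i; case: (HP i) => -[_ ->].
- move=> j K KP; case: (HP j) => _ _ + _; apply=> u v uK vK uv.
  exact/pcP/KP.
- move=> kappa.
  have [j jS] : exists j, sigma <= #|[set u | kappa u == j]|.
    apply: NNPP => no; have : q ^ 2 < r * sigma.
      rewrite -cP -sum1_card (partition_big kappa xpredT) //=.
      rewrite -[r in r * _]card_ord -sum_nat_const.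
      have lt j : \sum_(i | kappa i == j) 1 < sigma.
        by rewrite sum1dep_card ltnNge; apply/negP => le; apply: no; exists j.
      rewrite (bigD1 (Ordinal r0)) //= [ltnRHS](bigD1 (Ordinal r0)) //= -addSn leq_add //.
      by apply: leq_sum => j _; apply: ltnW.
    by rewrite ltnNge rsig.
  have [_ _ _ /(_ _ jS)[K [KS cK KH]]] := HP j.
  exists j, K; split=> //; first by move=> u /(subsetP KS); rewrite inE => /eqP.
  by move=> u v uK vK uv; apply/pcP/KH.
Qed.

Theorem min_degree_upper_nat s : 1 < s -> exists K, 0 < K /\ forall r h, 1 < r -> 0 < h ->
  K * r * h ^ (2 * 'C(s, 2)) <= 2 ^ h ->
  exists n (e : rel 'I_n), ramsey_minimal e (complete_rel s.+1) r /\ min_degree e <= 2 ^ (2 * h).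
Proof.
move=> s1; set c0 := 'C(s, 2); set c1 := 'C(s.+1, 2).
have c00 : 0 < c0 by rewrite bin_gt0.
pose K1 := 32 * c1.+1 * c0 * (66 * s) ^ 2.
pose K2 := 2 * c1.+1 * s * K1 ^ c0.
have K10 : 0 < K1 by rewrite /K1 !(muln_gt0, expn_gt0) c00 (ltnW s1).
have K20 : 0 < K2 by rewrite /K2 muln_gt0 expn_gt0 K10 !muln_gt0 (ltnW s1).
exists (66 * s * s * K2); split; first by rewrite muln_gt0 K20 !muln_gt0 (ltnW s1).
move=> r h r1 h0 Kh.
(* After division by h s^2 q, [num3] reads 16 B + 66 < 33 B, true from B = 4 on. [K1] is such that t
   + 1 equals 16 c1.+1 c0 times 2 (2 d')^2, as [num2] needs; [B] is then fitted to [num1]. *)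
pose d' := 33 * h * s; pose t := (K1 * h ^ 2).-1.
have et : t.+1 = K1 * h ^ 2 by rewrite /t prednK // muln_gt0 K10 expn_gt0 h0.
have [B BE] : exists B, B = K2 * h ^ (2 * c0) by eexists.
have B0 : 0 < B by rewrite BE muln_gt0 K20 expn_gt0 h0.
have eB : B = 2 * c1.+1 * s * t.+1 ^ c0.
  by rewrite et expnMn -expnM BE /K2 -!mulnA.
set q := 2 ^ h in Kh.
pose sigma := 2 * (2 * s * (2 * (s * B))) * q.
pose x := 2 * h * sigma + 2.
have q0 : 0 < q by rewrite expn_gt0.
have s0 := ltnW s1.
have KB : 66 * s * s * B * r <= q.
  apply: leq_trans Kh; rewrite BE; apply/eq_leq; nia.
have T0 : 0 < t.+1 ^ c0 by rewrite expn_gt0.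
have c1B : 4 <= B by rewrite eB; move: T0; move: (t.+1 ^ c0) => T T0; nia.
have esig : (q ^ 2) ^ sigma = 2 ^ (2 * h * sigma) by rewrite -!expnM; congr (2 ^ _); nia.
have hB : h <= B.
  rewrite BE; apply: (@leq_trans (h ^ (2 * c0))); last by rewrite leq_pmull.
  by rewrite -[leqLHS]expn1 leq_pexp2l // muln_gt0.
have n1 : r * (2 * d') <= q.
  apply: leq_trans KB; rewrite /d'.
  have -> : r * (2 * (33 * h * s)) = 66 * s * r * h by clear; nia.
  have -> : 66 * s * s * B * r = 66 * s * r * (s * B) by clear; nia.
  rewrite leq_mul2l; apply/orP; right; apply: leq_trans hB _; by rewrite leq_pmull.
have sigE : sigma = 8 * s * s * B * q by rewrite /sigma; clear; nia.
have n2 : r * sigma <= q ^ 2.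
  rewrite sigE -mulnn mulnA leq_mul2r; apply/orP; right; apply: leq_trans KB.
  have -> : r * (8 * s * s * B) = 8 * (s * s * B * r) by clear; nia.
  have -> : 66 * s * s * B * r = 66 * (s * s * B * r) by clear; nia.
  by rewrite leq_mul2r orbT.
have xE : x <= 18 * h * s * s * B * q.
  rewrite /x sigE; have : 0 < h * s * s * B * q by rewrite !muln_gt0 h0 s0 B0.
  have -> : 2 * h * (8 * s * s * B * q) = 16 * (h * s * s * B * q) by clear; nia.
  have -> : 18 * h * s * s * B * q = 18 * (h * s * s * B * q) by clear; nia.
  move: (h * s * s * B * q); clear => y; lia.
have num1 : 2 * t.+1 ^ c0 * (c1.+1 * x) <= d' * q * (B * B).
  apply: (@leq_trans (2 * t.+1 ^ c0 * (c1.+1 * (18 * h * s * s * B * q)))).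
    by rewrite leq_mul2l leq_mul2l xE !orbT.
  have -> : d' * q * (B * B) = 33 * h * s * q * (2 * c1.+1 * s * t.+1 ^ c0 * B) by rewrite -eB.
  move: (t.+1 ^ c0) => T.
  have -> : 2 * T * (c1.+1 * (18 * h * s * s * B * q)) = 36 * (T * c1.+1 * h * s * s * B * q) by clear; nia.
  have -> : 33 * h * s * q * (2 * c1.+1 * s * T * B) = 66 * (T * c1.+1 * h * s * s * B * q).
    by move: c1.+1 => c; clear; nia.
  by rewrite leq_mul2r orbT.
have num2 : 16 * c1.+1 * c0 * (2 * (2 * d') ^ 2) ^ s <= t.+1 ^ s.
  rewrite et /K1 /d'; set A := 16 * c1.+1 * c0.
  have -> : 32 * c1.+1 * c0 * (66 * s) ^ 2 * h ^ 2 = A * (2 * (2 * (33 * h * s)) ^ 2).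
    by rewrite /A; move: (c1.+1) (c0) => c c'; clear; nia.
  rewrite (expnMn A) leq_mul2r; apply/orP; right.
  have A0 : 0 < A by rewrite !muln_gt0 c00.
  by rewrite -[leqLHS]expn1 leq_pexp2l.
have num3 : (q ^ 2) ^ sigma * s.+1 ^ (2 * (d' * q)) < 2 ^ (s * B * (d' * q)).
  apply: (@leq_ltn_trans (2 ^ (2 * h * sigma) * 2 ^ (s * (2 * (d' * q))))).
    rewrite esig leq_mul2l (expnM 2 s); apply/orP; right.
    have [->|dq] := posnP (2 * (d' * q)); first by rewrite !expn0.
    by rewrite leq_exp2r // ltn_expl.
  rewrite -expnD ltn_exp2l // sigE /d'.
  have y0 : 0 < h * s * s * q by rewrite !muln_gt0 h0 s0.
  have -> : 2 * h * (8 * s * s * B * q) + s * (2 * (33 * h * s * q)) = (16 * B + 66) * (h * s * s * q) by clear; nia.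
  have -> : s * B * (33 * h * s * q) = (33 * B) * (h * s * s * q) by clear; nia.
  by rewrite ltn_pmul2r //; move: c1B; clear; lia.
have num4 : 2 * (q ^ 2) ^ sigma < 2 ^ x.
  by rewrite esig -expnS /x ltn_exp2l // addn2.
have x0 : 0 < x by rewrite /x addn2.
have [P [pc [cP [pcs pci] pcf pcst]]] :=
  field_pattern (ltnW r1) h0 s1 B0 x0 n1 n2 num1 num2 num3 num4.
have [|n [e [em ed]]] := pattern_min_degree (k := s.+1) r1 (s1 : 2 < s.+1) pcs pci pcf.
  move=> kappa; have [j [K [cK kK pK]]] := pcst kappa.
  by exists j, K; split=> //; rewrite cK.
exists n, e; split=> //; apply: leq_trans ed _; by rewrite cP /q -expnM mulnC.
Qed.

(** * Independent sets in clique-free graphs *)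

Section IndependentSets.
Variables (T : finType) (G : rel T).
Hypothesis Gsym : forall x y, G x y = G y x.
Hypothesis Girr : forall x, G x x = false.
Implicit Types (A W Y Z K : {set T}).

Definition indep W := [forall x in W, forall y in W, ~~ G x y].
Definition indep_sets A := [set W : {set T} | (W \subset A) && indep W].
Definition clique_free s A := forall K, K \subset A ->
  (forall x y, x \in K -> y \in K -> x != y -> G x y) -> #|K| < s.
Definition nbr A v := [set y in A | G v y].

Lemma indepP W : reflect (forall x y, x \in W -> y \in W -> ~~ G x y) (indep W).
Proof.
apply: (iffP forall_inP) => [H x y xW yW|H x xW]; first by move/forall_inP: (H x xW); apply.
by apply/forall_inP => y; exact: H.
Qed.

Lemma indepS W W' : W' \subset W -> indep W -> indep W'.
Proof. by move=> /subsetP s /indepP H; apply/indepP => x y /s xW /s yW; exact: H. Qed.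

Lemma indep0 : indep set0.
Proof. by apply/indepP => x y; rewrite inE. Qed.

Lemma clique_free_nbr s A v : v \in A -> clique_free s.+1 A -> clique_free s (nbr A v).
Proof.
move=> vA Acf K KN KP.
have vK : v \notin K by apply/negP => /(subsetP KN); rewrite inE Girr andbF.
have := Acf (v |: K); rewrite cardsU1 vK ltnS; apply.
  rewrite subUset sub1set vA; apply: subset_trans KN _; apply/subsetP => x.
  by rewrite inE => /andP[].
have vG x : x \in K -> G v x by move/(subsetP KN); rewrite inE => /andP[].
move=> x y; rewrite !inE => /orP[/eqP->|xK] /orP[/eqP->|yK] xy //.
- by rewrite eqxx in xy.
- exact: vG.
- by rewrite Gsym; exact: vG.
- exact: KP.
Qed.

Lemma greedy_indep A D : (forall v, v \in A -> #|nbr A v| <= D) ->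
  exists W, [/\ W \subset A, indep W & #|A| <= D.+1 * #|W|].
Proof.
move=> deg; have [W /maxsetP[/andP[WA Wi] Wmax]] : {W | maxset (fun W => (W \subset A) && indep W) W}.
  by apply: ex_maxset; exists set0; rewrite sub0set indep0.
exists W; split=> //.
have sub : A \subset \bigcup_(w in W) (w |: nbr A w).
  apply/subsetP => v vA; apply/bigcupP; apply: NNPP => no.
  have vW : v \notin W by apply/negP => vW; apply: no; exists v; rewrite ?setU11.
  have nG w : w \in W -> ~~ G w v.
    by move=> wW; apply/negP => wv; apply: no; exists w => //; rewrite !inE vA wv orbT.
  case/negP: vW; rewrite -(Wmax (v |: W)) ?setU11 ?subsetUr // subUset sub1set vA WA /=.
  apply/indepP => x y; rewrite !inE => /orP[/eqP->|xW] /orP[/eqP->|yW].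
  - by rewrite Girr.
  - by rewrite Gsym nG.
  - exact: nG.
  - by move/indepP: Wi; apply.
apply: leq_trans (subset_leq_card sub) _; apply: leq_trans (leq_card_bigcup _ _) _.
rewrite mulnC -sum_nat_const; apply: leq_sum => w wW.
by rewrite cardsU1 -addn1 addnC leq_add ?deg ?(subsetP WA) //; case: (w \notin _).
Qed.

(** Either some neighbourhood, which excludes one clique size more, has x^(s-1) points, or all
    degrees are below x^(s-1) and the greedy set is large enough. *)
Lemma ramsey_indep s x A : clique_free s.+1 A -> x ^ s <= #|A| ->
  exists W, [/\ W \subset A, indep W & x <= #|W|].
Proof.
elim: s A => [|s IH] A Acf xA.
  move: xA; rewrite expn0 => /card_gt0P[v vA].
  have := Acf [set v]; rewrite cards1 ltnn sub1set vA => /(_ isT) H; exfalso; apply: notF; apply: H.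
  by move=> y z; rewrite !inE => /eqP-> /eqP->; rewrite eqxx.
have [[v vA big]|no] := classic (exists2 v, v \in A & x ^ s <= #|nbr A v|).
  have [W [WN Wi xW]] := IH _ (clique_free_nbr vA Acf) big.
  exists W; split=> //; apply: subset_trans WN _; apply/subsetP => y; by rewrite inE => /andP[].
have [x0|x0] := posnP x; first by exists set0; rewrite sub0set indep0 x0.
have X0 : 0 < x ^ s by rewrite expn_gt0 x0.
have [|W [WA Wi AW]] := @greedy_indep A (x ^ s).-1.
  move=> v vA; rewrite -ltnS prednK // ltnNge; apply/negP => le; apply: no; by exists v.
exists W; split=> //; rewrite prednK // in AW.
by have := leq_trans xA AW; rewrite expnSr leq_pmul2l.
Qed.

Lemma card_small_sets Y m : #|[set Z : {set T} | (Z \subset Y) && (#|Z| < m)]| <= #|Y|.+1 ^ m.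
Proof.
have sub : [set Z : {set T} | (Z \subset Y) && (#|Z| < m)] \subset
   \bigcup_(j < m) [set Z : {set T} | (Z \subset Y) && (#|Z| == j)].
  apply/subsetP => Z; rewrite inE => /andP[ZY Zm].
  by apply/bigcupP; exists (Ordinal Zm) => //; rewrite inE ZY /=.
apply: leq_trans (subset_leq_card sub) _; apply: leq_trans (leq_card_bigcup _ _) _.
rewrite (eq_bigr (fun j : 'I_m => 'C(#|Y|, j))); last by move=> j _; rewrite cards_draws.
elim: m {sub} => [|m IH]; first by rewrite big_ord0.
rewrite big_ord_recr /=; case: m IH => [|m] IH; first by rewrite big_ord0 bin0 expn1.
rewrite expnS mulSn leq_add //; apply: leq_trans (bin_leq_expn _ _) _.
rewrite expnS leq_mul2l; apply/orP; right.
apply: (@leq_trans (#|Y|.+1 ^ m)); last by apply: leq_pexp2l.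
by case: (m) => // n; rewrite leq_exp2r.
Qed.

Lemma indep_sets_large Y W : W \subset Y -> indep W -> 2 ^ #|W| <= #|indep_sets Y|.
Proof.
move=> WY Wi; rewrite -card_powerset; apply: subset_leq_card; apply/subsetP => Z.
by rewrite !inE => ZW; rewrite (subset_trans ZW WY) (indepS ZW Wi).
Qed.

Lemma card_indep_sets_gt0 Y : 0 < #|indep_sets Y|.
Proof. by apply/card_gt0P; exists set0; rewrite inE sub0set indep0. Qed.

(** If the term [2 ^ L] does not suffice alone, at least half of the independent sets have [4 * t]
    or more elements. The smaller ones number at most (x+1)^(4te), where x is the integer e-th root
    of [#|Y|], while Ramsey gives at least 2^x independent sets. *)
Lemma indep_sets_average Y e t L lam : clique_free e.+1 Y -> 0 < e -> 0 < t -> 0 < lam ->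
  L <= 2 ^ lam -> 16 * lam * t * e + 4 <= L ->
  t * (1 + #|indep_sets Y|) <= 2 ^ L + \sum_(Z in indep_sets Y) #|Z|.
Proof.
move=> Ycf e0 t0 lam0 Llam; rewrite -!mulnA => tL.
have te1 : t <= lam * (t * e) by rewrite mulnCA leq_pmulr // muln_gt0 lam0.
set i := #|indep_sets Y|.
have i0 : 0 < i := card_indep_sets_gt0 Y.
have [le|lt] := leqP (t * (1 + i)) (2 ^ L); first exact: leq_trans le (leq_addr _ _).
apply: leq_trans (leq_addl _ _).
pose Sm := [set Z in indep_sets Y | #|Z| < 4 * t].
suff small : 2 * #|Sm| <= i.
  apply: (@leq_trans (\sum_(Z in indep_sets Y | ~~ (#|Z| < 4 * t)) 4 * t)).
    have e1 : #|[set Z in indep_sets Y | ~~ (#|Z| < 4 * t)]| + #|Sm| = i.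
      rewrite /i -(cardsID [set Z : {set T} | #|Z| < 4 * t] (indep_sets Y)) addnC.
      by congr (_ + _); apply: eq_card => Z; rewrite !inE andbC.
    rewrite (eq_bigl (mem [set Z in indep_sets Y | ~~ (#|Z| < 4 * t)])); last first.
      by move=> Z; rewrite -[RHS]/(Z \in [set Z in indep_sets Y | ~~ (#|Z| < 4 * t)]) in_set.
    rewrite sum_nat_const; move: e1 small i0; move: (#|Sm|) (#|[set Z in _ | _]|) (i) => b a n.
    clear; nia.
  rewrite [leqRHS](bigID (fun Z : {set T} => #|Z| < 4 * t)) /=.
  apply: leq_trans (leq_addl _ _); apply: leq_sum => Z /andP[_]; by rewrite -leqNgt.
have [x [xY Yx]] : exists x, x ^ e <= #|Y| /\ #|Y| < x.+1 ^ e.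
  have ex0 : exists x, x ^ e <= #|Y| by exists 0; rewrite exp0n.
  have bd x : x ^ e <= #|Y| -> x <= #|Y|.
    by apply: leq_trans; rewrite -[leqLHS]expn1; case: x => // x; rewrite leq_pexp2l.
  case: (ex_maxnP ex0 bd) => x xY xmax; exists x; split=> //.
  by rewrite ltnNge; apply/negP => /xmax; rewrite ltnn.
have cSm : #|Sm| <= x.+1 ^ (4 * t * e).
  apply: (@leq_trans (#|Y|.+1 ^ (4 * t))).
    apply: leq_trans (card_small_sets Y (4 * t)); apply: subset_leq_card; apply/subsetP => Z.
    by rewrite !inE => /andP[/andP[-> _] ->].
  by rewrite [4 * t * e]mulnC (expnM x.+1 e) leq_exp2r // muln_gt0.
have [W [WY Wi xW]] := ramsey_indep Ycf xY.
have ix : 2 ^ x <= i by apply: leq_trans (indep_sets_large WY Wi); rewrite leq_exp2l.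
(* For small x, 2^x may be too weak and the failure of the first alternative bounds the number of
   sets from below; for large x, x exceeds 4te log2(x+1). *)
have [xs|xl] := leqP x.+1 (2 ^ (2 * lam)).
  apply: (@leq_trans (2 ^ (L - 1 - t))); last first.
    have : 2 ^ L < 2 ^ (1 + t) * i.
      apply: leq_trans lt _; apply: (@leq_trans (t * (2 * i))); first by rewrite leq_mul2l; lia.
      by rewrite expnD expn1 mulnCA mulnA leq_mul2r leq_mul2l (ltnW (ltn_expl _ _)) // !orbT.
    have eL : L = (1 + t) + (L - 1 - t) by move: tL te1; move: (lam * _) => p; clear; lia.
    by rewrite {1}eL expnD ltn_pmul2l ?expn_gt0 // => /ltnW.
  apply: (@leq_trans (2 * (2 ^ (2 * lam)) ^ (4 * t * e))).
    rewrite leq_mul2l /=; apply: leq_trans cSm _.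
    by rewrite leq_exp2r // !muln_gt0 t0 e0.
  rewrite -expnM -expnS leq_exp2l //.
  have -> : 2 * lam * (4 * t * e) = 8 * (lam * (t * e)) by clear; nia.
  by move: tL te1 t0; move: (lam * _) => p; clear; lia.
pose j := trunc_log 2 x.+1.
have jx : 2 ^ j <= x.+1 by apply: trunc_logP.
have xj : x.+1 < 2 ^ j.+1 by apply: trunc_log_ltn.
have lamj : 2 * lam <= j.
  by rewrite -ltnS -(ltn_exp2l _ _ (isT : 1 < 2)); apply: leq_ltn_trans (ltnW xl) xj.
have key : 4 * t * e * j.+1 + 1 <= x.
  have te : 16 * (t * e) <= 2 ^ lam.
    apply: leq_trans Llam; apply: leq_trans tL; apply: leq_trans (leq_addr _ _).
    by rewrite leq_mul2l leq_pmull.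
  have lj : 2 ^ lam * j.+1 <= 2 * 2 ^ j.
    have -> : 2 ^ j = 2 ^ lam * 2 ^ (j - lam) by rewrite -expnD subnKC //; clear -lamj; lia.
    rewrite mulnCA leq_mul2l; apply/orP; right.
    have := ltn_expl (j - lam) (isT : 1 < 2); move: (2 ^ (j - lam)); clear -lamj; lia.
  have j2 : 4 <= 2 ^ j by rewrite (@leq_exp2l 2 2) //; clear -lamj lam0; lia.
  have : 16 * (t * e) * j.+1 <= 2 * 2 ^ j by apply: leq_trans lj; rewrite leq_mul2r te orbT.
  by move: jx j2; move: (2 ^ j); clear => n jx j2; nia.
apply: leq_trans ix; apply: (@leq_trans (2 * (2 ^ j.+1) ^ (4 * t * e))).
  rewrite leq_mul2l /=; apply: leq_trans cSm _.
  by rewrite leq_exp2r ?(ltnW xj) // !muln_gt0 t0 e0.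
rewrite -expnM -expnS leq_exp2l //; move: key; clear; lia.
Qed.

(* Shearer: for a uniformly random independent set [W], the weight
   [2 ^ L * (v \in W) + #|nbr A v :&: W|] has expectation at least [t], already
   conditionally on [W] outside the closed neighbourhood of [v]. *)
Lemma shearer_weight A e t L lam v : v \in A -> clique_free e.+2 A -> 0 < e -> 0 < t -> 0 < lam ->
  L <= 2 ^ lam -> 16 * lam * t * e + 4 <= L ->
  t * #|indep_sets A| <= \sum_(W in indep_sets A) (2 ^ L * (v \in W) + #|nbr A v :&: W|).
Proof.
move=> vA Acf e0 t0 lam0 Llam tL; pose N := nbr A v.
have vN : v \notin N by rewrite inE Girr andbF.
have NA : N \subset A by apply/subsetP => y; rewrite inE => /andP[].
(* Independent sets are grouped by their part outside the closed neighbourhood of [v], and the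
   inequality holds within each group. *)
pose trace W := W :\: (v |: N).
rewrite -sum1_card big_distrr /= (partition_big trace xpredT) //= [leqRHS](partition_big trace xpredT) //=.
apply: leq_sum => W0 _.
pose C := [set W in indep_sets A | trace W == W0].
have sumC (F : {set T} -> nat) : \sum_(W in indep_sets A | trace W == W0) F W = \sum_(W in C) F W.
  by apply: eq_bigl => W; rewrite [RHS]in_set.
rewrite !sumC; have [->|[W1]] := set_0Vmem C; first by rewrite big_set0.
rewrite in_set => /andP[]; rewrite in_set => /andP[W1A W1i] /eqP tW1.
have W0A : W0 \subset A by rewrite -tW1; apply: subset_trans W1A; exact: subsetDl.
have W0i : indep W0 by rewrite -tW1; apply: indepS W1i; exact: subsetDl.
have W0v x : x \in W0 -> (x != v) && (x \notin N) && (x \in A).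
  by move=> xW; rewrite (subsetP W0A) // andbT; move: xW; rewrite -tW1 in_setD in_setU1 negb_or => /andP[].
pose Y := [set y in N | [forall w in W0, ~~ G y w]].
have YN : Y \subset N by apply/subsetP => y; rewrite inE => /andP[].
have Ycf : clique_free e.+1 Y.
  by move=> K KY; apply: (clique_free_nbr vA Acf); exact: subset_trans KY YN.
have avg := indep_sets_average Ycf e0 t0 lam0 Llam tL.
have vW0 : v \notin W0 by apply/negP => /W0v; rewrite eqxx.
have glue_i Z : Z \subset Y -> indep Z -> indep (W0 :|: Z).
  move=> /subsetP ZY /indepP Zi; apply/indepP => x y; rewrite !inE => /orP[xW|xZ] /orP[yW|yZ].
  - by move/indepP: W0i; apply.
  - by rewrite Gsym; have := ZY _ yZ; rewrite inE => /andP[_ /forall_inP]; apply.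
  - by have := ZY _ xZ; rewrite inE => /andP[_ /forall_inP]; apply.
  - exact: Zi.
have v_i : indep (v |: W0).
  have vw w : w \in W0 -> ~~ G v w.
    by move=> /W0v /andP[/andP[_ +] wA]; rewrite inE wA.
  apply/indepP => x y; rewrite !inE => /orP[/eqP->|xW] /orP[/eqP->|yW].
  - by rewrite Girr.
  - exact: vw.
  - by rewrite Gsym vw.
  - by move/indepP: W0i; apply.
pose Im := [set W0 :|: Z | Z in indep_sets Y].
have ZW Z : Z \subset Y -> (W0 :|: Z) :&: N = Z.
  move=> /subsetP ZY; apply/setP => x; rewrite in_setI in_setU.
  have [xZ|xZ] := boolP (x \in Z); first by rewrite orbT (subsetP YN) // ZY.
  rewrite orbF; apply/negP => /andP[/W0v /andP[/andP[_ /negP nx] _] xN]; exact: nx.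
have Ginj : {in indep_sets Y &, injective (fun Z => W0 :|: Z)}.
  move=> Z Z'; rewrite !in_set => /andP[ZY _] /andP[Z'Y _] eZ.
  by rewrite -(ZW Z ZY) -(ZW Z' Z'Y) eZ.
(* A group consists of [W0] with [v], of weight at least 2^L, and of [W0] with any independent [Z]
   inside [Y], of weight at least [#|Z|]: exactly the sum treated in [indep_sets_average]. *)
have CE : C = (v |: W0) |: Im.
  apply/setP => W; apply/idP/idP.
    rewrite in_set => /andP[]; rewrite in_set => /andP[WA Wi] /eqP tW.
    have EW : W = W0 :|: (W :&: (v |: N)) by rewrite -tW setUC setID.
    have [vW|vW] := boolP (v \in W).
      rewrite in_setU1; apply/orP; left; apply/eqP; rewrite [LHS]EW setUC; congr (_ :|: _).
      apply/setP => x; rewrite in_setI in_setU1 in_set1.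
      have [->|xv] /= := eqVneq x v; first by rewrite vW.
      apply/negP => /andP[xW]; rewrite inE => /andP[_ vx].
      by move/indepP: Wi => /(_ v x vW xW); rewrite vx.
    rewrite in_setU1; apply/orP; right; apply/imsetP; exists (W :&: N).
      rewrite in_set; apply/andP; split; last by apply: indepS Wi; exact: subsetIl.
      apply/subsetP => x; rewrite in_setI => /andP[xW xN]; rewrite inE xN.
      apply/forall_inP => w; rewrite -tW in_setD => /andP[_ wW].
      by move/indepP: Wi => /(_ x w xW wW).
    rewrite [LHS]EW; congr (_ :|: _); apply/setP => x; rewrite !in_setI in_setU1.
    by have [->|xv] //= := eqVneq x v; rewrite (negbTE vW) (negbTE vN).
  have tr (X : {set T}) : X \subset v |: N -> trace (W0 :|: X) = W0.
    move=> XN; apply/setP => x; rewrite /trace in_setD in_setU1 [x \in W0 :|: X]in_setU.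
    have [xW|xW] /= := boolP (x \in W0).
      by have /andP[/andP[/negbTE-> /negbTE->]] := W0v x xW.
    have [/(subsetP XN)|] := boolP (x \in X); last by rewrite andbF.
    by rewrite in_setU1 => ->.
  rewrite in_setU1 => /orP[/eqP->|/imsetP[Z + ->]].
    rewrite in_set in_set subUset sub1set vA W0A v_i /=; apply/eqP.
    by rewrite setUC; apply: tr; rewrite sub1set setU11.
  rewrite in_set => /andP[ZY Zi]; have ZN := subset_trans ZY YN.
  rewrite in_set in_set subUset W0A (subset_trans ZN NA) glue_i //=; apply/eqP; apply: tr.
  by apply: subset_trans ZN _; exact: subsetUr.
have vIm : v |: W0 \notin Im.
  apply/negP => /imsetP[Z]; rewrite in_set => /andP[ZY _] /setP/(_ v).
  rewrite in_setU1 eqxx in_setU (negbTE vW0) /= => /esym /(subsetP ZY)/(subsetP YN) vN'.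
  by rewrite vN' in vN.
rewrite CE !big_setU1 //= (big_imset _ Ginj) /= [in leqRHS](big_imset _ Ginj) /=.
rewrite sum_nat_const !muln1.
have -> : t + #|indep_sets Y| * t = t * (1 + #|indep_sets Y|) by rewrite mulnDr muln1 mulnC.
apply: leq_trans avg _; apply: leq_add.
  by rewrite in_setU1 eqxx muln1 leq_addr.
apply: leq_sum => Z; rewrite in_set => /andP[ZY _].
by rewrite setIC ZW // leq_addl.
Qed.

(** Summed over [v], the weight of one independent set [W] is 2^L times its size plus the degrees of
    its members, at most 2^(L+1) times its size. Averaging over [W] finishes the proof. *)
Theorem shearer A e t L lam : clique_free e.+2 A -> 0 < e -> 0 < t -> 0 < lam ->
  L <= 2 ^ lam -> 16 * lam * t * e + 4 <= L ->
  (forall v, v \in A -> #|nbr A v| <= 2 ^ L) ->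
  exists W, [/\ W \subset A, indep W & t * #|A| <= 2 ^ L.+1 * #|W|].
Proof.
move=> Acf e0 t0 lam0 Llam tL deg; apply: NNPP => no.
have H1 : t * #|indep_sets A| * #|A| <=
    \sum_(v in A) \sum_(W in indep_sets A) (2 ^ L * (v \in W) + #|nbr A v :&: W|).
  rewrite mulnC -sum_nat_const; apply: leq_sum => v vA.
  exact: (shearer_weight vA Acf e0 t0 lam0 Llam tL).
have H2 W : W \in indep_sets A ->
    \sum_(v in A) (2 ^ L * (v \in W) + #|nbr A v :&: W|) <= 2 ^ L.+1 * #|W|.
  have cE (X : {set T}) : #|X| = \sum_(x : T) (x \in X) by rewrite -sum1_card big_mkcond; apply: eq_bigr => x _; case: (x \in X).
  rewrite in_set => /andP[WA _]; rewrite big_split /= expnS mul2n -addnn mulnDl leq_add //.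
    rewrite -big_distrr /= leq_mul2l; apply/orP; right.
    by rewrite cE big_mkcond; apply: leq_sum => v _; case: (v \in A).
  apply: (@leq_trans (\sum_(w in W) #|nbr A w|)); last first.
    rewrite mulnC -sum_nat_const; apply: leq_sum => w wW; apply: deg; exact: (subsetP WA).
  under eq_bigr do rewrite cE; under [leqRHS]eq_bigr do rewrite cE.
  rewrite big_mkcond [leqRHS]big_mkcond /=.
  apply/eq_leq; transitivity (\sum_(v : T) \sum_(w : T) [&& v \in A, w \in W & G v w]).
    apply: eq_bigr => v _; case: ifP => vA; last by rewrite big1.
    apply: eq_bigr => w _; rewrite !inE /=.
    by have [wW|] := boolP (w \in W); rewrite ?andbF // (subsetP WA) ?andbT.
  rewrite exchange_big /=; apply: eq_bigr => w _; case: ifP => wW; last first.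
    by rewrite big1 // => v _; rewrite andbF.
  by apply: eq_bigr => v _; rewrite !inE /= Gsym.
have : t * #|indep_sets A| * #|A| < t * #|indep_sets A| * #|A|.
  apply: leq_ltn_trans H1 _; rewrite exchange_big /=.
  apply: (@leq_ltn_trans (\sum_(W in indep_sets A) 2 ^ L.+1 * #|W|)); first exact: leq_sum.
  rewrite -mulnA mulnCA -sum_nat_const.
  have s0 : set0 \in indep_sets A by rewrite in_set sub0set indep0.
  have lt W : W \in indep_sets A -> 2 ^ L.+1 * #|W| < t * #|A|.
    by rewrite in_set => /andP[WA Wi]; rewrite ltnNge; apply/negP => le; apply: no; exists W.
  rewrite (bigD1 set0) //= [ltnRHS](bigD1 set0) //= -addSn leq_add ?lt //.
  by apply: leq_sum => W /andP[WI _]; apply/ltnW/lt.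
by rewrite ltnn.
Qed.

End IndependentSets.

(** * Greedy vertex colouring *)

Section VertexColouring.
Variables (T : finType) (r : nat) (G : 'I_r -> rel T) (i0 : 'I_r).
Hypothesis Gsym : forall i x y, G i x y = G i y x.
Hypothesis Girr : forall i x, G i x x = false.
Hypothesis Gdisj : forall i j x y, G i x y -> G j x y -> i = j.
Implicit Types (A : {set T}) (C : {set 'I_r}).

Definition vertex_colourable C A := exists kappa : T -> 'I_r,
  (forall x, x \in A -> kappa x \in C) /\
  (forall x y, x \in A -> y \in A -> kappa x = kappa y -> ~~ G (kappa x) x y).

(** Edge-disjointness bounds the degree sums over all colours together by [#|A|] squared, so some
    colour has average degree at most [#|A|] / [#|C|], and half of the vertices have at most twice
    that. *)
Lemma sparse_colour C A : 0 < #|C| -> exists i A',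
  [/\ i \in C, A' \subset A, #|A| <= 2 * #|A'| &
      forall v, v \in A' -> #|nbr (G i) A v| * #|C| <= 2 * #|A|].
Proof.
move=> C0.
have tot : \sum_(i in C) \sum_(v in A) #|nbr (G i) A v| <= #|A| * #|A|.
  rewrite exchange_big /= -sum_nat_const; apply: leq_sum => v _.
  have cE (i : 'I_r) : #|nbr (G i) A v| = \sum_(y in A) G i v y.
    rewrite -sum1_card [LHS]big_mkcond [RHS]big_mkcond; apply: eq_bigr => y _.
    by rewrite inE; case: (y \in A) => //=; case: (G i v y).
  under eq_bigr do rewrite cE; rewrite exchange_big /= -sum1_card; apply: leq_sum => y _.
  have [[i iC ivy]|no] := classic (exists2 i, i \in C & G i v y).
    rewrite (bigD1 i) //= ivy big1 // => j /andP[_ ji].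
    by case jvy: (G j v y) => //; rewrite (Gdisj jvy ivy) eqxx in ji.
  rewrite big1 // => j jC; case jvy: (G j v y) => //; by case: no; exists j.
have [i iC ti] : exists2 i, i \in C & #|C| * \sum_(v in A) #|nbr (G i) A v| <= #|A| * #|A|.
  apply: NNPP => no; move: tot; rewrite leqNgt => /negP; apply.
  rewrite -(ltn_pmul2l C0) big_distrr /= -[ltnLHS]sum_nat_const.
  have lt i : i \in C -> #|A| * #|A| < #|C| * \sum_(v in A) #|nbr (G i) A v|.
    by move=> iC; rewrite ltnNge; apply/negP => le; apply: no; exists i.
  case/card_gt0P: C0 => j jC; rewrite (bigD1 j) //= [ltnRHS](bigD1 j) //= -addSn leq_add ?lt //.
  by apply: leq_sum => i /andP[iC _]; apply/ltnW/lt.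
exists i, [set v in A | #|nbr (G i) A v| * #|C| <= 2 * #|A|]; split=> //.
- by apply/subsetP => v; rewrite inE => /andP[].
- have [->|A0] := posnP #|A|; first by [].
  set A' := [set v in A | _].
  have bad : #|A :\: A'| * (2 * #|A|) <= #|A| * #|A|.
    apply: leq_trans ti; rewrite big_distrr /= -sum_nat_const.
    rewrite [leqRHS](bigID (mem (A :\: A'))) /=; apply: leq_trans (leq_addr _ _).
    rewrite [leqRHS](eq_bigl (mem (A :\: A'))); last first.
      by move=> v /=; rewrite inE; case: (v \in A); rewrite ?andbF.
    apply: leq_sum => v; rewrite !inE negb_and => /andP[/orP[/negP//|+] vA].
    by rewrite -ltnNge => /ltnW; rewrite [#|C| * _]mulnC.
  have := cardsID A' A; have -> : A :&: A' = A'.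
    by apply/setP => v; rewrite !inE; case: (v \in A).
  by move: bad A0; clear; nia.
- by move=> v; rewrite inE => /andP[].
Qed.

Lemma vertex_colourable_extend C A i (W : {set T}) : i \in C -> W \subset A -> indep (G i) W ->
  vertex_colourable (C :\ i) (A :\: W) -> vertex_colourable C A.
Proof.
move=> iC WA /indepP Wi [kappa [kC kP]].
exists (fun x => if x \in W then i else kappa x); split.
  move=> x xA; case: ifP => // xW; have := kC x; rewrite !inE xW xA => /(_ isT).
  by case/andP.
have ki x : x \in A -> x \notin W -> kappa x != i.
  by move=> xA xW; have := kC x; rewrite !inE xW xA => /(_ isT)/andP[].
move=> x y xA yA; case: ifP => xW; case: ifP => yW.
- by move=> _; exact: Wi.
- by move=> e; have := ki y yA (negbT yW); rewrite -e eqxx.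
- by move=> e; have := ki x xA (negbT xW); rewrite e eqxx.
- by move=> e; apply: kP; rewrite ?inE ?xW ?yW.
Qed.

Lemma vertex_colourable_few C A : #|A| <= #|C| -> vertex_colourable C A.
Proof.
move=> AC.
have lt x : x \in A -> index x (enum A) < size (enum C).
  move=> xA; rewrite -cardE; apply: leq_trans AC; by rewrite [#|A|]cardE index_mem mem_enum.
exists (fun x => nth i0 (enum C) (index x (enum A))); split.
  by move=> x xA; rewrite -mem_enum; apply: mem_nth; exact: lt.
move=> x y xA yA /eqP; rewrite nth_uniq ?lt ?enum_uniq // => /eqP e.
have := congr1 (nth x (enum A)) e; rewrite !nth_index ?mem_enum // => ->.
by rewrite Girr.
Qed.

(** Each colour removes a greedy independent set of at least [#|C|] / 6 vertices. This lowers the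
    left side by 2n for n = [#|C|], more than n^2 - (n-1)^2. *)
Lemma vertex_colourable_quadratic C A : 12 * #|A| <= #|C| ^ 2 -> vertex_colourable C A.
Proof.
move: {2}(#|C|) (erefl #|C|) => n; elim: n C A => [|n IH] C A cC AC.
  apply: vertex_colourable_few; move: AC; rewrite cC; clear; case: #|A| => //.
have [le|CA] := leqP #|A| #|C|; first exact: vertex_colourable_few.
have C0 : 0 < #|C| by rewrite cC.
have [i [A' [iC A'A AA' deg]]] := sparse_colour A C0.
have [v|W [WA' Wi AW]] := @greedy_indep _ (G i) (Gsym i) (Girr i) A' (2 * #|A| %/ #|C|).
  move=> vA'; rewrite leq_divRL //; apply: leq_trans (deg v vA').
  rewrite leq_mul2r; apply/orP; right; apply: subset_leq_card; apply/subsetP => y.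
  by rewrite !inE => /andP[/(subsetP A'A) -> ->].
have WA := subset_trans WA' A'A.
apply: (vertex_colourable_extend iC WA Wi); apply: IH.
  by move: cC; rewrite (cardsD1 i C) iC => -[].
have c1 : #|C :\ i| = n by move: cC; rewrite (cardsD1 i C) iC => -[].
have c2 := cardsDS WA; have c3 := subset_leq_card WA.
have c4 : (2 * #|A| %/ #|C|) * #|C| <= 2 * #|A| by exact: leq_trunc_div.
have c5 : #|C| <= 6 * #|W|.
  have H : #|A| * #|C| <= 2 * (((2 * #|A| %/ #|C|) * #|C| + #|C|) * #|W|).
    apply: leq_trans (leq_mul AA' (leqnn _)) _.
    rewrite -mulnA leq_mul2l /=; apply: leq_trans (leq_mul AW (leqnn _)) _.
    by rewrite mulnAC mulSn addnC.
  have H' : #|A| * #|C| <= #|A| * (6 * #|W|).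
    apply: leq_trans H _.
    have : 2 * #|A| %/ #|C| * #|C| + #|C| <= 3 * #|A| by move: c4 CA; clear; lia.
    move: (_ + _) => z zA; have := leq_mul zA (leqnn #|W|); clear; lia.
  by move: H'; rewrite leq_pmul2l //; apply: leq_ltn_trans CA.
rewrite c1 c2; move: AC c5; rewrite cC; move: c3; clear; nia.
Qed.

(** While more than [p] colours remain, the sparsest one has degree at most D = 2 [#|A|] / p on half
    of [A], where Shearer's bound yields t p / 16 vertices. The last [p] colours are kept for the
    quadratic lemma, which takes over once 12 [#|A|] <= p^2; before that, D is large enough for
    Shearer's bound. *)
Lemma vertex_colourable_large e t lam p w :
  (forall i, clique_free (G i) e.+2 [set: T]) -> 0 < e -> 0 < t -> 0 < lam ->
  6 * 2 ^ (16 * lam * t * e + 4) <= p -> p ^ 2 <= 2 ^ (2 ^ lam) -> 16 * w <= t * p ->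
  forall j C A, j <= p -> p + j <= #|C| -> 12 * #|A| <= p ^ 2 + 12 * (j * w) ->
  vertex_colourable C A.
Proof.
move=> Gcf e0 t0 lam0 Hp1 Hp2 Hw.
have p0 : 0 < p by apply: leq_trans Hp1; rewrite muln_gt0 expn_gt0.
elim=> [|j IH] C A jp pC AC.
  apply: vertex_colourable_quadratic; apply: leq_trans AC _.
  by rewrite muln0 addn0 leq_exp2r // -[p]addn0.
have [small|big] := leqP (12 * #|A|) (p ^ 2).
  apply: vertex_colourable_quadratic; apply: leq_trans small _.
  by rewrite leq_exp2r //; apply: leq_trans pC; exact: leq_addr.
have C0 : 0 < #|C| by apply: leq_trans pC; rewrite addn_gt0 p0.
have [i [A' [iC A'A AA' deg]]] := sparse_colour A C0.
set D := 2 * #|A| %/ p.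
have D1 : p < 6 * D.+1.
  have := ltn_ceil (2 * #|A|) p0; rewrite -/D; move: big p0; rewrite -mulnn; clear; nia.
have D0 : 0 < D.
  rewrite lt0n; apply/eqP => D0; move: D1 Hp1; rewrite D0 addnC expnD.
  have : 0 < 2 ^ (16 * lam * t * e) by rewrite expn_gt0.
  move: (2 ^ (16 * _ * _ * _)); clear; lia.
pose L := (trunc_log 2 D).+1.
have DL : D < 2 ^ L by apply: trunc_log_ltn.
have LD : 2 ^ L <= 2 * D by rewrite expnS leq_mul2l trunc_logP.
have DA : D * p <= 2 * #|A| by exact: leq_trunc_div.
have tL : 16 * lam * t * e + 4 <= L.
  rewrite -ltnS -(ltn_exp2l _ _ (isT : 1 < 2)) expnS.
  have := leq_trans Hp1 (ltnW D1); move: (2 ^ (_ + 4)) (2 ^ L) DL; clear; lia.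
have tp : t <= p.
  apply: leq_trans Hp1; apply: (@leq_trans (2 ^ t)); first exact: ltnW (ltn_expl _ _).
  apply: (@leq_trans (2 ^ (16 * lam * t * e + 4))); last by rewrite leq_pmull.
  rewrite leq_exp2l //; apply: leq_trans (leq_addr _ _).
  by rewrite -!mulnA mulnA mulnCA leq_pmulr // !muln_gt0 lam0.
have Llam : L <= 2 ^ lam.
  rewrite -(@leq_exp2l 2) //; apply: leq_trans Hp2; apply: leq_trans LD _.
  rewrite -(leq_pmul2r p0) -mulnA; apply: (@leq_trans (2 * (2 * #|A|))); first by rewrite leq_mul2l DA.
  have : j.+1 * w <= p * w by rewrite leq_mul2r jp orbT.
  move: AC Hw tp p0; rewrite -!mulnn; clear; nia.
have degL v : v \in A' -> #|nbr (G i) A' v| <= 2 ^ L.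
  move=> vA'; apply: leq_trans (ltnW DL); rewrite leq_divRL //.
  apply: leq_trans (deg v vA'); apply: leq_mul; last by apply: leq_trans pC; exact: leq_addr.
  apply: subset_leq_card; apply/subsetP => y.
  by rewrite !inE => /andP[/(subsetP A'A) -> ->].
have A'cf : clique_free (G i) e.+2 A' by move=> K _; apply: Gcf; exact: subsetT.
have [W [WA' Wi tW]] := shearer (Gsym i) (Girr i) A'cf e0 t0 lam0 Llam tL degL.
have WA := subset_trans WA' A'A.
apply: (vertex_colourable_extend iC WA Wi); apply: IH; first exact: ltnW.
  by move: pC; rewrite (cardsD1 i C) iC addnS.
have A0 : 0 < #|A| by move: big; case: #|A|.
have wW : w <= #|W|.
  have H : t * p * #|A| <= 16 * #|W| * #|A|.
    apply: (@leq_trans (2 * p * (t * #|A'|))).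
      have -> : 2 * p * (t * #|A'|) = t * p * (2 * #|A'|) by clear; nia.
      by rewrite leq_mul2l AA' orbT.
    apply: (@leq_trans (2 * p * (2 * (2 * D) * #|W|))).
      rewrite leq_mul2l; apply/orP; right; apply: leq_trans tW _.
      by rewrite leq_mul2r; apply/orP; right; rewrite expnS leq_mul2l LD.
    have -> : 2 * p * (2 * (2 * D) * #|W|) = 8 * #|W| * (D * p) by clear; nia.
    have -> : 16 * #|W| * #|A| = 8 * #|W| * (2 * #|A|) by clear; nia.
    by rewrite leq_mul2l DA orbT.
  rewrite leq_pmul2r // in H; have := leq_trans Hw H; clear; lia.
rewrite (cardsDS WA); move: AC wW; rewrite (mulSn j w); move: (j * w) (p ^ 2) (subset_leq_card WA); clear; lia.
Qed.

End VertexColouring.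

(** * From minimal graphs to neighbourhoods without vertex colouring *)

Lemma minimal_nbhd_not_colourable k r n (e : rel 'I_n) (v : 'I_n) : 0 < r -> 2 < k ->
  ramsey_minimal e (complete_rel k) r ->
  exists G : 'I_r -> rel 'I_n, [/\ (forall i x y, G i x y = G i y x) /\ (forall i x, G i x x = false),
    forall i j x y, G i x y -> G j x y -> i = j,
    forall i, clique_free (G i) k [set: 'I_n] &
    ~ vertex_colourable G [set: 'I_r] [set u | e v u]].
Proof.
move=> r0 k2 [[esym eirr] [ear emin]].
pose e' x y := [&& e x y, x != v & y != v].
have e'sym x y : e' x y = e' y x by rewrite /e' esym; congr (_ && _); exact: andbC.
have na : ~ arrows [set~ v] e' (complete_rel k) r.
  apply: emin => //; first by move=> x y /and3P[-> xv yv]; rewrite !inE xv yv.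
  left; apply/eqP => /setP/(_ v); by rewrite !inE eqxx.
have [|chi [chisym chiP]] := not_arrows_colourable r0 e'sym _ (ltnW k2) na.
  by move=> x y /and3P[_ xv _]; rewrite !inE.
exists (fun i x y => e' x y && (chi x y == i)); split.
- by split=> [i x y|i x]; [rewrite e'sym chisym | rewrite /e' eirr].
- by move=> i j x y /andP[_ /eqP <-] /andP[_ /eqP <-].
- move=> i K _ KP; apply: (chiP i) => x y xK yK xy.
  by have /andP[-> /eqP] := KP x y xK yK xy.
- move=> [kappa [_ kP]].
  apply: (@colourable_not_arrows _ r k e setT) ear.
  (* A vertex colouring would tell how to colour the edges at [v]: a monochromatic clique through
     [v] would contain an edge [xy] of the common vertex colour of [x] and [y]. *)
  exists (fun x y => if x == v then kappa y else if y == v then kappa x else chi x y); split.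
    by move=> x y; case: (eqVneq x v) => [xv|_]; case: (eqVneq y v) => [yv|_] //; rewrite xv yv.
  move=> c K KP; rewrite ltnNge; apply/negP => kK.
  have [vK|vK] := boolP (v \in K); last first.
    have : #|K| < k; last by rewrite ltnNge kK.
    apply: (chiP c) => x y xK yK xy; have [exy] := KP x y xK yK xy.
    have xv : x != v by apply: contraNneq vK => <-.
    have yv : y != v by apply: contraNneq vK => <-.
    by rewrite (negbTE xv) (negbTE yv) /e' exy xv yv.
  have /card_gt1P[x [y [xK yK xy]]] : 1 < #|K :\ v|.
    by move: (leq_trans k2 kK); rewrite (cardsD1 v K) vK.
  move: xK yK; rewrite !inE => /andP[xv xK] /andP[yv yK].
  have vx : v != x by rewrite eq_sym.
  have vy : v != y by rewrite eq_sym.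
  have [evx] := KP v x vK xK vx; rewrite eqxx => kx.
  have [evy] := KP v y vK yK vy; rewrite eqxx => ky.
  have [exy cxy] := KP x y xK yK xy; rewrite (negbTE xv) (negbTE yv) in cxy.
  have := kP x y; rewrite !inE evx evy kx ky /e' exy xv yv cxy eqxx => /(_ isT isT erefl).
  by [].
Qed.

Lemma min_degree_gt k r n (e : rel 'I_n) b : 0 < r -> 0 < k ->
  ramsey_minimal e (complete_rel k) r -> (forall v, b < degree e v) -> b < min_degree e.
Proof.
move=> r0 k0 [[esym eirr] [ear _]] deg.
have [v _] : exists v : 'I_n, True.
  have [c [f _]] := ear (fun _ _ => Ordinal r0) (fun _ _ _ => erefl).
  by exists (f (Ordinal k0)).
have bn : b < n.
  apply: leq_trans (deg v) _; rewrite /degree; apply: leq_trans (max_card _) _; by rewrite card_ord.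
rewrite /min_degree; elim/big_ind: _ => // x y bx b_y.
by rewrite leq_min bx.
Qed.

Theorem min_degree_lower_nat e r n (E : rel 'I_n) t lam p w : 0 < e -> 0 < r -> 2 * p <= r ->
  ramsey_minimal E (complete_rel e.+2) r -> 0 < t -> 0 < lam ->
  6 * 2 ^ (16 * lam * t * e + 4) <= p -> p ^ 2 <= 2 ^ (2 ^ lam) -> 16 * w <= t * p ->
  p * w < min_degree E.
Proof.
move=> e0 r0 pr Em t0 lam0 Hp1 Hp2 Hw.
apply: (min_degree_gt r0 _ Em) => // v; rewrite ltnNge; apply/negP => le.
have [G [[Gs Gi] Gd Gcf nc]] := minimal_nbhd_not_colourable v r0 (e0 : 2 < e.+2) Em.
apply: nc; apply: (vertex_colourable_large (Ordinal r0) Gs Gi Gd Gcf e0 t0 lam0 Hp1 Hp2 Hw (leqnn p)).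
  by rewrite cardsT card_ord addnn -mul2n.
by apply: leq_trans (leq_addl _ _); rewrite leq_mul2l.
Qed.

Lemma min_degree_gt0 k r n (E : rel 'I_n) : 2 < k -> 0 < r ->
  ramsey_minimal E (complete_rel k) r -> 0 < min_degree E.
Proof.
move=> k2 r0 Em; apply: (min_degree_gt r0 _ Em) => [|v]; first exact: leq_trans k2.
rewrite lt0n; apply/eqP => d0.
have [G [[Gs Gi] Gd Gcf nc]] := minimal_nbhd_not_colourable v r0 k2 Em.
by apply: nc; apply: (vertex_colourable_few (Ordinal r0) Gi); rewrite -/(degree E v) d0.
Qed.

(** * Asymptotics *)

Lemma expn_dominates K e : exists M, [/\ 0 < M, e < M & K * M ^ e <= 2 ^ (M - 1 - e)].
Proof.
pose kap := K + 1 + e; pose b := kap + 2 * e + 1.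
exists (2 ^ (2 * b)).
have Hb : kap + 2 * b * e <= 2 ^ (2 * b).
  rewrite mul2n -addnn expnD; apply: (@leq_trans (b.+1 * b.+1)).
    by rewrite /b; move: (kap) => z; clear; nia.
  by apply: leq_mul; apply: ltn_expl.
have bM : b < 2 ^ (2 * b) by apply: leq_ltn_trans (ltn_expl _ (isT : 1 < 2)); rewrite leq_pmull.
split; first by rewrite expn_gt0.
- by apply: leq_ltn_trans bM; rewrite /b; clear; lia.
- rewrite -expnM; apply: (@leq_trans (2 ^ K * 2 ^ (2 * b * e))).
    by rewrite leq_mul2r ltnW ?orbT // ltn_expl.
  by rewrite -expnD leq_exp2l // ; move: Hb; rewrite /kap; move: (2 * b * e) (2 ^ (2 * b)); clear; lia.
Qed.

(** The least admissible [h] is at most [M * L], and the failure of its predecessor bounds 2^h from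
    above, up to the factor 2. *)
Lemma exponent_choice K e : 0 < K -> 0 < e -> exists M, 0 < M /\ forall r L, 0 < r -> 0 < L -> r <= 2 ^ L ->
  exists h, [/\ 0 < h, K * r * h ^ e <= 2 ^ h & 2 ^ h <= 2 * K * r * (M * L) ^ e].
Proof.
move=> K0 e0; have [M [M0 eM HM]] := expn_dominates K e; exists M; split=> // r L r0 L0 rL.
have ML : (0 < M * L) && (K * r * (M * L) ^ e <= 2 ^ (M * L)).
  rewrite muln_gt0 M0 L0 /=.
  apply: (@leq_trans (2 ^ L * (2 ^ (M - 1 - e) * 2 ^ (L * e)))).
    rewrite [K * r]mulnC -mulnA; apply: leq_mul rL _; rewrite expnMn mulnA; apply: leq_mul HM _.
    by rewrite expnM leq_exp2r // ltnW // ltn_expl.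
  rewrite -!expnD leq_exp2l //; move: eM L0; clear; nia.
have ex : exists h, (0 < h) && (K * r * h ^ e <= 2 ^ h) by exists (M * L).
case: (ex_minnP ex) => h /andP[h0 Kh] hmin; exists h; split=> //.
have hML : h <= M * L := hmin _ ML.
case: h h0 hmin hML {Kh} => // -[|h] _ hmin hML.
  by rewrite expn1 -!mulnA leq_pmulr // !muln_gt0 K0 r0 expn_gt0 muln_gt0 M0 L0.
have lt : 2 ^ h.+1 < K * r * h.+1 ^ e.
  by rewrite ltnNge; apply/negP => le; have := hmin h.+1; rewrite le ltnn => /(_ isT).
rewrite expnS -!mulnA leq_mul2l /=; apply: leq_trans (ltnW lt) _.
by rewrite -mulnA leq_mul2l leq_mul2l leq_exp2r // (ltnW hML) !orbT.
Qed.

Lemma sq_le_pow n : n ^ 2 <= 4 * 2 ^ n.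
Proof.
have [|n4] := leqP 4 n; last by case: n n4 => [|[|[|[|]]]].
elim: n => // n IH; rewrite leq_eqVlt => /orP[/eqP <- //|]; rewrite ltnS => n4.
have := IH n4; rewrite [2 ^ n.+1]expnS; move: (2 ^ n) => z; rewrite -!mulnn; move: n4; clear; nia.
Qed.

(** Here [l] is log r, [lam] about log log r, and t = (l - 8) / (16 lam e) the largest value for
    which [p], half of [r], meets Shearer's condition. If t = 0, then l = O(lam) while 2^lam = O(l),
    which bounds [r]: the first alternative. *)
Lemma lower_parameters e r : 0 < e -> 3 <= r ->
  let l := trunc_log 2 r in let lam := (trunc_log 2 (2 * l + 2)).+1 in
  l <= 16 * (4 * (64 * e + 36)) * e + 8 \/
  exists t p w, [/\ [/\ 2 * p <= r, 0 < t & 6 * 2 ^ (16 * lam * t * e + 4) <= p],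
    p ^ 2 <= 2 ^ (2 ^ lam), 16 * w <= t * p &
    [/\ l <= 64 * (t * lam * e), r <= 3 * p, t * p <= 32 * w & 0 < l]].
Proof.
move=> e0 r3 l lam.
have r0 : 0 < r by apply: ltn_trans r3.
have lam0 : 0 < lam by [].
have lr : 2 ^ l <= r by apply: trunc_logP.
have rl : r < 2 ^ l.+1 by apply: trunc_log_ltn.
have lamU : 2 * l + 2 < 2 ^ lam by apply: trunc_log_ltn.
have lamL : 2 ^ lam <= 2 * (2 * l + 2).
  by rewrite /lam expnS leq_mul2l trunc_logP // addn2.
pose t := (l - 8) %/ (16 * lam * e).
have d0 : 0 < 16 * lam * e by rewrite !muln_gt0 e0.
have [t0|t0] := posnP t.
  left; have lt : l - 8 < 16 * lam * e by have := ltn_ceil (l - 8) d0; rewrite -/t t0 mul1n.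
  have H1 : lam ^ 2 <= 4 * (64 * e + 36) * lam.
    apply: leq_trans (sq_le_pow lam) _; rewrite -mulnA leq_mul2l /=.
    apply: leq_trans lamL _; move: lt lam0; clear; nia.
  have H2 : lam <= 4 * (64 * e + 36) by rewrite -mulnn leq_pmul2r in H1.
  have H3 : 16 * lam * e <= 16 * (4 * (64 * e + 36)) * e by do 2?apply: leq_mul.
  move: lt H3; move: (16 * lam * e) (16 * _ * e); clear; lia.
right; exists t, (r %/ 2), (t * (r %/ 2) %/ 16).
have tl : t * (16 * lam * e) <= l - 8 by exact: leq_trunc_div.
have tl' : l - 8 < t.+1 * (16 * lam * e) by exact: ltn_ceil.
have l24 : 24 <= l.
  have : 16 <= t * (16 * lam * e).
    have H0 : 0 < t * (lam * e) by rewrite !muln_gt0 t0 e0.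
    have -> : t * (16 * lam * e) = 16 * (t * (lam * e)) by clear; nia.
    by move: H0; move: (t * (lam * e)); clear; lia.
  move: tl; clear; lia.
have pr : r %/ 2 * 2 <= r := leq_trunc_div _ _.
have rp : r < (r %/ 2).+1 * 2 by apply: ltn_ceil.
have Hp : 6 * 2 ^ (16 * lam * t * e + 4) <= r %/ 2.
  have X : 2 ^ (16 * lam * t * e + 8) <= r.
    apply: leq_trans lr; rewrite leq_exp2l //.
    have -> : 16 * lam * t * e = t * (16 * lam * e) by clear; nia.
    move: tl l24; clear; lia.
  move: X rp; rewrite -[8]/(4 + 4) addnA expnD; move: (2 ^ (_ + 4)) (r %/ 2); clear.
  move=> a b; rewrite -[2 ^ 4]/16; lia.
have p96 : 96 <= r %/ 2.
  apply: leq_trans Hp; rewrite addnC expnD mulnA leq_pmulr // expn_gt0 //.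
split; [split=> //; by rewrite mulnC | | | split].
- apply: leq_trans (_ : (2 ^ l.+1) ^ 2 <= _).
    by rewrite leq_exp2r //; apply: leq_trans (ltnW rl); rewrite leq_div.
  by rewrite -expnM leq_exp2l // ltnW // ; move: lamU; clear; lia.
- by rewrite mulnC leq_trunc_div.
- move: tl' l24 t0; clear; nia.
- move: pr rp p96; clear; lia.
- have := ltn_ceil (t * (r %/ 2)) (isT : 0 < 16).
  have : 16 <= t * (r %/ 2) by move: p96 t0; clear; nia.
  move: (_ %/ 16); clear; lia.
- by apply: leq_trans l24.
Qed.

Lemma INR_mul a b : INR (a * b) = Rmult (INR a) (INR b).
Proof. by rewrite -mult_INR. Qed.

Lemma INR_exp a b : INR (a ^ b) = pow (INR a) b.
Proof. by elim: b => [|b IH]; [rewrite expn0|rewrite expnS INR_mul IH]. Qed.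

Lemma INR_leq a b : a <= b -> Rle (INR a) (INR b).
Proof. by move/leP; exact: le_INR. Qed.

Lemma INR_gt0 a : 0 < a -> Rlt 0 (INR a).
Proof. by move/ltP; exact: lt_0_INR. Qed.

Section RealBounds.
Local Open Scope R_scope.

(** Needed so that ln 3 > 1 and ln (ln r) is positive already at r = 3. The bound (n/(n-1))^n on e
    falls below 3 first at n = 6. *)
Lemma exp1_lt_3 : exp 1 < 3.
Proof.
have H : 5 / 6 <= exp (- (1 / 6)) by have := exp_ineq1_le (- (1 / 6)); lra.
have E : exp 1 = (/ exp (- (1 / 6))) ^ 6.
  rewrite -exp_Ropp Ropp_involutive.
  have -> : exp 1 = exp (1 / 6 + (1 / 6 + (1 / 6 + (1 / 6 + (1 / 6 + 1 / 6))))) by congr exp; field.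
  by rewrite !exp_plus; ring.
have P : 0 < exp (- (1 / 6)) := exp_pos _.
have I : / exp (- (1 / 6)) <= 6 / 5.
  have -> : 6 / 5 = / (5 / 6) by field.
  by apply: Rinv_le_contravar; lra.
rewrite E; apply: (Rle_lt_trans _ ((6 / 5) ^ 6)); last lra.
by apply: pow_incr; split => //; left; apply: Rinv_0_lt_compat.
Qed.

Lemma ln_le' x y : 0 < x -> x <= y -> ln x <= ln y.
Proof. by move=> x0 [xy|->]; [left; apply: ln_increasing | right]. Qed.

Lemma ln3_gt1 : 1 < ln 3.
Proof. by rewrite -{1}(ln_exp 1); apply: ln_increasing; [exact: exp_pos | exact: exp1_lt_3]. Qed.

Lemma ln_ge_ln3 r : (3 <= r)%N -> ln 3 <= ln (INR r).
Proof.
move=> r3; apply: ln_le'; first lra.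
by have := INR_leq r3; rewrite /=; lra.
Qed.

Lemma ln2_le1 : ln 2 <= 1.
Proof.
rewrite -(ln_exp 1); apply: ln_le'; first lra.
have := exp_ineq1_le 1; lra.
Qed.

Lemma ln_pow2 n : ln (INR (2 ^ n)) = INR n * ln 2.
Proof. by rewrite INR_exp ln_pow //=; lra. Qed.

Lemma trunc_log_ln r : (3 <= r)%N -> INR (trunc_log 2 r).+1 <= 3 * ln (INR r).
Proof.
move=> r3; have r0 : (0 < r)%N by apply: ltn_trans r3.
have l1 := ln_ge_ln3 r3; have := ln3_gt1 => l3.
have H : INR (trunc_log 2 r) * ln 2 <= ln (INR r).
  rewrite -ln_pow2; apply: ln_le'; first by apply: INR_gt0; rewrite expn_gt0.
  by apply: INR_leq; apply: trunc_logP.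
have l2 := ln_lt_2; rewrite S_INR; have p0 := pos_INR (trunc_log 2 r).
have : INR (trunc_log 2 r) <= 2 * ln (INR r) by nra.
lra.
Qed.

Lemma upper_real K e E : (0 < K)%N -> (0 < e)%N -> (2 * e <= E)%N -> exists C, 0 < C /\
  forall r, (3 <= r)%N -> exists h, [/\ (0 < h)%N, (K * r * h ^ e <= 2 ^ h)%N &
    INR (2 ^ (2 * h)) <= C * INR r ^ 2 * ln (INR r) ^ E].
Proof.
move=> K0 e0 eE; have [M [M0 HM]] := exponent_choice K0 e0.
have KP : 0 < INR K := INR_gt0 K0; have MP : 0 < INR M := INR_gt0 M0.
exists ((2 * INR K * (3 * INR M) ^ e) ^ 2); split.
  by apply: pow_lt; apply: Rmult_lt_0_compat; [lra | apply: pow_lt; lra].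
move=> r r3; have r0 : (0 < r)%N by apply: ltn_trans r3.
have l1 := ln_ge_ln3 r3; have l3 := ln3_gt1.
have [h [h0 Kh hb]] := HM r (trunc_log 2 r).+1 r0 (ltn0Sn _) (ltnW (trunc_log_ltn r (isT : (1 < 2)%N))).
exists h; split=> //; rewrite mulnC expnM INR_exp.
have rP : 0 < INR r := INR_gt0 r0.
have hb' : INR (2 ^ h) <= 2 * INR K * INR r * ((3 * INR M) ^ e * ln (INR r) ^ e).
  apply: Rle_trans (INR_leq hb) _; rewrite !INR_mul INR_exp INR_mul -Rpow_mult_distr.
  apply: Rmult_le_compat_l; first by repeat apply: Rmult_le_pos; try lra; exact: pos_INR.
  apply: pow_incr; split; first by apply: Rmult_le_pos; [lra | exact: pos_INR].
  have := trunc_log_ln r3; nra.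
apply: Rle_trans (_ : (2 * INR K * INR r * ((3 * INR M) ^ e * ln (INR r) ^ e)) ^ 2 <= _).
  by apply: pow_incr; split=> //; exact: pos_INR.
have -> : (2 * INR K * INR r * ((3 * INR M) ^ e * ln (INR r) ^ e)) ^ 2 =
  (2 * INR K * (3 * INR M) ^ e) ^ 2 * INR r ^ 2 * (ln (INR r) ^ e) ^ 2 by ring.
apply: Rmult_le_compat_l.
  by apply: Rmult_le_pos; apply: pow2_ge_0.
rewrite -pow_mult; apply: Rle_pow; first lra.
by apply/leP; rewrite multE mulnC.
Qed.

(** For bounded [r] the trivial bound 1 <= s is enough with [c2]; beyond that, [lower_parameters]
    gives s of order t r^2. *)
Lemma lower_real e : (0 < e)%N -> exists c, 0 < c /\ forall r s, (3 <= r)%N -> (0 < s)%N ->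
  (forall t lam p w, (2 * p <= r)%N -> (0 < t)%N -> (0 < lam)%N ->
    (6 * 2 ^ (16 * lam * t * e + 4) <= p)%N -> (p ^ 2 <= 2 ^ (2 ^ lam))%N ->
    (16 * w <= t * p)%N -> (p * w < s)%N) ->
  c * INR r ^ 2 * ln (INR r) / ln (ln (INR r)) <= INR s.
Proof.
move=> e0; set d := ln (ln 3).
have l3 := ln3_gt1.
have d0 : 0 < d by rewrite -ln_1; apply: ln_increasing; lra.
set l0 := (16 * (4 * (64 * e + 36)) * e + 8)%N.
set R0 := INR (2 ^ l0.+1).
have R00 : 1 <= R0 by rewrite -INR_1; apply: INR_leq; rewrite expn_gt0.
have eP : 0 < INR e := INR_gt0 e0.
set D := 4 / d + 2.
have D0 : 0 < D by apply: Rplus_lt_0_compat; [apply: Rdiv_lt_0_compat|]; lra.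
(* 36864 = 2 * 64 * 288: ln r <= 2 l, l <= 64 t lam e, and t r^2 <= 288 s, where 288 = 9 * 32. The
   constant [D] satisfies lam <= D ln (ln r), its part 4 / d absorbing an additive 4. *)
set c1 := / (36864 * INR e * D); set c2 := d / R0 ^ 3.
have c10 : 0 < c1 by apply: Rinv_0_lt_compat; repeat apply: Rmult_lt_0_compat; lra.
have R03 : 0 < R0 ^ 3 by apply: pow_lt; lra.
have c20 : 0 < c2 by apply: Rdiv_lt_0_compat.
exists (Rmin c1 c2); split; first by apply: Rmin_glb_lt.
move=> r s r3 s0 Hs.
have r0 : (0 < r)%N by apply: ltn_trans r3.
have rP : 0 < INR r := INR_gt0 r0.
have lr3 := ln_ge_ln3 r3.
have llr : d <= ln (ln (INR r)) by apply: ln_le'; lra.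
have s1 : 1 <= INR s by rewrite -INR_1; apply: INR_leq.
suff [c [cm H]] : exists c, Rmin c1 c2 <= c /\ c * (INR r ^ 2 * ln (INR r)) <= INR s * ln (ln (INR r)).
  apply: (Rmult_le_reg_r (ln (ln (INR r)))); first lra.
  have -> : Rmin c1 c2 * INR r ^ 2 * ln (INR r) / ln (ln (INR r)) * ln (ln (INR r)) =
     Rmin c1 c2 * (INR r ^ 2 * ln (INR r)) by field; lra.
  apply: Rle_trans H; apply: Rmult_le_compat_r => //.
  by apply: Rmult_le_pos; [apply: pow2_ge_0 | lra].
have [small|[t [p [w [[pr t0 Hp] Hp2 Hw [lt rp tw lpos]]]]]] := lower_parameters e0 r3.
  exists c2; split; first exact: Rmin_r.
  have rR : INR r <= R0.
    apply: INR_leq; apply: leq_trans (ltnW (trunc_log_ltn r (isT : (1 < 2)%N))) _.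
    by rewrite leq_exp2l.
  have lnr : ln (INR r) <= INR r.
    have := exp_ineq1_le (ln (INR r)); rewrite exp_ln //; lra.
  have B : INR r ^ 2 * ln (INR r) <= R0 ^ 3.
    have -> : R0 ^ 3 = R0 ^ 2 * R0 by ring.
    apply: Rmult_le_compat; [exact: pow2_ge_0 | lra | apply: pow_incr; lra | lra].
  apply: Rle_trans (_ : c2 * R0 ^ 3 <= _); first by apply: Rmult_le_compat_l; lra.
  have -> : c2 * R0 ^ 3 = d by rewrite /c2; field; lra.
  nra.
exists c1; split; first exact: Rmin_l.
move: (trunc_log 2 r) (trunc_log_ln r3) (trunc_logP (isT : (1 < 2)%N) r0)
  (trunc_log_ltn r (isT : (1 < 2)%N)) Hp Hp2 lt lpos => l _ lr rl.
set lam := (trunc_log 2 (2 * l + 2)).+1 => Hp Hp2 lt lpos.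
have sw := Hs t lam p w pr t0 (ltn0Sn _) Hp Hp2 Hw.
have l2 := ln_lt_2; have l2' := ln2_le1.
have Hl1 : INR l * ln 2 <= ln (INR r).
  by rewrite -ln_pow2; apply: ln_le'; [apply: INR_gt0; rewrite expn_gt0 | exact: INR_leq].
have lge1 : 1 <= INR l by rewrite -INR_1; apply: INR_leq.
have Hl2 : ln (INR r) <= 2 * INR l.
  have : ln (INR r) <= INR l.+1 * ln 2.
    by rewrite -ln_pow2; apply: ln_le' => //; apply: INR_leq; exact: ltnW.
  rewrite S_INR; nra.
have Hlam : INR lam <= D * ln (ln (INR r)).
  have lamL : (2 ^ lam <= 2 * (2 * l + 2))%N by rewrite /lam expnS leq_mul2l trunc_logP // addn2.
  have : INR lam * ln 2 <= 4 * ln 2 + ln (ln (INR r)).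
    rewrite -ln_pow2.
    have -> : 4 * ln 2 = ln 16.
      have -> : 16 = 2 ^ 4 by ring.
      by rewrite ln_pow /=; lra.
    rewrite -ln_mult; [|lra|lra]; apply: ln_le'; first by apply: INR_gt0; rewrite expn_gt0.
    apply: Rle_trans (INR_leq lamL) _.
    rewrite INR_mul plus_INR INR_mul /=; nra.
  have dd : 4 <= 4 / d * ln (ln (INR r)).
    have : 4 / d * d <= 4 / d * ln (ln (INR r)).
      by apply: Rmult_le_compat_l => //; apply: Rlt_le; apply: Rdiv_lt_0_compat; lra.
    have -> : 4 / d * d = 4 by field; lra.
    by [].
  have := pos_INR lam; rewrite /D Rmult_plus_distr_r; nra.
have W1 : INR p * INR w <= INR s by rewrite -INR_mul; apply: INR_leq; exact: ltnW.
have W2 : INR t * INR p <= 32 * INR w.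
  by have := INR_leq tw; rewrite !INR_mul /=; lra.
have W3 : INR r <= 3 * INR p by have := INR_leq rp; rewrite INR_mul /=; lra.
have W4 : INR l <= 64 * (INR t * INR lam * INR e).
  by have := INR_leq lt; rewrite !INR_mul /=; lra.
have pP := pos_INR p; have tP : 0 < INR t := INR_gt0 t0; have wP := pos_INR w.
have S1 : INR t * INR r ^ 2 <= 288 * INR s.
  have A1 : INR r ^ 2 <= 9 * (INR p * INR p) by nra.
  have A2 : INR p * (INR t * INR p) <= INR p * (32 * INR w) by apply: Rmult_le_compat_l.
  nra.
have S2 : INR l * INR r ^ 2 <= 64 * 288 * INR e * INR lam * INR s.
  have R2 : 0 <= INR r ^ 2 := pow2_ge_0 _.
  apply: Rle_trans (_ : 64 * (INR t * INR lam * INR e) * INR r ^ 2 <= _).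
    exact: Rmult_le_compat_r.
  have -> : 64 * (INR t * INR lam * INR e) * INR r ^ 2 = 64 * (INR lam * INR e) * (INR t * INR r ^ 2) by ring.
  have -> : 64 * 288 * INR e * INR lam * INR s = 64 * (INR lam * INR e) * (288 * INR s) by ring.
  apply: Rmult_le_compat_l => //; have := pos_INR lam; nra.
apply: (Rmult_le_reg_l (36864 * INR e * D)).
  by repeat apply: Rmult_lt_0_compat; lra.
have -> : 36864 * INR e * D * (c1 * (INR r ^ 2 * ln (INR r))) = INR r ^ 2 * ln (INR r).
  rewrite /c1; field; split; lra.
apply: Rle_trans (_ : INR r ^ 2 * (2 * INR l) <= _).
  by apply: Rmult_le_compat_l; [exact: pow2_ge_0 | lra].
apply: Rle_trans (_ : 2 * (64 * 288 * INR e * (D * ln (ln (INR r))) * INR s) <= _); last first.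
  by apply: Req_le; ring.
apply: Rle_trans (_ : 2 * (64 * 288 * INR e * INR lam * INR s) <= _); first lra.
apply: Rmult_le_compat_l; first lra.
apply: Rmult_le_compat_r; first lra.
by apply: Rmult_le_compat_l; lra.
Qed.
End RealBounds.

Unset Implicit Arguments.

Theorem theorem2 :
  forall k : nat, (4 <= k)%N ->
  exists c C : R, Rlt 0 c /\ Rlt 0 C /\
    forall r : nat, (3 <= r)%N ->
    exists s : nat, is_s_r r (complete_rel k) s /\
      Rle (Rdiv (Rmult (Rmult c (pow (INR r) 2)) (ln (INR r))) (ln (ln (INR r))))
          (INR s) /\
      Rle (INR s)
          (Rmult (Rmult C (pow (INR r) 2)) (pow (ln (INR r)) (8 * (k - 1) ^ 2)%N)).
Proof.
(* From here k = e + 2: the upper bound takes s = e + 1 parts, and Shearer's theorem is applied to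
   K_(e+2)-free graphs. *)
case=> // -[//|e] e2; have e0 : 0 < e by case: e e2.
have [K [K0 up]] := @min_degree_upper_nat e.+1 e0.
(* The outer factor 2 comes from squaring q; the larger exponent is harmless because ln r > 1. *)
have eE : 2 * (2 * 'C(e.+1, 2)) <= 8 * (e.+2 - 1) ^ 2.
  by rewrite subn1 /=; have := bin_leq_expn e.+1 2; move: 'C(_, _) (_ ^ 2); clear; lia.
have C0 : 0 < 2 * 'C(e.+1, 2) by rewrite muln_gt0 bin_gt0.
have [C [CP upC]] := upper_real K0 C0 eE.
have [c [cP lowc]] := lower_real e0.
exists c, C; split=> //; split=> // r r3.
have r1 : 1 < r by apply: ltn_trans r3.
have [h [h0 Kh hC]] := upC r r3.
have [n [E [Em Ed]]] := up r h r1 h0 Kh.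
have [s [[n' [E' [Em' Es']]] smin]] : exists s, (exists (n : nat) (E : rel 'I_n),
    ramsey_minimal E (complete_rel e.+2) r /\ min_degree E = s) /\
    forall m, m < s -> ~ exists (n : nat) (E : rel 'I_n),
    ramsey_minimal E (complete_rel e.+2) r /\ min_degree E = m.
  by apply: ex_minimal; exists (min_degree E), n, E.
have sle (n1 : nat) (E1 : rel 'I_n1) : ramsey_minimal E1 (complete_rel e.+2) r -> s <= min_degree E1.
  move=> E1m; rewrite leqNgt; apply/negP => lt; apply: (smin _ lt); by exists n1, E1.
exists s; split; first by split=> //; exists n', E'.
split.
  apply: lowc => //; rewrite -Es'; first by apply: min_degree_gt0 Em'; [|exact: ltnW].
  move=> t lam p w pr t0 lam0 Hp Hp2 Hw.
  exact: (min_degree_lower_nat e0 (ltnW r1) pr Em' t0 lam0 Hp Hp2 Hw).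
apply: Rle_trans hC; apply: INR_leq; apply: leq_trans Ed; exact: sle.
Qed.
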